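(* Let $R$ be a two-dimensional regular local ring, let $f\in R$ be a curve and let $\mathcal C$ be the cluster of a resolution of $f$. (i) For every $S\in\mathcal C$, $$\mathrm{ord}_S\big((fR)^S\big)=\sum_{T\succ S}[T:S]\,\mathrm{ord}_T\big((fR)^T\big),$$ where the sum is over all points $T$ proximate to $S$. (ii) Let $S\in\mathcal C$. For any $T\in N(R)$ and any curvette $g\in T$, $$\mathrm{ord}_S\big((gT\cap R)^S\big)=\sum_{T'\succ S}[T':S]\,\mathrm{ord}_{T'}\big((gT\cap R)^{T'}\big),$$ where the sum is over all points $T'$ proximate to $S$.
   Context: $R$ is a two-dimensional regular local ring with maximal ideal $\mathfrak m_R$ and quotient field $\mathcal K$. A curve in $R$ is a non-zero principal ideal $fR$ (identified with its equation $f\ne0$, determined up to units). Order: $\mathrm{ord}_S(h)=m$ if $h\in\mathfrak m_S^m\setminus\mathfrak m_S^{m+1}$; for a non-zero ideal $\mathfrak a$ of $S$, $\mathrm{ord}_S(\mathfrak a)$ is the minimum of the orders of its elements (so $\mathrm{ord}_S(S)=0$). $V_S$ is the valuation ring of $\mathcal K$ of the discrete valuation extending $\mathrm{ord}_S$. Infinitely near points: $N_1(S)$ is the set of quadratic transforms of $S$ (the local rings at the closed points of the exceptional fibre of the blowing-up of the closed point of $\mathrm{Spec}(S)$); $N_0(R)=\{R\}$, $N_i(R)$ is the set of quadratic transforms of rings in $N_{i-1}(R)$, and $N(R)=\bigcup_{i\ge0}N_i(R)=\Omega(R)$, the set of all two-dimensional regular local subrings of $\mathcal K$ containing $R$ with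 quotient field $\mathcal K$. For $S\subset T$ in $N(R)$ there is a unique chain of successive quadratic transforms from $S$ to $T$ (the quadratic sequence), and $[T:S]:=[k_T:k_S]$ is the finite degree of the residue field extension. For $S\subsetneqq T$ in $N(R)$, $T$ is proximate to $S$ ($T\succ S$) if $T\subset V_S$; $\succ$ is used between distinct points only. A cluster over $R$ is a finite subset $\mathcal C$ of $N(R)$ containing $R$ and containing, with each $R'$, all members of the quadratic sequence between $R$ and $R'$. The cluster of a resolution of $f$ is the cluster of the points blown up in a finite sequence of blowing-ups of closed points, starting with the closed point of $R$, which resolves the curve $f$. Strict transform: for $S\in N(R)$ and a non-zero principal ideal $hR$, $(hR)^S$ is computed step by step along the quadratic sequence; for one quadratic transform $R\subset S$ with $\mathfrak m_RS=xS$, $(hR)^S=x^{-\mathrm{ord}_R(h)}hS$. Exceptional divisor in $T\in N(R)$, with quadratic sequence $R=R_0\subset\dots\subset R_n=T$: $E_{R_1}=\mathfrak m_{R_0}R_1$ and $E_{R_i}=\mathfrak m_{R_{i-1}}R_i\cdot(E_{R_{i-1}})^{R_i}$ for $i>1$. Curvette (relative to the given $f$): let $T\in N(R)$ be such that $(fR)^T=T$ (i.e. $T$ is not in the point locus of $f$) and $T$ is not the intersection of two components of the exceptional divisor, so that $E_T=xT$ with $x$ a regular parameter. A curvette at $T$ is an element $g\in T$ which is normal-crossing, i.e. $\{x,g\}$ is a regular system of parameters of $T$, such that $(gT\cap R)^T$ has order $1$ in $T$ and $(gT\cap R)^{S'}=S'$ for every $S'\in N(R)$ with $S'\nsupseteq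 T$ and $S'\nsubseteq T$. *)

(* Defs.v *)
From mathcomp Require Import all_boot all_algebra.
From mathcomp Require Import boolp classical_sets cardinality fsbigop.

Set Implicit Arguments.
Unset Strict Implicit.
Unset Printing Implicit Defensive.

Import GRing.Theory.
Local Open Scope classical_set_scope.
Local Open Scope ring_scope.

(* Rings are subrings of a fixed field K, given as sets of elements of K, and
   their ideals are sets of elements of K too.  Functions defined by [xget]
   take a junk value when the described object does not exist. *)

Section LocalAlgebra.
Variable K : fieldType.
Implicit Types (A B S T I J M P Q : set K) (x y z h : K) (n : nat).

Definition is_subring A := GRing.subring_closed [in A].

Definition is_ideal A I :=
  [/\ I `<=` A, I 0, forall x y, I x -> I y -> I (x + y)
    & forall a x, A a -> I x -> I (a * x)].

Definition ideal_gen A (X : set K) : set K := smallest (is_ideal A) X.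

Definition pideal A x : set K := [set x * a | a in A].

Definition ideal_mul A I J := ideal_gen A [set x * y | x in I & y in J].

Fixpoint ideal_pow A I n : set K :=
  if n is n'.+1 then ideal_mul A I (ideal_pow A I n') else A.

Definition is_prime A P :=
  [/\ is_ideal A P, ~ P 1
    & forall x y, A x -> A y -> P (x * y) -> P x \/ P y].

Definition is_maximal A M :=
  [/\ is_ideal A M, ~ M 1
    & forall J, is_ideal A J -> M `<=` J -> J = M \/ J = A].

Definition is_noetherian A :=
  forall I, is_ideal A I ->
    exists X, [/\ finite_set X, X `<=` A & I = ideal_gen A X].

Definition is_local A := exists! M, is_maximal A M.

Definition maxid A : set K := xget set0 (is_maximal A).

Definition has_prime_chain A n :=
  exists P : nat -> set K,
    (forall i, (i <= n)%N -> is_prime A (P i)) /\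
    (forall i, (i < n)%N -> P i `<` P i.+1).

Definition krull_dim A n := has_prime_chain A n /\ ~ has_prime_chain A n.+1.

Definition regular_local_ring A d :=
  [/\ is_subring A, is_noetherian A, is_local A, krull_dim A d
    & exists s : d.-tuple K, maxid A = ideal_gen A [set` s]].

Definition is_quotient_field A :=
  forall z, exists a b, [/\ A a, A b, b != 0 & z = a / b].

Definition is_rsp A x y := maxid A = ideal_gen A [set x; y].

Definition ord S h : nat :=
  xget 0%N [set m | ideal_pow S (maxid S) m h /\
                    ~ ideal_pow S (maxid S) m.+1 h].

(* The order of 0 is infinite, so the minimum runs over non-zero elements. *)
Definition ordI S I : nat :=
  xget 0%N [set m | (exists h, [/\ I h, h != 0 & ord S h = m]) /\
                    (forall h, I h -> h != 0 -> (m <= ord S h)%N)].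

Definition ord_valuation_ring S : set K :=
  [set z | exists a b, [/\ S a, S b, b != 0, z = a / b
                         & a = 0 \/ (ord S b <= ord S a)%N]].

Definition localization B Q : set K :=
  [set z | exists a b, [/\ B a, B b, ~ Q b & z = a / b]].

(* The ring S[m_S / x], i.e. the affine chart of the blowing-up of the closed
   point of Spec S on which m_S is generated by x. *)
Definition blowup_chart S x : set K :=
  smallest is_subring (S `|` [set y / x | y in maxid S]).

Definition quadratic_transform S T :=
  exists x Q, [/\ maxid S x, x != 0, is_maximal (blowup_chart S x) Q,
    maxid S `<=` Q & T = localization (blowup_chart S x) Q].

Fixpoint near_points_at S n : set (set K) :=
  if n is n'.+1
  then [set T | exists2 S', near_points_at S n' S' & quadratic_transform S' T]
  else [set S].

Definition near_points S : set (set K) := \bigcup_n near_points_at S n.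

Definition proximate R S T :=
  [/\ near_points R S, near_points R T, S `<` T & T `<=` ord_valuation_ring S].

(* The classes of b_0, ..., b_(n-1) form a basis of T/m_T over S/m_S. *)
Definition residue_basis S T n (b : 'I_n -> K) :=
  [/\ forall i, T (b i),
      forall t, T t -> exists c : 'I_n -> K,
        (forall i, S (c i)) /\ maxid T (t - \sum_i c i * b i)
    & forall c : 'I_n -> K, (forall i, S (c i)) ->
        maxid T (\sum_i c i * b i) -> forall i, maxid S (c i)].

Definition residue_degree T S : nat :=
  xget 0%N [set n | exists b : 'I_n -> K, residue_basis S T b].

Fixpoint quadratic_chain S (s : seq (set K)) T : Prop :=
  if s is S' :: s' then quadratic_transform S S' /\ quadratic_chain S' s' T
  else S = T.

(* The quadratic sequence from S to T, without its first term S. *)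
Definition quadratic_seq S T : seq (set K) :=
  xget [::] [set s | quadratic_chain S s T].

(* The result does not depend on the chosen generators x and h. *)
Definition strict_transform1 S T I : set K :=
  [set z | exists x h, [/\ ideal_gen T (maxid S) = pideal T x, h != 0,
     I = pideal S h & pideal T (x ^- ord S h * h) z]].

Fixpoint strict_transform_along S (s : seq (set K)) I : set K :=
  if s is S' :: s' then strict_transform_along S' s' (strict_transform1 S S' I)
  else I.

Definition strict_transform R T I : set K :=
  strict_transform_along R (quadratic_seq R T) I.

Fixpoint exc_div_along S (s : seq (set K)) E : set K :=
  if s is S' :: s' then
    exc_div_along S' s'
      (ideal_mul S' (ideal_gen S' (maxid S)) (strict_transform1 S S' E))
  else E.

(* Starting from the unit ideal at R gives E_(R_1) = m_R R_1. *)
Definition exc_div R T : set K := exc_div_along R (quadratic_seq R T) R.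

(* [blowups R C X]: C is the set of points blown up in a finite sequence of
   blowing-ups of closed points that starts with the closed point of Spec R,
   and X is the set of local rings at the closed points of the last surface. *)
Inductive blowups R : set (set K) -> set (set K) -> Prop :=
| blowups_start : blowups R [set R] [set T | quadratic_transform R T]
| blowups_step C X S : blowups R C X -> X S ->
    blowups R (S |` C) ((X `\ S) `|` [set T | quadratic_transform S T]).

(* The curve f may be non-reduced, hence the exponent a; a = 0 is the case
   where the strict transform does not pass through T.  Normal crossings with
   the exceptional divisor are not required: every embedded resolution is a
   resolution in this sense. *)
Definition resolved_at R f T :=
  exists g y a, is_rsp T g y /\
    strict_transform R T (pideal R f) = pideal T (g ^+ a).

Definition resolution_cluster R f (C : set (set K)) :=
  exists X, blowups R C X /\ (forall T, X T -> resolved_at R f T).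

(* The existence of a regular parameter x with E_T = xT says that T lies on
   exactly one component of the exceptional divisor; it excludes T = R. *)
Definition curvette R f T g :=
  let I := pideal T g `&` R in
  [/\ near_points R T /\ T g,
      strict_transform R T (pideal R f) = T,
      exists x, exc_div R T = pideal T x /\ is_rsp T x g,
      ordI T (strict_transform R T I) = 1%N
    & forall S, near_points R S -> ~ (T `<=` S) -> ~ (S `<=` T) ->
        strict_transform R S I = S].

End LocalAlgebra.

(* Main.v *)
(** Let S be a point near R and h an equation at S of the strict transform of the
    curve.  The initial form F of h is a form of degree ord_S(h) in two variables
    over the residue field k of S, and the points T of the first neighbourhood of S
    are the closed points of the exceptional line over k.  Hence ord_S(h) = deg F is
    the sum over these T of [T:S] i_T, where i_T is the multiplicity of F at T, that
    is, the intersection multiplicity at T of the exceptional curve E with the strict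
    transform of h.  The curve E is smooth, so it passes through exactly one point of
    the first neighbourhood of T, and through exactly one of the next, and so on:
    these points T = T_0, T_1, T_2 ... have the same residue field, and for varying T
    they are precisely the points proximate to S.  Passing from T_j to T_(j+1) lowers
    the intersection multiplicity with E by ord_(T_j)(h), so i_T is the sum of these
    orders.  The formula thus holds for every non-zero principal ideal of R, and for
    a curvette the ideal gT /\ R must be principal, because its strict transform
    would be empty otherwise. *)
From HB Require Import structures.
Require Import Defs.
From mathcomp Require Import all_boot all_algebra.
From mathcomp Require Import boolp classical_sets cardinality fsbigop.
From mathcomp Require Import ring zify.

Import GRing.Theory.
Local Open Scope classical_set_scope.
Local Open Scope ring_scope.

Set Implicit Arguments.
Unset Strict Implicit.
Unset Printing Implicit Defensive.

(** * Local subrings of a field *)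

(** One fact makes the picture computable: for parameters x, y of S, the ring S[y/x] modulo x is the
    polynomial ring k[X]. It yields the closed points as irreducible polynomials p, their residue
    fields, the parameters x and p(y/x) at such a point, and the multiplicities i_T by factorization
    in k[X]. It also identifies V_S with the localization of S[y/x] at the prime (x), the local ring
    at the generic point of E. So T is contained in V_S exactly when T lies on the strict transform
    of E, and proximity becomes a walk along one smooth curve. Regularity is carried along as a
    short list of properties that pass to quadratic transforms by the same reduction modulo x;
    Krull's principal ideal theorem is needed only once, for R itself. The walk along E never ends,
    so infinitely many points are proximate to S, and a sum with infinite support has the default
    value 0. The finiteness of the support is therefore proved together with the formula: above each
    T only the first i_T points of the walk contribute. *)

Section Subrings.
Variable K : fieldType.
Implicit Types (A B S T I J M P Q : set K) (a b c x y z : K).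

Lemma subring1 A : is_subring A -> A 1.
Proof. by case=> /set_mem. Qed.

Lemma subringB A a b : is_subring A -> A a -> A b -> A (a - b).
Proof. by move=> [_ hB _] Aa Ab; apply/set_mem/hB; apply/mem_set. Qed.

Lemma subringM A a b : is_subring A -> A a -> A b -> A (a * b).
Proof. by move=> [_ _ hM] Aa Ab; apply/set_mem/hM; apply/mem_set. Qed.

Lemma subring0 A : is_subring A -> A 0.
Proof. by move=> hA; rewrite -(subrr 1); apply: subringB => //; apply: subring1. Qed.

Lemma subringN A a : is_subring A -> A a -> A (- a).
Proof. by move=> hA Aa; rewrite -sub0r; apply: subringB => //; apply: subring0. Qed.

Lemma subringD A a b : is_subring A -> A a -> A b -> A (a + b).
Proof. by move=> hA Aa Ab; rewrite -[b]opprK; apply: subringB => //; apply: subringN. Qed.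

Lemma subringX A a n : is_subring A -> A a -> A (a ^+ n).
Proof.
move=> hA Aa; elim: n => [|n IH]; first by rewrite expr0; apply: subring1.
by rewrite exprS; apply: subringM.
Qed.

Lemma subring_sum A (I : Type) (r : seq I) (p : pred I) (F : I -> K) :
  is_subring A -> (forall i, p i -> A (F i)) -> A (\sum_(i <- r | p i) F i).
Proof.
move=> hA hF; apply: (big_ind A) => //; first exact: subring0.
by move=> *; apply: subringD.
Qed.

Lemma is_subringP A : A 1 -> (forall a b, A a -> A b -> A (a - b)) ->
  (forall a b, A a -> A b -> A (a * b)) -> is_subring A.
Proof.
move=> h1 hB hM; split; first exact/mem_set.
  by move=> a b /set_mem Aa /set_mem Ab; apply/mem_set/hB.
by move=> a b /set_mem Aa /set_mem Ab; apply/mem_set/hM.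
Qed.

Lemma idealS A I a : is_ideal A I -> I a -> A a.
Proof. by case=> h _ _ _ /h. Qed.

Lemma ideal0 A I : is_ideal A I -> I 0.
Proof. by case. Qed.

Lemma idealD A I a b : is_ideal A I -> I a -> I b -> I (a + b).
Proof. by case=> _ _ h _; apply: h. Qed.

Lemma idealMl A I a b : is_ideal A I -> A a -> I b -> I (a * b).
Proof. by case=> _ _ _; apply. Qed.

Lemma idealMr A I a b : is_ideal A I -> I a -> A b -> I (a * b).
Proof. by rewrite mulrC => hI Ia Ab; apply: (idealMl hI). Qed.

Lemma idealB A I a b : is_subring A -> is_ideal A I -> I a -> I b -> I (a - b).
Proof.
move=> hA hI Ia Ib; apply: (idealD hI) => //; rewrite -mulN1r.
by apply: (idealMl hI) => //; apply: (subringN hA); apply: subring1.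
Qed.

Lemma ideal_sum A I (U : Type) (r : seq U) (p : pred U) (F : U -> K) :
  is_ideal A I -> (forall i, p i -> I (F i)) -> I (\sum_(i <- r | p i) F i).
Proof.
move=> hI hF; apply: (big_ind I) => //; first exact: ideal0 hI.
by move=> *; apply: (idealD hI).
Qed.

Lemma idealDr A I a b : is_subring A -> is_ideal A I -> I b -> I (a + b) -> I a.
Proof. by move=> hA hI Ib /(idealB hA hI) /(_ Ib); rewrite addrK. Qed.

Lemma ideal_unit A I a : is_ideal A I -> I a -> a != 0 -> A a^-1 -> I 1.
Proof. by move=> hI Ia a0 /(idealMr hI Ia); rewrite divff. Qed.

Lemma ideal_gen_sub A X I : is_ideal A I -> X `<=` I -> ideal_gen A X `<=` I.
Proof. by move=> hI hX; apply: smallest_sub. Qed.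

Lemma ideal_genS A X : X `<=` ideal_gen A X.
Proof. exact: sub_smallest. Qed.

Lemma is_ideal_whole A : is_subring A -> is_ideal A A.
Proof.
move=> hA; split=> //; first exact: subring0.
  by move=> *; apply: subringD.
by move=> *; apply: subringM.
Qed.

Lemma is_ideal_gen A X : is_subring A -> X `<=` A -> is_ideal A (ideal_gen A X).
Proof.
move=> hA hX; split.
- exact: ideal_gen_sub (is_ideal_whole hA) hX.
- by move=> I [hI _]; apply: ideal0 hI.
- move=> a b ha hb I hI; apply: (idealD hI.1); [exact: ha|exact: hb].
- by move=> a b Aa hb I hI; apply: (idealMl hI.1) => //; apply: hb.
Qed.

Lemma is_ideal_pideal A a : is_subring A -> A a -> is_ideal A (pideal A a).
Proof.
move=> hA Aa; split.
- by move=> _ [b Ab <-]; apply: subringM.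
- by exists 0; [exact: subring0|rewrite mulr0].
- by move=> _ _ [b Ab <-] [c Ac <-]; exists (b + c); [apply: subringD|rewrite mulrDr].
- move=> b _ Ab [c Ac <-]; exists (b * c); first exact: subringM.
  by ring.
Qed.

(** Locality in the form used throughout: elements outside [M] are units. Naming [M] allows
    [lring_maxid] to identify the ideal that [maxid] picks by choice. *)
Definition lring A M :=
  [/\ is_subring A, is_ideal A M, ~ M 1 & forall a, A a -> ~ M a -> A a^-1].

Lemma lring_maximal A M : lring A M -> is_maximal A M.
Proof.
case=> hA hM M1 hU; split=> // J hJ MJ.
have [JM|/existsNP[a /not_implyP[Ja Ma]]] := pselect (J `<=` M).
  by left; apply/seteqP.
right; apply/seteqP; split=> b; first exact: (idealS hJ).
move=> Ab; rewrite -(mulr1 b); apply: (idealMl hJ) => //.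
apply: (ideal_unit hJ Ja); last exact: hU (idealS hJ Ja) Ma.
by apply/eqP => a0; apply: Ma; rewrite a0; apply: (ideal0 hM).
Qed.

Lemma lring_maximal_uniq A M J : lring A M -> is_maximal A J -> J = M.
Proof.
case=> hA hM M1 hU [hJ J1 hmax].
case: (hmax M hM) => //.
  move=> a Ja; apply: contrapT => Ma; apply: J1; apply: (ideal_unit hJ Ja).
    by apply/eqP => a0; apply: Ma; rewrite a0; apply: (ideal0 hM).
  exact: hU (idealS hJ Ja) Ma.
by move=> MA; case: M1; rewrite MA; apply: subring1.
Qed.

Lemma lring_maxid A M : lring A M -> maxid A = M.
Proof.
move=> hA; apply: (lring_maximal_uniq hA); rewrite /maxid.
by apply: xgetPex; exists M; apply: lring_maximal.
Qed.

Definition lr A := lring A (maxid A).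

Lemma lring_lr A M : lring A M -> lr A.
Proof. by move=> hA; rewrite /lr (lring_maxid hA). Qed.

Lemma lr_subring A : lr A -> is_subring A. Proof. by case. Qed.
Lemma lr_ideal A : lr A -> is_ideal A (maxid A). Proof. by case. Qed.
Lemma lr_not1 A : lr A -> ~ maxid A 1. Proof. by case. Qed.
Lemma lr_inv A a : lr A -> A a -> ~ maxid A a -> A a^-1.
Proof. by case=> _ _ _; apply. Qed.

Lemma lr_neq0 A a : lr A -> ~ maxid A a -> a != 0.
Proof. by move=> hA Ma; apply/eqP => a0; apply: Ma; rewrite a0; apply: ideal0 (lr_ideal hA). Qed.

Lemma lr_unitP A a : lr A -> a != 0 -> A a^-1 -> ~ maxid A a.
Proof. by move=> hA a0 Aa Ma; apply: (lr_not1 hA); apply: (ideal_unit (lr_ideal hA) Ma). Qed.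

Lemma lr_maxidS A a : lr A -> maxid A a -> A a.
Proof. by move=> hA; apply: idealS (lr_ideal hA). Qed.

Lemma lr_notM A a b : lr A -> A a -> A b -> ~ maxid A a -> ~ maxid A b -> ~ maxid A (a * b).
Proof.
move=> hA Aa Ab Ma Mb; apply: (lr_unitP hA).
  by rewrite mulf_neq0 ?(lr_neq0 hA).
rewrite invfM; apply: (subringM (lr_subring hA)); exact: lr_inv.
Qed.

Lemma lr_notD A a b : lr A -> ~ maxid A a -> maxid A b -> ~ maxid A (a + b).
Proof. by move=> hA Ma Mb /(idealDr (lr_subring hA) (lr_ideal hA) Mb). Qed.

Definition locid B Q : set K :=
  [set z | exists a b, [/\ Q a, B b, ~ Q b & z = a / b]].

Lemma prime_neq0 B Q b : is_prime B Q -> ~ Q b -> b != 0.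
Proof. by case=> hQ _ _ Qb; apply/eqP => b0; apply: Qb; rewrite b0; apply: ideal0 hQ. Qed.

Lemma prime_notM B Q a b : is_prime B Q -> B a -> B b -> ~ Q a -> ~ Q b -> ~ Q (a * b).
Proof. by case=> _ _ hP Ba Bb Qa Qb /(hP _ _ Ba Bb) []. Qed.

Lemma sub_localization B Q : is_subring B -> is_prime B Q -> B `<=` localization B Q.
Proof.
move=> hB [_ Q1 _] b Bb; exists b, 1; split=> //; first exact: subring1.
by rewrite divr1.
Qed.

Lemma sub_locid B Q : is_subring B -> is_prime B Q -> Q `<=` locid B Q.
Proof.
move=> hB [_ Q1 _] b Bb; exists b, 1; split=> //; first exact: subring1.
by rewrite divr1.
Qed.

Lemma localization_lring B Q : is_subring B -> is_prime B Q ->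
  lring (localization B Q) (locid B Q).
Proof.
move=> hB hQ; have [iQ Q1 _] := hQ.
have n0 b := prime_neq0 hQ (b := b).
have B1 := subring1 hB.
split.
- apply: is_subringP.
  + by exists 1, 1; split=> //; rewrite divr1.
  + move=> _ _ [a [b [Ba Bb Qb ->]]] [c [d [Bc Bd Qd ->]]].
    exists (a * d - c * b), (b * d); split.
    * by apply: (subringB hB); apply: (subringM hB).
    * exact: (subringM hB).
    * exact: (prime_notM hQ).
    * by rewrite -mulNr addf_div ?n0 // mulNr.
  + move=> _ _ [a [b [Ba Bb Qb ->]]] [c [d [Bc Bd Qd ->]]].
    exists (a * c), (b * d); split.
    * exact: (subringM hB).
    * exact: (subringM hB).
    * exact: (prime_notM hQ).
    * by rewrite mulf_div.
- split.
  + move=> _ [a [b [Qa Bb Qb ->]]]; exists a, b; split=> //; exact: idealS Qa.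
  + by exists 0, 1; split=> //; [exact: ideal0 iQ|rewrite mul0r].
  + move=> _ _ [a [b [Ba Bb Qb ->]]] [c [d [Bc Bd Qd ->]]].
    exists (a * d + c * b), (b * d); split.
    * by apply: (idealD iQ); apply: (idealMr iQ).
    * exact: (subringM hB).
    * exact: (prime_notM hQ).
    * by rewrite addf_div ?n0.
  + move=> _ _ [a [b [Ba Bb Qb ->]]] [c [d [Bc Bd Qd ->]]].
    exists (a * c), (b * d); split.
    * exact: (idealMl iQ).
    * exact: (subringM hB).
    * exact: (prime_notM hQ).
    * by rewrite mulf_div.
- move=> [a [b [Qa Bb Qb /esym h]]]; apply: Qb.
  by rewrite -(divr1_eq h).
- move=> _ [a [b [Ba Bb Qb ->]]] h; exists b, a; split=> //.
    by move=> Qa; apply: h; exists a, b.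
  by rewrite invf_div.
Qed.

Lemma localization_lr B Q : is_subring B -> is_prime B Q -> lr (localization B Q).
Proof. by move=> hB hQ; apply: lring_lr (localization_lring hB hQ). Qed.

Lemma maxid_localization B Q : is_subring B -> is_prime B Q ->
  maxid (localization B Q) = locid B Q.
Proof. by move=> hB hQ; apply: lring_maxid (localization_lring hB hQ). Qed.

Lemma maxid_localizationI B Q b : is_subring B -> is_prime B Q -> B b ->
  maxid (localization B Q) b <-> Q b.
Proof.
move=> hB hQ Bb; rewrite maxid_localization //; split; last exact: sub_locid.
case=> c [d [Qc Bd Qd h]]; case: (hQ) => iQ _ hP.
have := Qc; rewrite -[c](divfK (prime_neq0 hQ Qd)) -h.
by case/(hP _ _ Bb Bd).
Qed.

Lemma maximal_inv B Q b : is_subring B -> is_maximal B Q -> B b -> ~ Q b ->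
  exists2 c, B c & Q (b * c - 1).
Proof.
move=> hB [iQ Q1 hmax] Bb Qb.
pose J := [set z | exists q c, [/\ Q q, B c & z = q + b * c]].
have iJ : is_ideal B J.
  split.
  - move=> _ [q [c [Qq Bc ->]]]; apply: (subringD hB); first exact: idealS Qq.
    exact: (subringM hB).
  - exists 0, 0; split; [exact: ideal0 iQ|exact: subring0|by rewrite mulr0 addr0].
  - move=> _ _ [q [c [Qq Bc ->]]] [q' [c' [Qq' Bc' ->]]].
    exists (q + q'), (c + c'); split; [exact: (idealD iQ)|exact: (subringD hB)|].
    by ring.
  - move=> a _ Ba [q [c [Qq Bc ->]]]; exists (a * q), (a * c).
    split; [exact: (idealMl iQ)|exact: (subringM hB)|by ring].
have QJ : Q `<=` J.
  move=> q Qq; exists q, 0; split=> //; first exact: subring0.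
  by rewrite mulr0 addr0.
have Jb : J b.
  exists 0, 1; split; [exact: ideal0 iQ|exact: subring1|by rewrite mulr1 add0r].
case: (hmax J iJ QJ) => [JQ|JB]; first by case: Qb; rewrite -JQ.
have : J 1 by rewrite JB; apply: subring1.
case=> q [c [Qq Bc e]]; exists c => //.
have -> : b * c - 1 = - q by rewrite e; ring.
by rewrite -sub0r; apply: (idealB hB iQ) => //; apply: ideal0 iQ.
Qed.

Lemma maximal_prime B Q : is_subring B -> is_maximal B Q -> is_prime B Q.
Proof.
move=> hB hQ; have [iQ Q1 _] := hQ; split=> // a b Ba Bb Qab.
have [Qa|/(maximal_inv hB hQ Ba) [c Bc Qc]] := pselect (Q a); first by left.
right; have -> : b = (a * b) * c - b * (a * c - 1) by ring.
by apply: (idealB hB iQ); [apply: (idealMr iQ)|apply: (idealMl iQ)].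
Qed.

Definition dominates S T := S `<=` T /\ maxid S `<=` maxid T.

Lemma dominates_refl S : dominates S S. Proof. by split. Qed.

Lemma dominates_trans S T U : dominates S T -> dominates T U -> dominates S U.
Proof. by move=> [h1 h2] [h3 h4]; split=> a; [move/h1/h3|move/h2/h4]. Qed.

Lemma dominates_unit S T a : lr S -> lr T -> dominates S T -> S a ->
  maxid T a -> maxid S a.
Proof.
move=> hS hT [ST _] Sa Ta; apply: contrapT => Ma.
by move: Ta; apply: (lr_unitP hT); [exact: (lr_neq0 hS Ma)|apply/ST/(lr_inv hS)].
Qed.

End Subrings.

(** * Quadratic transforms *)

Section Blowup.
Variable K : fieldType.
Implicit Types (A B S T I J M P Q : set K) (a b c x y z : K).

Lemma chart_subring S x : is_subring (blowup_chart S x).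
Proof.
apply: is_subringP.
- by move=> B [hB _]; apply: subring1.
- by move=> a b Sa Sb B hB; apply: (subringB hB.1); [apply: Sa|apply: Sb].
- by move=> a b Sa Sb B hB; apply: (subringM hB.1); [apply: Sa|apply: Sb].
Qed.

Lemma sub_chart S x : S `<=` blowup_chart S x.
Proof. by move=> a Sa B [_ h]; apply: h; left. Qed.

Lemma chart_div S x y : maxid S y -> blowup_chart S x (y / x).
Proof. by move=> my B [_ h]; apply: h; right; exists y. Qed.

Lemma chart_sub S x T : is_subring T -> S `<=` T ->
  (forall y, maxid S y -> T (y / x)) -> blowup_chart S x `<=` T.
Proof.
by move=> hT ST h a; apply; split=> // b [/ST//|[y my <-]]; apply: h.
Qed.

(** The last clause says that [x] generates the extension of the maximal ideal of [S] to [T],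
    without reference to a chart. *)
Lemma qt_generator S T : lr S -> quadratic_transform S T ->
  [/\ lr T, dominates S T & exists x,
     [/\ maxid S x, x != 0 & forall y, maxid S y -> T (y / x)]].
Proof.
move=> hS [x [Q [mx x0 hQ mQ ->]]].
have hB := chart_subring S x; have pQ := maximal_prime hB hQ.
split; first exact: localization_lr.
  split; first by move=> a /(sub_chart (x := x)); apply: sub_localization.
  by move=> a /mQ Qa; rewrite maxid_localization //; apply: sub_locid.
exists x; split=> // y my; apply: (sub_localization hB pQ).
exact: chart_div.
Qed.

Lemma contraction_prime T B : lr T -> is_subring B -> B `<=` T ->
  is_prime B (maxid T `&` B).
Proof.
move=> hT hB BT; have iT := lr_ideal hT; split.
- split; first by move=> a [].
  + by split; [apply: ideal0 iT|apply: subring0].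
  + by move=> a b [? ?] [? ?]; split; [apply: (idealD iT)|apply: (subringD hB)].
  + by move=> a b ? [? ?]; split; [apply: (idealMl iT) => //; apply: BT|apply: (subringM hB)].
- by case=> /(lr_not1 hT).
- move=> a b Ba Bb [mab _]; apply: contrapT => /not_orP[na nb].
  by apply: (lr_notM hT (BT _ Ba) (BT _ Bb)) mab => ?; [apply: na|apply: nb].
Qed.

(** A quadratic transform is determined by any local ring [T'] dominating it. If [x1] generates the
    maximal ideal of [S] in [T] and [x] does so in [T'], then x/x1 lies in [T] and is a unit of
    [T'], hence a unit of [T], so the chart of [x] lies in [T] too. This gives both the uniqueness
    of quadratic sequences and the freedom to choose a chart. *)
Lemma qt_localization S T T' x : lr S -> lr T' -> quadratic_transform S T ->
  dominates T T' -> maxid S x -> x != 0 -> (forall y, maxid S y -> T' (y / x)) ->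
  T = localization (blowup_chart S x) (maxid T' `&` blowup_chart S x).
Proof.
move=> hS hT' qST domT mx x0 T'x.
have [hT domS [x1 [mx1 x10 Tx1]]] := qt_generator hS qST.
have [TT' mTT'] := domT; have [ST mST] := domS.
have sT := lr_subring hT; have sT' := lr_subring hT'.
set B := blowup_chart S x; have hB : is_subring B := chart_subring S x.
have BT' : B `<=` T' by apply: chart_sub => // a /ST /TT'.
have u0 : x1 / x != 0 by rewrite mulf_neq0 ?invr_neq0.
have uV : (x1 / x)^-1 = x / x1 by rewrite invf_div.
have Tu : ~ maxid T' (x1 / x) by apply: (lr_unitP hT') => //; rewrite uV; apply/TT'/Tx1.
have Tv : ~ maxid T (x / x1).
  move=> /mTT'; apply: (lr_unitP hT'); first by rewrite -uV invr_neq0.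
  by rewrite invf_div; apply: T'x.
have BT : B `<=` T.
  apply: chart_sub => // y my.
  have -> : y / x = (y / x1) * (x / x1)^-1 by field; rewrite x0 x10.
  by apply: (subringM sT); [apply: Tx1|apply: (lr_inv hT) => //; apply: Tx1].
have pQ : is_prime B (maxid T' `&` B) by apply: contraction_prime.
set D := localization B _.
have hD : lr D by apply: localization_lr.
have sD := lr_subring hD.
have BD : B `<=` D by apply: sub_localization.
have mDT : maxid D `<=` maxid T'.
  rewrite /D maxid_localization // => _ [a [b [[ma Ba] Bb Qb ->]]].
  apply: (idealMr (lr_ideal hT')) => //; apply: (lr_inv hT'); first exact: BT'.
  by move=> mb; apply: Qb.
apply/seteqP; split.
  have [x2 [Q2 [mx2 x20 hQ2 mQ2 TE]]] := qST.
  have hB2 := chart_subring S x2; have pQ2 := maximal_prime hB2 hQ2.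
  have B2T : blowup_chart S x2 `<=` T by rewrite TE; apply: sub_localization.
  have B2D : blowup_chart S x2 `<=` D.
    apply: chart_sub => //; first by move=> a /(sub_chart (x := x))/BD.
    move=> y my; exists (y / x), (x2 / x); split; [exact: chart_div|exact: chart_div| |].
      case=> h _; move: h; apply: (lr_unitP hT'); first by rewrite mulf_neq0 ?invr_neq0.
      by rewrite invf_div; apply: TT'; apply: B2T; apply: chart_div.
    by field; rewrite x0 x20.
  rewrite TE => _ [a [b [Ba Bb Qb ->]]].
  apply: (subringM sD); first exact: B2D.
  apply: (lr_inv hD); first exact: B2D.
  move=> /mDT; have Tb : ~ maxid T b by rewrite TE maxid_localizationI.
  apply: (lr_unitP hT'); first exact: lr_neq0 Tb.
  by apply: TT'; apply: (lr_inv hT) => //; apply: B2T.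
move=> _ [a [b [Ba Bb Qb ->]]]; apply: (subringM sT); first exact: BT.
apply: (lr_inv hT); first exact: BT.
by move=> /mTT' h; apply: Qb.
Qed.

Lemma qt_uniq S T T1 T2 : lr S -> lr T -> quadratic_transform S T1 ->
  quadratic_transform S T2 -> dominates T1 T -> dominates T2 T -> T1 = T2.
Proof.
move=> hS hT q1 q2 d1 d2.
have [_ _ [x [mx x0 Tx]]] := qt_generator hS q1.
have Tx' y : maxid S y -> T (y / x) by move=> /Tx; apply: d1.1.
by rewrite (qt_localization hS hT q1 d1 mx x0 Tx') (qt_localization hS hT q2 d2 mx x0 Tx').
Qed.

End Blowup.

(** * Regular systems of parameters *)

Section Regular.
Variable K : fieldType.
Implicit Types (A B S T I J M P Q : set K) (a b c h x y z : K).

(** The n-th power of the ideal (x, y), with explicit coefficients where [ideal_pow] offers only an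
    intersection of ideals; [regp_pow] identifies the two. *)
Fixpoint Mp S x y n : set K :=
  if n is n'.+1
  then [set z | exists a b, [/\ Mp S x y n' a, Mp S x y n' b & z = a * x + b * y]]
  else S.

Lemma MpSP S x y n z : Mp S x y n.+1 z ->
  exists a b, [/\ Mp S x y n a, Mp S x y n b & z = a * x + b * y].
Proof. by []. Qed.

Lemma Mp_ideal S x y n : is_subring S -> S x -> S y -> is_ideal S (Mp S x y n).
Proof.
move=> hS Sx Sy; elim: n => [|n iM] /=; first exact: is_ideal_whole.
split.
- move=> _ [a [b [Ma Mb ->]]].
  by apply: (subringD hS); apply: (subringM hS) => //; apply: (idealS iM).
- by exists 0, 0; split; [exact: ideal0 iM|exact: ideal0 iM|rewrite !mul0r addr0].
- move=> _ _ [a [b [Ma Mb ->]]] [c [d [Mc Md ->]]].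
  by exists (a + c), (b + d); split; [exact: (idealD iM)|exact: (idealD iM)|ring].
- move=> e _ Se [a [b [Ma Mb ->]]].
  by exists (e * a), (e * b); split; [exact: (idealMl iM)|exact: (idealMl iM)|ring].
Qed.

Lemma MpS S x y n : is_subring S -> S x -> S y -> Mp S x y n.+1 `<=` Mp S x y n.
Proof.
move=> hS Sx Sy _ [a [b [Ma Mb ->]]]; have iM := Mp_ideal n hS Sx Sy.
by apply: (idealD iM); apply: (idealMr iM).
Qed.

Lemma Mp_le S x y m n : is_subring S -> S x -> S y -> (m <= n)%N ->
  Mp S x y n `<=` Mp S x y m.
Proof.
move=> hS Sx Sy; elim: n => [|n IH]; first by rewrite leqn0 => /eqP ->.
rewrite leq_eqVlt => /predU1P[-> //|lemn] a /(MpS hS Sx Sy); exact: IH.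
Qed.

Lemma Mp_x S x y n a : is_subring S -> S x -> S y ->
  Mp S x y n a -> Mp S x y n.+1 (x * a).
Proof.
move=> hS Sx Sy Ma; exists a, 0; split=> //; first exact: (ideal0 (Mp_ideal n hS Sx Sy)).
by rewrite mul0r addr0 mulrC.
Qed.

Lemma Mp_y S x y n a : is_subring S -> S x -> S y ->
  Mp S x y n a -> Mp S x y n.+1 (y * a).
Proof.
move=> hS Sx Sy Ma; exists 0, a; split=> //; first exact: (ideal0 (Mp_ideal n hS Sx Sy)).
by rewrite mul0r add0r mulrC.
Qed.

Lemma Mp_change S x y x' y' : is_subring S -> S x -> S y -> S x' -> S y' ->
  Mp S x y 1 x' -> Mp S x y 1 y' -> forall n, Mp S x' y' n `<=` Mp S x y n.
Proof.
move=> hS Sx Sy Sx' Sy' [a [b [Sa Sb ->]]] [c [d [Sc Sd ->]]].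
elim=> [//|n IH] _ [e [f [/IH Me /IH Mf ->]]]; have iM := Mp_ideal n hS Sx Sy.
exists (e * a + f * c), (e * b + f * d); split; last by ring.
  by apply: (idealD iM); apply: (idealMr iM).
by apply: (idealD iM); apply: (idealMr iM).
Qed.

Lemma Mp_div S T x y g n a : is_subring T -> S `<=` T -> g != 0 ->
  T (x / g) -> T (y / g) -> Mp S x y n a -> T (a / g ^+ n).
Proof.
move=> sT ST g0 Tx Ty; elim: n a => [|n IH] a; first by rewrite expr0 divr1; apply: ST.
move=> /MpSP [b [c [/IH Tb /IH Tc ->]]].
have -> : (b * x + c * y) / g ^+ n.+1 = (b / g ^+ n) * (x / g) + (c / g ^+ n) * (y / g).
  by rewrite exprS; field; rewrite g0 expf_neq0.
by apply: (subringD sT); apply: (subringM sT).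
Qed.

(** Every relation between [x] and [y] is a multiple of the Koszul relation. This form is symmetric
    and yields the quotient as a witness. *)
Definition regseq S x y := forall a b, S a -> S b -> a * x = b * y ->
  exists c, [/\ S c, a = c * y & b = c * x].

Section Regseq.
Variables (S : set K) (x y : K).
Hypotheses (sS : is_subring S) (Sx : S x) (Sy : S y) (hr : regseq S x y).
Let iM n : is_ideal S (Mp S x y n) := Mp_ideal n sS Sx Sy.

Lemma regseq_dvdx n a b : S a -> S b -> a * x = b * y ^+ n -> exists2 c, S c & b = c * x.
Proof.
elim: n a b => [|n IH] a b Sa Sb; first by rewrite expr0 mulr1 => <-; exists a.
rewrite exprSr mulrA => /(hr Sa (subringM sS Sb (subringX _ sS Sy))).
by case=> c [Sc _ /esym/(IH _ _ Sc Sb)].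
Qed.

(** The initial form of [x] is not a zero divisor in the associated graded ring. *)
Lemma regseq_cancelx n c : S c -> Mp S x y n.+1 (x * c) -> Mp S x y n c.
Proof.
elim: n c => [//|n IH] c Sc /MpSP [a [b [Ma Mb e]]].
have Sa := idealS (iM _) Ma; have Sb := idealS (iM _) Mb.
have [|d [Sd e1 e2]] := hr (subringB sS Sc Sa) Sb.
  by apply: (addrI (a * x)); rewrite -e; ring.
have Md : Mp S x y n d by apply: IH => //; rewrite mulrC -e2.
have -> : c = a + y * d by rewrite mulrC -e1; ring.
by apply: (idealD (iM _)) => //; apply: Mp_y.
Qed.

Lemma regseq_cancelX m n c : S c -> Mp S x y (m + n) (x ^+ m * c) -> Mp S x y n c.
Proof.
move=> Sc; elim: m => [|m IH]; first by rewrite expr0 mul1r.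
rewrite addSn exprS -mulrA => /regseq_cancelx h; apply: IH; apply: h.
by apply: (subringM sS) => //; apply: (subringX _ sS).
Qed.

Lemma Mp_modx n a : Mp S x y n a -> exists e c, [/\ S e, S c & a = e * y ^+ n + x * c].
Proof.
elim: n a => [|n IH] a; first move=> Sa.
  by exists a, 0; split=> //; [exact: (subring0 sS)|rewrite expr0; ring].
move=> /MpSP [b [c [Mb /IH [e [f [Se Sf ->]]] ->]]].
exists e, (b + f * y); split=> //; last by rewrite exprS; ring.
by apply: (subringD sS); [exact: (idealS (iM n))|exact: (subringM sS)].
Qed.

(** Modulo [x], the elements of the power n+1 are multiples of y^(n+1); since y^n can be cancelled
    modulo [x], membership would put [u] into (x, y). *)
Lemma regseq_not_Mp n u c : S u -> S c -> ~ Mp S x y 1 u ->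
  ~ Mp S x y n.+1 (u * y ^+ n + x * c).
Proof.
move=> Su Sc Mu /Mp_modx [e [f [Se Sf E]]]; apply: Mu.
have e1 : (f - c) * x = (u - e * y) * y ^+ n.
  have -> : (u - e * y) * y ^+ n = (u * y ^+ n + x * c) - (e * y ^+ n.+1 + x * c).
    by rewrite exprS; ring.
  by rewrite E; ring.
have [c' Sc' E'] : exists2 c', S c' & u - e * y = c' * x.
  apply: (@regseq_dvdx n (f - c)) e1; first exact: (subringB sS).
  by apply: (subringB sS) => //; apply: (subringM sS).
exists c', e; split=> //; by rewrite -E'; ring.
Qed.

End Regseq.

(* The part of "S is a two-dimensional regular local ring with parameters x, y"
   that the proof uses.  The separation axiom [regp_sep] stands for noetherianity:
   it passes to quadratic transforms without Hilbert's basis theorem. *)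
Record regp S x y : Prop := Regp {
  regp_sub : is_subring S;
  regp_x : S x;
  regp_y : S y;
  regp_not1 : ~ Mp S x y 1 1;
  regp_inv : forall a, S a -> ~ Mp S x y 1 a -> S a^-1;
  regp_reg : regseq S x y;
  regp_sep : forall a, (forall n, Mp S x y n a) -> a = 0;
  regp_frac : is_quotient_field S }.

Section Regp.
Variables (S : set K) (x y : K).
Hypothesis hS : regp S x y.
Let sS := regp_sub hS.
Let Sx := regp_x hS.
Let Sy := regp_y hS.

Let iM n : is_ideal S (Mp S x y n) := Mp_ideal n sS Sx Sy.

Lemma regp_Mx : Mp S x y 1 x.
Proof.
exists 1, 0; rewrite mul0r mul1r addr0.
by split=> //; [exact: subring1|exact: subring0].
Qed.

Lemma regp_My : Mp S x y 1 y.
Proof.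
exists 0, 1; rewrite mul0r mul1r add0r.
by split=> //; [exact: subring0|exact: subring1].
Qed.

Lemma regp_lring : lring S (Mp S x y 1).
Proof. by case: hS. Qed.

Lemma regp_lr : lr S. Proof. exact: lring_lr regp_lring. Qed.

Lemma regp_maxid : maxid S = Mp S x y 1. Proof. exact: lring_maxid regp_lring. Qed.

Lemma regp_x0 : x != 0.
Proof.
apply/eqP => x0; have [] := regp_reg hS (subring1 sS) (subring0 sS).
  by rewrite x0 mul0r mulr0.
by move=> c [Sc e _]; apply: (regp_not1 hS); rewrite e; exact: (idealMl (iM 1) Sc regp_My).
Qed.

Lemma regp_y0 : y != 0.
Proof.
apply/eqP => y0; have [] := regp_reg hS (subring0 sS) (subring1 sS).
  by rewrite y0 mul0r mulr0.
by move=> c [Sc _ e]; apply: (regp_not1 hS); rewrite e; exact: (idealMl (iM 1) Sc regp_Mx).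
Qed.

Lemma regp_pow n : ideal_pow S (maxid S) n = Mp S x y n.
Proof.
elim: n => [//|n IH] /=; rewrite /ideal_mul IH regp_maxid.
apply/seteqP; split.
  apply: (ideal_gen_sub (iM n.+1)) => _ [a [b [c [Sb Sc ->]]] [d Md] <-].
  exists (d * b), (d * c); split; [exact: (idealMr (iM n))|exact: (idealMr (iM n))|by ring].
move=> _ [a [b [Ma Mb ->]]].
have iG : is_ideal S (ideal_gen S [set x0 * y0 | x0 in Mp S x y 1 & y0 in Mp S x y n]).
  apply: is_ideal_gen => // _ [c Mc [d Md] <-].
  by apply: (subringM sS); [apply: (idealS (iM 1))|apply: (idealS (iM n))].
apply: (idealD iG); apply: ideal_genS.
  by exists x; [exact: regp_Mx|exists a => //; rewrite mulrC].
by exists y; [exact: regp_My|exists b => //; rewrite mulrC].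
Qed.

Lemma regp_dvdx n a b : S a -> S b -> a * x = b * y ^+ n -> exists2 c, S c & b = c * x.
Proof. exact: (regseq_dvdx sS Sy (regp_reg hS)). Qed.

Lemma regp_cancelx n c : S c -> Mp S x y n.+1 (x * c) -> Mp S x y n c.
Proof. exact: (regseq_cancelx sS Sx Sy (regp_reg hS)). Qed.

Lemma regp_ord_ex h : S h -> h != 0 -> exists n, Mp S x y n h /\ ~ Mp S x y n.+1 h.
Proof.
move=> Sh h0; apply: contrapT => /forallNP H; move: h0; apply/negP; rewrite negbK.
apply/eqP/(regp_sep hS); elim=> [//|n IH].
by apply: contrapT => hn; apply: (H n).
Qed.

Lemma regp_ordE h n : Mp S x y n h -> ~ Mp S x y n.+1 h -> ord S h = n.
Proof.
move=> Mn MSn; rewrite /ord; case: xgetP => [m -> [Mm MSm]|/(_ n)[]]; last by split; rewrite regp_pow.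
rewrite regp_pow in Mm; rewrite regp_pow in MSm; apply/eqP; rewrite eqn_leq; apply/andP; split.
  by rewrite leqNgt; apply/negP => lt; apply: MSn; exact: (Mp_le sS Sx Sy lt Mm).
by rewrite leqNgt; apply/negP => lt; apply: MSm; exact: (Mp_le sS Sx Sy lt Mn).
Qed.

Lemma regp_ordP h : S h -> h != 0 ->
  Mp S x y (ord S h) h /\ ~ Mp S x y (ord S h).+1 h.
Proof. by move=> Sh /(regp_ord_ex Sh)[n [Mn MSn]]; rewrite (regp_ordE Mn MSn). Qed.

Lemma regp_le_ord h n : Mp S x y n h -> h != 0 -> (n <= ord S h)%N.
Proof.
move=> Mn h0; have [_ Mh] := regp_ordP (idealS (iM _) Mn) h0.
by rewrite leqNgt; apply/negP => lt; apply: Mh; exact: (Mp_le sS Sx Sy lt Mn).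
Qed.

Lemma regp_ordI h : S h -> h != 0 -> ordI S (pideal S h) = ord S h.
Proof.
move=> Sh h0.
have H g : pideal S h g -> g != 0 -> (ord S h <= ord S g)%N.
  move=> [a Sa <-] ha0; apply: regp_le_ord => //; apply: (idealMr (iM _)) => //.
  exact: (regp_ordP Sh h0).1.
have Ih : pideal S h h by exists 1; [exact: subring1|rewrite mulr1].
rewrite /ordI; case: xgetP => [m -> /= [[g [Ig g0 gm]] hm]|/(_ (ord S h))[]].
  by apply/eqP; rewrite eqn_leq hm //= -gm H.
by split=> //; exists h.
Qed.

Lemma regp_unit_ord h u : S h -> h != 0 -> S u -> u != 0 -> S u^-1 -> ord S (h * u) = ord S h.
Proof.
move=> Sh h0 Su u0 Sv; have [M1 M2] := regp_ordP Sh h0; apply: regp_ordE.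
  exact: (idealMr (iM _)).
by move=> /(idealMr (iM _)) /(_ Sv); rewrite mulfK.
Qed.

Lemma regp_swap_Mp n : Mp S y x n = Mp S x y n.
Proof.
elim: n => //= n ->; apply/seteqP; split=> _ [a [b [Ma Mb ->]]];
  by exists b, a; split=> //; rewrite addrC.
Qed.

Lemma regp_swap : regp S y x.
Proof.
case: (hS) => *; split=> //; try by rewrite regp_swap_Mp.
- move=> a b Sa Sb /esym/(regp_reg hS Sb Sa) [c [Sc -> ->]]; by exists c.
- by move=> a H; apply: (regp_sep hS) => n; rewrite -regp_swap_Mp.
Qed.

Lemma regp_change a b : S a -> S a^-1 -> a != 0 -> S b -> regp S (a * x + b * y) y.
Proof.
move=> Sa Sa' a0 Sb; set z := a * x + b * y.
have Sz : S z by apply: (subringD sS); apply: (subringM sS).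
have Mz : Mp S x y 1 z by exists a, b.
have Mx : Mp S z y 1 x.
  exists a^-1, (- (a^-1 * b)); split=> //; last by rewrite /z; field.
  by apply: (subringN sS); apply: (subringM sS).
have My : Mp S z y 1 y.
  exists 0, 1; rewrite mul0r mul1r add0r.
  by split=> //; [exact: subring0|exact: subring1].
have E n : Mp S z y n = Mp S x y n.
  apply/seteqP; split; [apply: Mp_change|apply: Mp_change] => //.
  exact: regp_My.
split=> //; try by rewrite E; exact: regp_not1 hS.
- by move=> c Sc; rewrite E; exact: (regp_inv hS Sc).
- move=> c d Sc Sd e.
  have [|||f [Sf e1 e2]] := regp_reg hS (a := c * a) (b := d - c * b).
  + exact: (subringM sS).
  + by apply: (subringB sS) => //; apply: (subringM sS).
  + by apply: (addIr (c * b * y)); rewrite mulrBl subrK -e /z; ring.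
  exists (f / a); split; first exact: (subringM sS).
    by rewrite mulrAC -e1; field.
  have -> : d = f * x + c * b by rewrite -e2; ring.
  have -> : c = f * y / a by rewrite -e1; field.
  by rewrite /z; field.
- by move=> c H; apply: (regp_sep hS) => n; rewrite -E.
- exact: regp_frac hS.
Qed.

End Regp.

(** The element defining the chart is a regular parameter: if it were in the square of the maximal
    ideal, its inverse would be a sum of products of elements of the chart, and [Q] would contain
    1. *)
Lemma qt_regp S T x0 y0 : regp S x0 y0 -> quadratic_transform S T ->
  exists x y Q, [/\ regp S x y, is_maximal (blowup_chart S x) Q,
    maxid S `<=` Q & T = localization (blowup_chart S x) Q].
Proof.
move=> hS [x [Q [mx xn0 hQ mQ ->]]].
have mS := regp_maxid hS; have sS := regp_sub hS; have [Sx Sy] := (regp_x hS, regp_y hS).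
have iM n := Mp_ideal n sS Sx Sy; have hB := chart_subring S x.
have x2 : ~ Mp S x0 y0 2 x.
  case=> a [b [Ma Mb e]]; have [iQ Q1 _] := hQ; apply: Q1.
  rewrite -(divff xn0); apply: (idealMr iQ); first exact: mQ.
  have -> : x^-1 = (a / x) * (x0 / x) + (b / x) * (y0 / x).
    apply: (mulfI xn0); rewrite divff //.
    have -> : x * (a / x * (x0 / x) + b / x * (y0 / x)) = (a * x0 + b * y0) / x by field.
    by rewrite -e divff.
  have C z : Mp S x0 y0 1 z -> blowup_chart S x (z / x) by rewrite -mS; apply: chart_div.
  apply: (subringD hB); apply: (subringM hB); apply: C => //.
    exact: regp_Mx hS.
  exact: regp_My hS.
have [a [b [Sa Sb e]]] : Mp S x0 y0 1 x by rewrite -mS.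
have [Ma|Ma] := pselect (Mp S x0 y0 1 a); last first.
  exists x, y0, Q; split=> //; rewrite e; apply: regp_change => //.
    exact: (regp_inv hS).
  by apply/eqP => a0; apply: Ma; rewrite a0; apply: ideal0 (iM 1%N).
have Mb : ~ Mp S x0 y0 1 b by move=> Mb; apply: x2; exists a, b.
exists x, x0, Q; split=> //; rewrite e addrC; apply: (regp_change (regp_swap hS)) => //.
  exact: (regp_inv hS).
by apply/eqP => b0; apply: Mb; rewrite b0; apply: ideal0 (iM 1%N).
Qed.

(** x/u and y/u act as homogeneous coordinates of the point [T] on the exceptional line; they permit
    a case distinction for parameters fixed in advance. *)
Lemma qt_generator_regp S T x y : regp S x y -> quadratic_transform S T ->
  exists u, [/\ u != 0, T (x / u), T (y / u) & ~ (maxid T (x / u) /\ maxid T (y / u))].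
Proof.
move=> hS qT; have lS := regp_lr hS; have mE := regp_maxid hS.
have [lT dST [u [mu u0 Tu]]] := qt_generator lS qT; have iT := lr_ideal lT.
have [a [b [Sa Sb Eu]]] : Mp S x y 1 u by rewrite -mE.
exists u; split=> //.
- by apply: Tu; rewrite mE; apply: regp_Mx hS.
- by apply: Tu; rewrite mE; apply: regp_My hS.
- case=> nx ny; apply: (lr_not1 lT).
  have -> : 1 = a * (x / u) + b * (y / u).
    by rewrite -(divff u0) {1}Eu; field.
  by apply: (idealD iT); apply: (idealMl iT) => //; apply: dST.1.
Qed.

(** The quotient y/x is in [T] but not in [S], since one regular parameter does not divide the
    other. This rules out cycles in quadratic sequences. *)
Lemma qt_strict S T x0 y0 : regp S x0 y0 -> quadratic_transform S T -> ~ T `<=` S.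
Proof.
move=> hS /(qt_regp hS) [x [y [Q [hS' hQ mQ ->]]]] TS.
have hB := chart_subring S x; have pQ := maximal_prime hB hQ.
have Sy : S (y / x).
  apply: TS; apply: sub_localization => //; apply: chart_div; rewrite (regp_maxid hS').
  exact: regp_My hS'.
have [] := regp_reg hS' Sy (subring1 (regp_sub hS')).
  by rewrite mul1r divfK // (regp_x0 hS').
move=> c [Sc _ e]; apply: (regp_not1 hS'); rewrite e.
by apply: (idealMl (Mp_ideal 1 (regp_sub hS') (regp_x hS') (regp_y hS')) Sc); apply: regp_Mx hS'.
Qed.

End Regular.

(** * Residue fields *)

Section ResidueField.
Variables (K : fieldType) (S M : set K) (hS : lring S M).
Implicit Types a b c : K.

Let sS : is_subring S. Proof. by case: hS. Qed.
Let iM : is_ideal S M. Proof. by case: hS. Qed.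

Definition residue_repr a : K := xget 0 [set b | S b /\ M (a - b)].

Lemma residue_reprP a : S a -> S (residue_repr a) /\ M (a - residue_repr a).
Proof.
move=> Sa; apply: (@xgetPex _ 0 [set b | S b /\ M (a - b)]).
by exists a; split=> //; rewrite subrr; apply: (ideal0 iM).
Qed.

Lemma residue_repr_eq a b : M (a - b) -> residue_repr a = residue_repr b.
Proof.
move=> Mab; rewrite /residue_repr; congr xget; apply/seteqP; split=> c [Sc Mc]; split=> //.
  have -> : b - c = (a - c) - (a - b) by ring.
  exact: (idealB sS iM).
have -> : a - c = (a - b) + (b - c) by ring.
exact: (idealD iM).
Qed.

(** The residue field is realized on chosen representatives of the classes, so that it is a subtype
    of [K] and inherits its choice structure. The proof [h] is a parameter so that the field
    structure, which depends on it, can be attached to the type. *)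
Definition residue_type (h : lring S M) :=
  {a : K | `[< S a /\ residue_repr a = a >]}.

Notation k := (residue_type hS).

HB.instance Definition _ := [Choice of residue_type hS by <:].

Definition residue_in a : K := if `[< S a >] then a else 0.

Lemma residue_proj_subproof a :
  `[< S (residue_repr (residue_in a)) /\
      residue_repr (residue_repr (residue_in a)) = residue_repr (residue_in a) >].
Proof.
have Sa : S (residue_in a).
  by rewrite /residue_in; case: asboolP => // _; apply: subring0.
have [Sr Mr] := residue_reprP Sa; apply/asboolP; split=> //.
by apply/esym/residue_repr_eq.
Qed.

Definition residue_proj a : k := exist _ (residue_repr (residue_in a)) (residue_proj_subproof a).

Lemma residue_valE a : val (residue_proj a) = residue_repr (residue_in a).
Proof. by []. Qed.

Lemma residue_valS (u : k) : S (val u).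
Proof. by case: u => a /= /asboolP[]. Qed.

Lemma residue_inE a : S a -> residue_in a = a.
Proof. by move=> Sa; rewrite /residue_in; case: asboolP. Qed.

Lemma residue_valK (u : k) : residue_proj (val u) = u.
Proof.
apply: val_inj; rewrite residue_valE residue_inE; last exact: residue_valS.
by case: u => a /= /asboolP[].
Qed.

Lemma residue_proj_eq a b : S a -> S b -> M (a - b) -> residue_proj a = residue_proj b.
Proof. by move=> Sa Sb Mab; apply: val_inj; rewrite !residue_valE !residue_inE //; apply: residue_repr_eq. Qed.

Lemma residue_projM a : S a -> M (a - val (residue_proj a)).
Proof. by move=> Sa; rewrite residue_valE residue_inE //; apply: (residue_reprP Sa).2. Qed.

Lemma residue_proj_inj a b : S a -> S b -> residue_proj a = residue_proj b -> M (a - b).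
Proof.
move=> Sa Sb e; have -> : a - b = (a - val (residue_proj a)) - (b - val (residue_proj b)).
  by rewrite e; ring.
by apply: (idealB sS iM); apply: residue_projM.
Qed.

Definition residue_add (u v : k) : k := residue_proj (val u + val v).
Definition residue_mul (u v : k) : k := residue_proj (val u * val v).
Definition residue_opp (u : k) : k := residue_proj (- val u).
Definition residue_inv (u : k) : k :=
  if u == residue_proj 0 then u else residue_proj (val u)^-1.

Let val_proj a : S a -> exists2 m, M m & val (residue_proj a) = a - m.
Proof.
by move=> Sa; exists (a - val (residue_proj a)); [exact: residue_projM|ring].
Qed.

Lemma residue_addE a b : S a -> S b ->
  residue_add (residue_proj a) (residue_proj b) = residue_proj (a + b).
Proof.
move=> Sa Sb; apply: residue_proj_eq.
- by apply: (subringD sS); apply: residue_valS.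
- exact: (subringD sS).
have [[m Mm ->] [n Mn ->]] := (val_proj Sa, val_proj Sb).
have -> : a - m + (b - n) - (a + b) = - m - n by ring.
apply: (idealB sS iM) => //; rewrite -sub0r; apply: (idealB sS iM) => //; exact: (ideal0 iM).
Qed.

Lemma residue_mulE a b : S a -> S b ->
  residue_mul (residue_proj a) (residue_proj b) = residue_proj (a * b).
Proof.
move=> Sa Sb; apply: residue_proj_eq.
- by apply: (subringM sS); apply: residue_valS.
- exact: (subringM sS).
have Sv := residue_valS (residue_proj b).
have [n Mn e] := val_proj Sb; rewrite e in Sv; rewrite e.
have [m Mm ->] := val_proj Sa.
have -> : (a - m) * (b - n) - a * b = (- a) * n - (b - n) * m by ring.
by apply: (idealB sS iM); apply: (idealMl iM) => //; apply: (subringN sS).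
Qed.

Lemma residue_oppE a : S a -> residue_opp (residue_proj a) = residue_proj (- a).
Proof.
move=> Sa; apply: residue_proj_eq.
- by apply: (subringN sS); apply: residue_valS.
- exact: (subringN sS).
by have [m Mm ->] := val_proj Sa; have -> : - (a - m) - - a = m by ring.
Qed.

Let Hval (P : k -> Prop) : (forall a, S a -> P (residue_proj a)) -> forall u, P u.
Proof. by move=> h u; rewrite -[u]residue_valK; apply: h; apply: residue_valS. Qed.

Ltac sin := repeat first [assumption | apply: (subring0 sS) | apply: (subring1 sS)
  | apply: (subringD sS) | apply: (subringM sS) | apply: (subringN sS)].

Fact residue_addA : associative residue_add.
Proof.
elim/Hval=> a Sa; elim/Hval=> b Sb; elim/Hval=> c Sc.
by rewrite !residue_addE ?addrA //; sin.
Qed.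

Fact residue_addC : commutative residue_add.
Proof.
by elim/Hval=> a Sa; elim/Hval=> b Sb; rewrite !residue_addE // addrC.
Qed.

Fact residue_add0 : left_id (residue_proj 0) residue_add.
Proof. by elim/Hval=> a Sa; rewrite residue_addE ?add0r //; sin. Qed.

Fact residue_addN : left_inverse (residue_proj 0) residue_opp residue_add.
Proof. by elim/Hval=> a Sa; rewrite residue_oppE // residue_addE ?addNr //; sin. Qed.

HB.instance Definition _ := GRing.isZmodule.Build (residue_type hS)
  residue_addA residue_addC residue_add0 residue_addN.

Fact residue_mulA : associative residue_mul.
Proof.
elim/Hval=> a Sa; elim/Hval=> b Sb; elim/Hval=> c Sc.
by rewrite !residue_mulE ?mulrA //; sin.
Qed.

Fact residue_mulC : commutative residue_mul.
Proof.
by elim/Hval=> a Sa; elim/Hval=> b Sb; rewrite !residue_mulE // mulrC.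
Qed.

Fact residue_mul1 : left_id (residue_proj 1) residue_mul.
Proof. by elim/Hval=> a Sa; rewrite residue_mulE ?mul1r //; sin. Qed.

Fact residue_mulDl : left_distributive residue_mul residue_add.
Proof.
elim/Hval=> a Sa; elim/Hval=> b Sb; elim/Hval=> c Sc.
by rewrite !(residue_mulE, residue_addE) ?mulrDl //; sin.
Qed.

Fact residue_1_neq0 : residue_proj 1 != residue_proj 0.
Proof.
apply/eqP => /residue_proj_inj; rewrite subr0 => h.
by case: hS => _ _ M1 _; apply: M1; apply: h; sin.
Qed.

HB.instance Definition _ := GRing.Zmodule_isComNzRing.Build (residue_type hS)
  residue_mulA residue_mulC residue_mul1 residue_mulDl residue_1_neq0.

Fact residue_mulV (u : k) : u != 0 -> residue_mul (residue_inv u) u = 1.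
Proof.
elim/Hval: u => a Sa u0; rewrite /residue_inv ifN // /residue_mul.
have Sv := residue_valS (residue_proj a).
have Mv : ~ M (val (residue_proj a)).
  move=> Mv; move/eqP: u0; apply; rewrite -[LHS]residue_valK.
  by apply: residue_proj_eq => //; [sin|rewrite subr0].
have Sv' : S (val (residue_proj a))^-1 by case: hS => _ _ _; apply.
have -> : residue_proj (val (residue_proj (val (residue_proj a))^-1) * val (residue_proj a))
   = residue_mul (residue_proj (val (residue_proj a))^-1) (residue_proj a) by [].
rewrite -{2}[residue_proj a]residue_valK residue_mulE // mulVf //.
by apply/eqP => v0; apply: Mv; rewrite v0; apply: (ideal0 iM).
Qed.

Fact residue_inv0 : residue_inv 0 = 0.
Proof. by rewrite /residue_inv eqxx. Qed.

HB.instance Definition _ := GRing.ComNzRing_isField.Build (residue_type hS)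
  residue_mulV residue_inv0.

End ResidueField.

(** All later arguments see the residue field only through a projection [pi] and a section [sg]. The
    field [ressg0] ensures that lifting a polynomial coefficientwise with [map_poly] lifts every
    coefficient, including those beyond the degree. *)
Record residue_map (K : fieldType) (S M : set K) (k : fieldType) (pi : K -> k)
    (sg : k -> K) : Prop := ResidueMap {
  resD : forall a b, S a -> S b -> pi (a + b) = pi a + pi b;
  resM : forall a b, S a -> S b -> pi (a * b) = pi a * pi b;
  res1 : pi 1 = 1;
  resP : forall a, S a -> (pi a = 0 <-> M a);
  ressg : forall c, S (sg c);
  ressgK : cancel sg pi;
  ressg0 : sg 0 = 0 }.

Lemma residue_map_ex (K : fieldType) (S M : set K) : lring S M ->
  exists (k : fieldType) (pi : K -> k) (sg : k -> K), residue_map S M pi sg.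
Proof.
move=> hS; have [sS _ _ _] := hS.
exists (residue_type hS : fieldType), (residue_proj hS).
(* The representative chosen for the class 0 may be any element of [M], hence the correction. *)
exists (fun c : residue_type hS => if c == 0 then 0 else val c).
have pi0 : residue_proj hS 0 = 0 by [].
split.
- by move=> a b Sa Sb; rewrite -[RHS]/(residue_add _ _) residue_addE.
- by move=> a b Sa Sb; rewrite -[RHS]/(residue_mul _ _) residue_mulE.
- by [].
- move=> a Sa; rewrite -pi0; split=> [/(residue_proj_inj Sa (subring0 sS))|Ma].
    by rewrite subr0.
  by apply: residue_proj_eq => //; [exact: (subring0 sS)|rewrite subr0].
- by move=> c; case: eqP => _; [exact: (subring0 sS)|exact: residue_valS].
- by move=> c; case: eqP => [->|_] //; apply: residue_valK.
- by rewrite eqxx.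
Qed.

(** * Regular local rings of dimension two *)

Section Noetherian.
Variable K : fieldType.
Implicit Types (A I J M P : set K) (a b c x y z u : K).

Lemma noetherian_stationary A (I : nat -> set K) : is_noetherian A ->
  (forall n, is_ideal A (I n)) -> (forall n, I n `<=` I n.+1) ->
  exists N, forall n, I n `<=` I N.
Proof.
move=> nA iI sI.
have le m n : (m <= n)%N -> I m `<=` I n.
  elim: n => [|n IH]; first by rewrite leqn0 => /eqP ->.
  by rewrite leq_eqVlt => /predU1P[-> //|/IH h] a /h /sI.
have iJ : is_ideal A (\bigcup_n I n).
  split.
  - by move=> a [n _ /(idealS (iI n))].
  - by exists 0%N => //; apply: ideal0 (iI 0%N).
  - move=> a b [m _ Ia] [n _ Ib]; exists (maxn m n) => //; apply: (idealD (iI _)).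
      exact: le (leq_maxl _ _) _ Ia.
    exact: le (leq_maxr _ _) _ Ib.
  - by move=> a b Aa [n _ Ib]; exists n => //; apply: (idealMl (iI n)).
have [X [/finite_seqP[s ->] sA E]] := nA _ iJ.
have [N hN] : exists N, forall a, a \in s -> I N a.
  have : forall a, a \in s -> exists n, I n a.
    move=> a sa; have : (\bigcup_n I n) a by rewrite E; apply: ideal_genS.
    by case=> n _; exists n.
  elim: {sA E} s => [|b s IH] h; first by exists 0%N.
  have [N hN] := IH (fun a sa => h a (mem_behead (s := b :: s) sa)).
  have [n Ib] := h b (mem_head b s).
  exists (maxn N n) => a; rewrite inE => /predU1P[->|/hN Ia].
    exact: le (leq_maxr _ _) _ Ib.
  exact: le (leq_maxl _ _) _ Ia.
exists N => n a Ia; have : (\bigcup_n I n) a by exists n.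
by rewrite E; apply: (ideal_gen_sub (iI N)).
Qed.

(* A form of Krull's intersection theorem that also serves as Nakayama's lemma. *)
Lemma noetherian_descent A M J z (a : nat -> K) : is_noetherian A -> lring A M ->
  is_ideal A J -> M z -> (forall n, A (a n)) -> (forall n, J (a n - z * a n.+1)) ->
  J (a 0%N).
Proof.
move=> nA lA iJ Mz Aa h; have [sA iM M1 inv] := lA; have Az := idealS iM Mz.
pose I n := [set w | exists j b, [/\ J j, A b & w = j + b * a n]].
have iI n : is_ideal A (I n).
  split.
  - by move=> _ [j [b [Jj Ab ->]]]; apply: (subringD sA); [exact: (idealS iJ)|exact: (subringM sA)].
  - by exists 0, 0; split; [exact: ideal0 iJ|exact: subring0|rewrite mul0r addr0].
  - move=> _ _ [j [b [Jj Ab ->]]] [j' [b' [Jj' Ab' ->]]].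
    by exists (j + j'), (b + b'); split; [exact: (idealD iJ)|exact: (subringD sA)|ring].
  - move=> c _ Ac [j [b [Jj Ab ->]]].
    by exists (c * j), (c * b); split; [exact: (idealMl iJ)|exact: (subringM sA)|ring].
have sI n : I n `<=` I n.+1.
  move=> _ [j [b [Jj Ab ->]]]; exists (j + b * (a n - z * a n.+1)), (b * z); split.
  - by apply: (idealD iJ) => //; apply: (idealMl iJ).
  - exact: (subringM sA).
  - by ring.
have [N hN] := noetherian_stationary nA iI sI.
have [j [b [Jj Ab E]]] : I N (a N.+1).
  apply: (hN N.+1); exists 0, 1; split; [exact: ideal0 iJ|exact: subring1|].
  by rewrite mul1r add0r.
have JN : J (a N.+1).
  have nM : ~ M (1 - b * z).
    move=> h1; apply: M1; rewrite -(subrK (b * z) 1); apply: (idealD iM) => //.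
    exact: (idealMl iM).
  have Au : A (1 - b * z).
    by apply: (subringB sA); [exact: subring1|exact: (subringM sA)].
  have u0 : 1 - b * z != 0.
    by apply/eqP => u0; apply: nM; rewrite u0; apply: ideal0 iM.
  rewrite -[a N.+1](mulKf u0); apply: (idealMl iJ); first exact: inv.
  have -> : (1 - b * z) * a N.+1 = j + b * (a N - z * a N.+1).
    by rewrite mulrBl mul1r {1}E; ring.
  by apply: (idealD iJ) => //; apply: (idealMl iJ).
elim: N.+1 JN => [//|n IH] Jn; apply: IH.
rewrite -(subrK (z * a n.+1) (a n)); apply: (idealD iJ) => //.
exact: (idealMl iJ).
Qed.

Lemma dependent_sequence (Z : set K) (r : K -> K -> Prop) (a : K) : Z a ->
  (forall b, Z b -> exists2 c, Z c & r b c) ->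
  exists s : nat -> K, [/\ s 0%N = a, forall n, Z (s n) & forall n, r (s n) (s n.+1)].
Proof.
move=> Za h.
have /boolp.choice [f hf] : forall b, exists c, Z b -> Z c /\ r b c.
  move=> b; have [/h [c Zc rc]|nZ] := pselect (Z b); first by exists c.
  by exists 0.
exists (fun n => iter n f a).
have Zn n : Z (iter n f a) by elim: n => //= n /hf [].
by split=> // n; apply: (hf _ (Zn n)).2.
Qed.

Lemma maximal_ideal_ex A a : is_subring A -> A a -> ~ pideal A a 1 ->
  exists2 M, is_maximal A M & M a.
Proof.
move=> sA Aa n1.
(* Zorn's lemma also asks for the union of the empty chain, which is empty and not an ideal. *)
pose P (X : set K) := X = set0 \/ [/\ is_ideal A X, X a & ~ X 1].
have [|M [PM maxM]] := @Zorn_bigcup _ P.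
  move=> F FP totF.
  have [[X [FX [t Xt]]]|nX] := pselect (exists X, F X /\ (X !=set0)); last first.
    left; apply/seteqP; split=> // b [X FX Xb]; apply: nX; exists X; split=> //; by exists b.
  have ideals Y b : F Y -> Y b -> [/\ is_ideal A Y, Y a & ~ Y 1].
    by move=> FY Yb; case: (FP Y FY) => // Y0; rewrite Y0 in Yb.
  have [iX Xa X1] := ideals X t FX Xt.
  right; split.
  - split.
    + by move=> b [Y FY Yb]; have [iY _ _] := ideals Y b FY Yb; apply: (idealS iY).
    + by exists X => //; apply: ideal0 iX.
    + move=> b c [Y FY Yb] [Y' FY' Yc].
      have [iY _ _] := ideals Y b FY Yb; have [iY' _ _] := ideals Y' c FY' Yc.
      case: (totF _ _ FY FY') => sub; [exists Y'|exists Y] => //.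
        by apply: (idealD iY') => //; apply: sub.
      by apply: (idealD iY) => //; apply: sub.
    + move=> b c Ab [Y FY Yc]; have [iY _ _] := ideals Y c FY Yc.
      by exists Y => //; apply: (idealMl iY).
  - by exists X.
  - by move=> [Y FY Y1]; have [_ _] := ideals Y 1 FY Y1.
have Pa : P (pideal A a).
  right; split=> //; first exact: is_ideal_pideal.
  by exists 1; [exact: subring1|rewrite mulr1].
case: PM => [M0|[iM Ma M1]].
  case: (maxM (pideal A a)) => //; rewrite M0; split=> // h.
  by have := h a; apply; exists 1; [exact: subring1|rewrite mulr1].
exists M => //; split=> // J iJ MJ.
have [JM|nJM] := pselect (J `<=` M); first by left; apply/seteqP.
right; apply/seteqP; split=> b; first exact: (idealS iJ).
move=> Ab; rewrite -(mulr1 b); apply: (idealMl iJ) => //.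
apply: contrapT => J1; apply: (maxM J); first by split.
by right; split=> //; apply: MJ.
Qed.

Lemma local_lr A : is_subring A -> is_local A -> lr A.
Proof.
move=> sA [M [hM uM]].
have ME : maxid A = M.
  by apply/esym/uM; rewrite /maxid; apply: xgetPex; exists M.
have [iM M1 _] := hM.
rewrite /lr ME; split=> // a Aa nMa.
have [[b Ab E]|/(maximal_ideal_ex sA Aa) [M' hM' Ma]] := pselect (pideal A a 1).
  have a0 : a != 0.
    by apply/eqP => a0; move/eqP: E; rewrite a0 mul0r eq_sym oner_eq0.
  by have -> : a^-1 = b by apply: (mulfI a0); rewrite divff.
by case: nMa; rewrite (uM _ hM').
Qed.

Lemma Mp1_gen A x y : is_subring A -> A x -> A y ->
  ideal_gen A [set x; y] = Mp A x y 1.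
Proof.
move=> sA Ax Ay; have i1 := Mp_ideal 1 sA Ax Ay.
apply/seteqP; split.
  apply: (ideal_gen_sub i1) => _ [->|->].
    by exists 1, 0; split; [exact: subring1|exact: subring0|ring].
  by exists 0, 1; split; [exact: subring0|exact: subring1|ring].
move=> _ [a [b [Aa Ab ->]]].
have iG : is_ideal A (ideal_gen A [set x; y]) by apply: is_ideal_gen => // _ [->|->].
by apply: (idealD iG); apply: (idealMl iG) => //; apply: ideal_genS; [left|right].
Qed.

End Noetherian.

(** * From dimension two to a regular sequence of parameters *)

Section DimensionTwo.
Variables (K : fieldType) (A : set K) (x y : K) (P : set K).
Hypotheses (nA : is_noetherian A) (lA : lring A (Mp A x y 1)).
Hypotheses (Ax : A x) (Ay : A y) (pP : is_prime A P) (PM : ~ Mp A x y 1 `<=` P).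
Variable (p : K).
Hypotheses (Pp : P p) (p0 : p != 0).
Implicit Types (a b c u z : K).

Let sA : is_subring A. Proof. by case: lA. Qed.
Let iM n : is_ideal A (Mp A x y n) := Mp_ideal n sA Ax Ay.
Let iP : is_ideal A P. Proof. by case: pP. Qed.
Let ix : is_ideal A (pideal A x) := is_ideal_pideal sA Ax.

Let Mx : Mp A x y 1 x.
Proof. by exists 1, 0; split; [exact: subring1|exact: subring0|ring]. Qed.

Let My : Mp A x y 1 y.
Proof. by exists 0, 1; split; [exact: subring0|exact: subring1|ring]. Qed.

Definition order_mod j a := exists u c,
  [/\ A u, ~ Mp A x y 1 u, A c & a = u * y ^+ j + x * c].

(* A/xA has the principal maximal ideal (y). *)
Lemma order_mod_ex a : A a -> pideal A x a \/ exists j, order_mod j a.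
Proof.
move=> Aa; have [|H] := pselect (exists j, order_mod j a); first by right.
left; pose Z := [set b | A b /\ ~ exists j, order_mod j b].
have [|s [s0 Zs rs]] := @dependent_sequence _ Z (fun b c => pideal A x (b - y * c)) a (conj Aa H).
  move=> b [Ab nb].
  have [c [d [Ac Ad E]]] : Mp A x y 1 b.
    apply: contrapT => Mb; apply: nb; exists 0%N, b, 0; split=> //; first exact: subring0.
    by rewrite expr0; ring.
  exists d; last by exists c => //; rewrite E; ring.
  split=> // -[j [u [e [Au nu Ae Ed]]]]; apply: nb; exists j.+1, u, (c + y * e); split=> //.
    by apply: (subringD sA) => //; apply: (subringM sA).
  by rewrite E Ed exprS; ring.
rewrite -s0; apply: (noetherian_descent nA lA ix My) => // n; exact: (Zs n).1.
Qed.

Lemma y_notP : P x -> ~ P y.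
Proof.
move=> Px Py; apply: PM => _ [a [b [Aa Ab ->]]].
by apply: (idealD iP); apply: (idealMl iP).
Qed.

Let P1 : ~ P 1. Proof. by case: pP. Qed.
Let prime a b : A a -> A b -> P (a * b) -> P a \/ P b. Proof. by case: pP => _ _; apply. Qed.

Let prime_exp a n : A a -> P (a ^+ n) -> P a.
Proof.
move=> Aa; elim: n => [|n IH]; first by rewrite expr0.
by rewrite exprS => /(prime Aa (subringX _ sA Aa)) [].
Qed.

(* Krull's principal ideal theorem: if y^n were in xA, the ideals of A/xA would
   form a finite chain, so the contractions J k of p^k A_P to A would satisfy
   J k = J (k+1) + x J k for some k, which forces J k = J (k+1). *)
Lemma y_exp_mod n : ~ pideal A x (y ^+ n).
Proof.
move=> xy; have nPx : ~ P x.
  move=> Px; apply: (y_notP Px); apply: (@prime_exp _ n Ay).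
  by case: xy => c Ac <-; apply: (idealMr iP).
pose J k := [set a | A a /\ exists s, [/\ A s, ~ P s & pideal A (p ^+ k) (s * a)]].
have Ap := idealS iP Pp.
have iJ k : is_ideal A (J k).
  have ip : is_ideal A (pideal A (p ^+ k)) by apply: is_ideal_pideal => //; apply: subringX.
  split.
  - by move=> a [].
  - split; first exact: subring0.
    by exists 1; split=> //; [exact: subring1|rewrite mulr0; apply: ideal0 ip].
  - move=> a b [Aa [s [As ns Ia]]] [Ab [s' [As' ns' Ib]]]; split; first exact: (subringD sA).
    exists (s * s'); split; [exact: (subringM sA)|by move/(prime As As') => []|].
    have -> : s * s' * (a + b) = s' * (s * a) + s * (s' * b) by ring.
    by apply: (idealD ip); apply: (idealMl ip).
  - move=> a b Aa [Ab [s [As ns Ib]]]; split; first exact: (subringM sA).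
    by exists s; split=> //; rewrite mulrCA; apply: (idealMl ip).
have sJ k : J k.+1 `<=` J k.
  move=> a [Aa [s [As ns [c Ac E]]]]; split=> //; exists s; split=> //.
  by exists (p * c); [exact: (subringM sA)|rewrite -E exprSr mulrA].
have [k Hk] : exists k, forall a, J k a -> exists2 b, J k.+1 b & pideal A x (a - b).
  apply: contrapT => H.
  (* If the inclusion fails for every k, orders modulo x are at least k on [J k]: an element of
     [J k.+1] of order k would divide all of [J k] modulo x. Once orders exceed n, all elements lie
     in xA because y^n does, and the inclusion holds after all. *)
  have main k : forall j a, (j < k)%N -> J k a -> ~ order_mod j a.
    elim: k => [//|k IH] j a; rewrite ltnS => jk Ja Oj.
    have jk' : j = k.
      by apply/eqP; rewrite eqn_leq jk leqNgt; apply/negP => lt; apply: (IH _ _ lt (sJ _ _ Ja)).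
    rewrite jk' in Oj; apply: H; exists k => b Jb.
    have Ab : A b by case: Jb.
    have [bx|[i Oi]] := order_mod_ex Ab.
      by exists 0; [exact: ideal0 (iJ k.+1)|rewrite subr0].
    have ki : (k <= i)%N by rewrite leqNgt; apply/negP => lt; apply: (IH _ _ lt Jb).
    have [u [c [Au nu Ac Ea]]] := Oj; have [v [d [Av _ Ad Eb]]] := Oi.
    have u0 : u != 0 by apply/eqP => u0; apply: nu; rewrite u0; apply: ideal0 (iM 1).
    have Au' : A u^-1 by case: lA => _ _ _; apply.
    exists (v * u^-1 * y ^+ (i - k) * a).
      apply: (idealMl (iJ k.+1)) => //; apply: (subringM sA); last exact: subringX.
      exact: (subringM sA).
    exists (d - v * u^-1 * y ^+ (i - k) * c).
      apply: (subringB sA) => //; apply: (subringM sA) => //; apply: (subringM sA); last exact: subringX.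
      exact: (subringM sA).
    by rewrite Ea Eb -{2}(subnK ki) exprD; field.
  apply: H; exists n.+1 => a Ja; exists 0; first exact: ideal0 (iJ n.+2).
  rewrite subr0; have Aa : A a by case: Ja.
  have [//|[j Oj]] := order_mod_ex Aa.
  have nj : (n < j)%N by rewrite ltnNge; apply/negP => le; apply: (main _ _ _ _ Ja Oj).
  have [u [c [Au _ Ac ->]]] := Oj.
  apply: (idealD ix); last by exists c.
  rewrite -(subnK (ltnW nj)) exprD mulrA; apply: (idealMl ix) => //.
  by apply: (subringM sA) => //; apply: subringX.
(* As x is outside P, the cofactor c of x is again in [J k], so p^k can be divided by x modulo
   [J k.+1] without end. By descent p^k lies in [J k.+1], and cancelling p^k puts a denominator
   outside P into P. *)
have [||s [s0 Zs rs]] := @dependent_sequence _ (J k) (fun b c => J k.+1 (b - x * c)) (p ^+ k).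
- split; first exact: subringX.
  by exists 1; split=> //; [exact: subring1|exists 1; [exact: subring1|ring]].
- move=> a Ja; have [b Jb [c Ac E]] := Hk a Ja.
  exists c; last by rewrite E (_ : a - (a - b) = b) //; ring.
  have [Ad [s [As ns [e Ae Ee]]]] : J k (x * c).
    by rewrite E; apply: (idealB sA (iJ k)) => //; apply: sJ.
  split=> //; exists (s * x); split; first exact: (subringM sA).
    by move/(prime As Ax) => [].
  by exists e => //; rewrite Ee; ring.
have : J k.+1 (s 0%N).
  by apply: (noetherian_descent nA lA (iJ k.+1) Mx) => // m; case: (Zs m).
rewrite s0 => -[_ [s' [As' ns [c Ac E]]]]; apply: ns.
have -> : s' = p * c.
  by apply: (mulIf (expf_neq0 k p0)); rewrite -E exprSr; ring.
exact: (idealMr iP).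
Qed.

(** If [x] were 0, the non-zero element [p] of [P] would be a unit times a power of [y]; then [P]
    would contain both parameters. *)
Lemma dim2_x_neq0 : x != 0.
Proof.
apply/eqP => x0; have Px : P x by rewrite x0; apply: ideal0 iP.
have Ap := idealS iP Pp.
have [[c Ac E]|[j [u [c [Au nu Ac E]]]]] := order_mod_ex Ap.
  by move: p0; rewrite -E x0 mul0r eqxx.
move: Pp; rewrite E x0 mul0r addr0 => /(prime Au (subringX _ sA Ay)) [Pu|/(prime_exp Ay)].
  have u0 : u != 0 by apply/eqP => u0; apply: nu; rewrite u0; apply: ideal0 (iM 1).
  by apply: P1; apply: (ideal_unit iP Pu u0); case: lA => _ _ _; apply.
exact: y_notP.
Qed.

(** If x did not divide b, then b would be u y^j modulo x with a unit u, and b y in xA would give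
    y^(j+1) in xA. *)
Lemma dim2_regseq : regseq A x y.
Proof.
move=> a b Aa Ab E; have x0 := dim2_x_neq0.
have [[c Ac Eb]|[j [u [c [Au nu Ac Eb]]]]] := order_mod_ex Ab.
  exists c; split=> //; last by rewrite -Eb mulrC.
  by apply: (mulIf x0); rewrite E -Eb; ring.
have u0 : u != 0 by apply/eqP => u0; apply: nu; rewrite u0; apply: ideal0 (iM 1).
have Au' : A u^-1 by case: lA => _ _ _; apply.
case: (@y_exp_mod j.+1); exists (u^-1 * (a - c * y)).
  by apply: (subringM sA) => //; apply: (subringB sA) => //; apply: (subringM sA).
have -> : x * (u^-1 * (a - c * y)) = u^-1 * (a * x - x * c * y) by ring.
by rewrite E Eb exprS; field.
Qed.

(* An element of every power of the maximal ideal is divisible by x, and so is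
   its quotient by x, and so on. *)
Lemma dim2_sep a : (forall n, Mp A x y n a) -> a = 0.
Proof.
move=> Ha; pose Z := [set b | forall n, Mp A x y n b].
have i0 : is_ideal A (pideal A 0) by apply: is_ideal_pideal => //; apply: subring0.
have [|s [s0 Zs rs]] := @dependent_sequence _ Z (fun b c => pideal A 0 (b - x * c)) a Ha.
  move=> b Zb; have [[c Ac E]|[j [u [c [Au nu Ac E]]]]] := order_mod_ex (Zb 0%N).
    exists c; last by rewrite E subrr; apply: ideal0 i0.
    move=> n; apply: (regseq_cancelx sA Ax Ay dim2_regseq) => //.
    by rewrite E; apply: Zb.
  have := Zb j.+1; rewrite E => h.
  by case: (regseq_not_Mp sA Ax Ay dim2_regseq Au Ac nu h).
have [c _] : pideal A 0 (s 0%N).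
  by apply: (noetherian_descent nA lA i0 Mx) => // n; apply: (Zs n 0%N).
by rewrite mul0r s0.
Qed.

End DimensionTwo.

(** The middle prime of a chain of three serves as [P]: it has a non-zero element because it exceeds
    the first one, and it does not contain the maximal ideal because the third one exceeds it. *)
Lemma regular_regp (K : fieldType) (A : set K) : regular_local_ring A 2 ->
  is_quotient_field A -> exists x y, regp A x y.
Proof.
move=> [sA nA locA [[P [hP sP]] _] [s Es]] fA.
have lA := local_lr sA locA.
have [x [y sE]] : exists x y, [set` s] = [set x; y].
  exists (tnth s ord0), (tnth s (lift ord0 ord0)); apply/seteqP; split=> [a /= /tnthP[i ->]|a [->|->]] /=; try exact: mem_tnth.
  by case: (unliftP ord0 i) => [j ->|->]; [right; rewrite (ord1 j)|left].
have Mxy a : [set x; y] a -> maxid A a by move=> h; rewrite Es sE; apply: ideal_genS.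
have Ax : A x by apply: (lr_maxidS lA); apply: Mxy; left.
have Ay : A y by apply: (lr_maxidS lA); apply: Mxy; right.
have ME : maxid A = Mp A x y 1 by rewrite Es sE Mp1_gen.
have lA' : lring A (Mp A x y 1) by rewrite -ME.
have [p Pp np] : exists2 p, P 1%N p & ~ P 0%N p.
  by have [_ /existsNP[p /not_implyP[]]] := sP 0%N isT; exists p.
have p0 : p != 0.
  apply/eqP => p0; apply: np; rewrite p0; have [iP0 _ _] := hP 0%N isT; exact: ideal0 iP0.
have PM : ~ Mp A x y 1 `<=` P 1%N.
  rewrite -ME => h; have [_ /existsNP[q /not_implyP[Pq]]] := sP 1%N isT; apply; apply: h.
  have [iP2 P21 _] := hP 2%N isT; apply: contrapT => nq; apply: P21.
  have Aq := idealS iP2 Pq.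
  by apply: (ideal_unit iP2 Pq); [exact: (lr_neq0 lA nq)|exact: (lr_inv lA)].
have pP := hP 1%N isT.
exists x, y; split=> //; try by case: lA'.
- exact: (dim2_regseq nA lA' Ax Ay pP PM Pp p0).
- exact: (dim2_sep nA lA' Ax Ay pP PM Pp p0).
Qed.

(** * Factorization of polynomials *)

Section Factorization.
Variable k : fieldType.
Implicit Types P G U W : {poly k}.

Lemma irredp_coprime P U : irreducible_poly P -> ~~ (P %| U) -> coprimep P U.
Proof.
move=> irrP PU; apply/coprimepP => d dP dU.
have [/eqP s1|s1] := eqVneq (size d) 1%N; first by rewrite -size_poly_eq1.
by move: (irrP _ s1 dP) PU => /eqp_dvdl <-; rewrite dU.
Qed.

Lemma irredp_factor G : (1 < size G)%N ->
  exists P, [/\ irreducible_poly P, P \is monic & P %| G].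
Proof.
have [n] := ubnP (size G); elim: n G => // n IH G; rewrite ltnS => leG sG.
have G0 : G != 0 by rewrite -size_poly_gt0 (ltn_trans _ sG).
have [irrG|nirr] := pselect (irreducible_poly G).
  have lc0 : (lead_coef G)^-1 != 0 by rewrite invr_neq0 // lead_coef_eq0.
  exists ((lead_coef G)^-1 *: G).
  have E : ((lead_coef G)^-1 *: G) %= G by rewrite eqp_scale.
  split.
  - split; first by rewrite size_scale.
    by move=> q sq; rewrite (eqp_dvdr _ E) => /(irrG _ sq) /eqp_trans; apply; rewrite eqp_sym.
  - by rewrite monicE lead_coefZ mulVf // lead_coef_eq0.
  - by rewrite (eqp_dvdl _ E).
have [q [sq dq nq]] : exists q : {poly k}, [/\ size q != 1%N, q %| G & ~~ (q %= G)].
  apply: contrapT => H; apply: nirr; split=> // q sq dq.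
  by apply: contrapT => nq; apply: H; exists q; split=> //; apply/negP.
have q0 : q != 0 by apply: contraTneq dq => ->; rewrite dvd0p.
have sq1 : (1 < size q)%N by rewrite ltn_neqAle eq_sym sq size_poly_gt0.
have ltq : (size q < size G)%N.
  by rewrite ltn_neqAle dvdp_leq // andbT dvdp_size_eqp.
have [P [irrP mP dP]] := IH q (leq_trans ltq leG) sq1.
by exists P; split=> //; apply: dvdp_trans dq.
Qed.

Lemma irredp_mult P G : irreducible_poly P -> G != 0 ->
  exists i U, G = P ^+ i * U /\ ~~ (P %| U).
Proof.
move=> irrP; have [n] := ubnP (size G); elim: n G => // n IH G; rewrite ltnS => leG G0.
have [|nP] := boolP (P %| G); last by exists 0%N, G; rewrite expr0 mul1r.
case/dvdpP=> H E; have H0 : H != 0 by apply: contraNneq G0 => H0; rewrite E H0 mul0r.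
have P0 := irredp_neq0 irrP.
have [|i [U [EH nU]]] := IH H _ H0.
  apply: leq_trans leG; rewrite E size_mul // -ltnS prednK ?addn_gt0 ?size_poly_gt0 ?H0 //.
  by rewrite -[X in (X < _)%N]addn1 ltn_add2l; case: irrP.
by exists i.+1, U; split=> //; rewrite E EH exprS mulrC mulrA.
Qed.

(** The distinct monic prime factors with their multiplicities [e]. The sum of degrees times
    multiplicities becomes the sum of the [T:S] i_T over the points of one chart. *)
Lemma factorization G : G != 0 ->
  exists (L : seq {poly k}) (e : {poly k} -> nat),
  [/\ uniq L, forall P, P \in L -> [/\ irreducible_poly P, P \is monic & P %| G],
      forall P, P \in L -> exists U, G = P ^+ e P * U /\ ~~ (P %| U),
      (\sum_(P <- L) (size P).-1 * e P)%N = (size G).-1 &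
      forall P, irreducible_poly P -> P \is monic -> P %| G -> P \in L].
Proof.
have [n] := ubnP (size G); elim: n G => // n IH G; rewrite ltnS => leG G0.
have [le1|sG] := leqP (size G) 1.
  exists [::], (fun=> 0%N); split=> //.
    by rewrite big_nil; case: (size G) le1 => [|[]].
  move=> P [sP _] _ /(dvdp_leq G0) /leq_trans /(_ le1).
  by rewrite leqNgt sP.
have [P [irrP mP dP]] := irredp_factor sG.
have [i [U [EG nU]]] := irredp_mult irrP G0.
have P0 := irredp_neq0 irrP.
have U0 : U != 0 by apply: contraNneq nU => ->; rewrite dvdp0.
have i0 : (0 < i)%N.
  by case: i EG => // EG; move: nU dP; rewrite {1}EG expr0 mul1r => /negP.
have sPi : size (P ^+ i) = ((size P).-1 * i).+1.
  by rewrite -size_exp prednK // size_poly_gt0 expf_neq0.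
have sE : size G = (size U + (size P).-1 * i)%N.
  by rewrite EG size_mul ?expf_neq0 // sPi addSn /= addnC.
have sP1 : (0 < (size P).-1)%N by rewrite -ltnS prednK ?size_poly_gt0 //; case: irrP.
have ltU : (size U < n)%N.
  by apply: leq_trans leG; rewrite sE -[X in (X < _)%N]addn0 ltn_add2l muln_gt0 sP1.
have [L [e [uL irrL eL sL fL]]] := IH U ltU U0.
have PL : P \notin L by apply: contra nU => /irrL [].
have irr_eq Q : irreducible_poly Q -> Q \is monic -> Q %| P -> Q = P.
  move=> irrQ mQ dQ; apply/eqP; rewrite -eqp_monic //; apply: irrP => //.
  by case: irrQ => sQ _; rewrite neq_ltn sQ orbT.
exists (P :: L), (fun Q => if Q == P then i else e Q).
have eE Q : Q \in L -> (if Q == P then i else e Q) = e Q.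
  by move=> QL; case: eqP => // QP; rewrite -QP QL in PL.
split.
- by rewrite /= PL.
- move=> Q; rewrite inE => /predU1P[->|/irrL [irrQ mQ dQ]]; first by split.
  by split=> //; rewrite EG dvdp_mull.
- move=> Q; rewrite inE => /predU1P[->|QL]; first by exists U; rewrite eqxx.
  rewrite eE //; have [W [EU nW]] := eL Q QL; have [irrQ mQ _] := irrL Q QL.
  exists (P ^+ i * W); split; first by rewrite EG {1}EU mulrCA.
  rewrite Gauss_dvdpr // coprimep_expr // irredp_coprime //.
  by apply/negP => /(irr_eq _ irrQ mQ) QP; rewrite QP (negPf PL) in QL.
- rewrite big_cons eqxx sE (eq_big_seq (fun Q : {poly k} => ((size Q).-1 * e Q)%N)) => [|Q /eE -> //].
  by rewrite sL (polySpred U0) addSn /= addnC.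
- move=> Q irrQ mQ dQ; rewrite inE; case: eqP => //= QP; apply: fL => //.
  move: dQ; rewrite EG Gauss_dvdpr // coprimep_expr // irredp_coprime //.
  by apply/negP => /(irr_eq _ irrQ mQ).
Qed.

End Factorization.

(** * The chart S[y/x] of the blowing-up *)

(** [S] is a set and not a ring type, so S[X] is cut out of K[X] by a condition on coefficients. *)
Definition polyS (K : fieldType) (S : set K) (p : {poly K}) := forall i, S p`_i.

Section PolyS.
Variables (K : fieldType) (S : set K) (sS : is_subring S).
Implicit Types p q : {poly K}.

Lemma polySC a : S a -> polyS S a%:P.
Proof. by move=> Sa i; rewrite coefC; case: eqP => // _; apply: (subring0 sS). Qed.

Lemma polyS1 : polyS S 1.
Proof. by apply: polySC; apply: subring1. Qed.

Lemma polySX : polyS S 'X.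
Proof.
move=> i; rewrite coefX; case: (i == 1%N); [exact: (subring1 sS)|exact: (subring0 sS)].
Qed.

Lemma polySD p q : polyS S p -> polyS S q -> polyS S (p + q).
Proof. by move=> Sp Sq i; rewrite coefD; apply: (subringD sS). Qed.

Lemma polySB p q : polyS S p -> polyS S q -> polyS S (p - q).
Proof. by move=> Sp Sq i; rewrite coefB; apply: (subringB sS). Qed.

Lemma polySM p q : polyS S p -> polyS S q -> polyS S (p * q).
Proof.
move=> Sp Sq i; rewrite coefM; apply: (subring_sum _ sS) => j _.
exact: (subringM sS).
Qed.

Lemma polySXn n : polyS S 'X^n.
Proof.
elim: n => [|n IH]; first by rewrite expr0; apply: polyS1.
by rewrite exprS; apply: polySM => //; apply: polySX.
Qed.

Lemma polyS_exp p n : polyS S p -> polyS S (p ^+ n).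
Proof.
move=> Sp; elim: n => [|n IH]; first by rewrite expr0; apply: polyS1.
by rewrite exprS; apply: polySM.
Qed.

Lemma polyS_MXaddC p a : polyS S (p * 'X + a%:P) <-> polyS S p /\ S a.
Proof.
split=> [H|[Sp Sa]]; last first.
  by apply: polySD; [apply: polySM => //; apply: polySX|apply: polySC].
split=> [i|]; first by have := H i.+1; rewrite coefD coefMX coefC /= addr0.
by have := H 0%N; rewrite coefD coefMX coefC /= add0r.
Qed.

Lemma polyS_horner (T : set K) p t : is_subring T -> S `<=` T -> T t ->
  polyS S p -> T p.[t].
Proof.
move=> sT ST Tt Sp; rewrite horner_coef; apply: (subring_sum _ sT) => i _.
by apply: (subringM sT); [apply: ST|apply: (subringX _ sT)].
Qed.

End PolyS.

Section Chart.
Variables (K : fieldType) (S : set K) (x y : K) (hS : regp S x y).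
Implicit Types (a b c z : K) (p q r : {poly K}).

Local Notation t := (y / x).
Local Notation B := (blowup_chart S x).

Let sS : is_subring S := regp_sub hS.
Let Sx := regp_x hS.
Let Sy := regp_y hS.
Let x0 : x != 0 := regp_x0 hS.
Let iM n : is_ideal S (Mp S x y n) := Mp_ideal n sS Sx Sy.
Let mE : maxid S = Mp S x y 1 := regp_maxid hS.
Let sB : is_subring B := chart_subring S x.

Lemma chart_t : B t.
Proof. by apply: chart_div; rewrite mE; apply: (regp_My hS). Qed.

Lemma chart_horner p : polyS S p -> B p.[t].
Proof. by apply: polyS_horner => //; [exact: sub_chart|exact: chart_t]. Qed.

Lemma chart_sub' (T : set K) : is_subring T -> S `<=` T -> T t -> B `<=` T.
Proof.
move=> sT ST Tt; apply: chart_sub => // z; rewrite mE => -[a [b [Sa Sb ->]]].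
have -> : (a * x + b * y) / x = a + b * t by field.
by apply: (subringD sT); [apply: ST|apply: (subringM sT) => //; apply: ST].
Qed.

Lemma chartP b : B b -> exists2 p, polyS S p & b = p.[t].
Proof.
have sT : is_subring [set b | exists2 p, polyS S p & b = p.[t]].
  apply: is_subringP.
  - by exists 1; [exact: polyS1|rewrite hornerC].
  - move=> _ _ [p Sp ->] [q Sq ->]; exists (p - q); first exact: polySB.
    by rewrite hornerD hornerN.
  - move=> _ _ [p Sp ->] [q Sq ->]; exists (p * q); first exact: polySM.
    by rewrite hornerM.
move: b; apply: chart_sub' => //.
- by move=> a Sa; exists a%:P; [exact: polySC|rewrite hornerC].
- by exists 'X; [exact: polySX|rewrite hornerX].
Qed.

(** x^n p(y/x) is the value at (x, y) of the form of degree n that homogenizes p. Conversely,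
    [Mp_poly] dehomogenizes. *)
Lemma Mp_horner n p : polyS S p -> (size p <= n.+1)%N -> Mp S x y n (x ^+ n * p.[t]).
Proof.
elim: n p => [|n IH] p Sp sp.
  rewrite expr0 mul1r (size1_polyC sp) hornerC; exact: Sp.
elim/poly_ind: p Sp sp => [|p a _] Sp sp.
  by rewrite horner0 mulr0; apply: ideal0 (iM n.+1).
have [Sp' Sa] := (polyS_MXaddC sS p a).1 Sp.
have sp' : (size p <= n.+1)%N.
  by move: sp; rewrite size_MXaddC; case: ifP => [/andP[/eqP -> _]|]; rewrite ?size_poly0.
rewrite hornerMXaddC.
have -> : x ^+ n.+1 * (p.[t] * t + a) = y * (x ^+ n * p.[t]) + x * (x ^+ n * a%:P.[t]).
  by rewrite hornerC exprS; field.
apply: (idealD (iM n.+1)).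
  by apply: Mp_y => //; apply: IH.
by apply: Mp_x => //; apply: IH; [exact: polySC|exact: leq_trans (size_polyC_leq1 a) _].
Qed.

Lemma Mp_poly n a : Mp S x y n a ->
  exists p, [/\ polyS S p, (size p <= n.+1)%N & a = x ^+ n * p.[t]].
Proof.
elim: n a => [|n IH] a.
  move=> Sa; exists a%:P; split; [exact: polySC|exact: size_polyC_leq1|].
  by rewrite hornerC expr0 mul1r.
move=> /MpSP [b [c [/IH [p [Sp sp ->]] /IH [q [Sq sq ->]] ->]]].
exists (p + q * 'X); split.
- by apply: polySD => //; apply: polySM => //; apply: polySX.
- apply: leq_trans (size_polyD _ _) _; rewrite geq_max (leq_trans sp) //=.
  have [->|q0] := eqVneq q 0; first by rewrite mul0r size_poly0.
  by rewrite size_mulX.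
- by rewrite hornerD hornerM hornerX exprS; field.
Qed.

(** The ideal x^n B contracts to the n-th power of the maximal ideal. If a = x^n p(y/x),
    multiplication by x^N with N the degree of p puts x^N a into the power n + N, and x^N can be
    cancelled there. *)
Lemma Mp_chart n a : S a -> (Mp S x y n a <-> exists2 c, B c & a = x ^+ n * c).
Proof.
move=> Sa; split=> [/Mp_poly [p [Sp _ ->]]|[c /chartP [p Sp ->] E]].
  by exists p.[t] => //; apply: chart_horner.
apply: (regseq_cancelX (m := (size p).-1) sS Sx Sy (regp_reg hS)) => //.
rewrite E mulrCA; set N := (size p).-1.
have H : Mp S x y N (x ^+ N * p.[t]) by apply: Mp_horner => //; apply: leqSpred.
rewrite addnC; elim: {E} n => [|n IH]; first by rewrite expr0 mul1r.
by rewrite exprS -mulrA; apply: Mp_x.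
Qed.

(* The top coefficient c of p is divisible by x, and x t = y lets one trade it for
   a multiple of y in the next lower degree. *)
Lemma chart_relation p : polyS S p -> p.[t] = 0 -> forall i, maxid S p`_i.
Proof.
rewrite mE; have [n] := ubnP (size p); elim: n p => // -[|n] IH p.
  rewrite ltnS leqn0 size_poly_eq0 => /eqP -> _ _ i; rewrite coef0; exact: ideal0 (iM 1).
rewrite ltnS => sp Sp e i.
case: n IH sp => [|n] IH sp.
  have [j|p0] := ltnP i 1; last by rewrite nth_default ?(leq_trans sp) //; apply: ideal0 (iM 1).
  move: e; rewrite (size1_polyC sp) hornerC => ->; rewrite polyC0 coef0; exact: ideal0 (iM 1).
pose q := take_poly n.+1 p.
have Sq : polyS S q.
  by move=> j; rewrite coef_take_poly; case: ifP => // _; apply: (subring0 sS).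
have pE : p = q + p`_n.+1 *: 'X^(n.+1).
  apply/polyP => j; rewrite coefD coefZ coefXn coef_take_poly ltnS.
  have [jn|nj] := leqP j n; first by rewrite (ltn_eqF (leq_ltn_trans jn _)) // mulr0 addr0.
  case: eqP => [->|jn]; first by rewrite mulr1 add0r.
  rewrite mulr0 addr0 nth_default // (leq_trans sp) //.
  by rewrite ltn_neqAle nj andbT; apply/eqP => h; apply: jn.
have sq : (size q <= n.+1)%N by apply: size_take_poly.
have Sz : S (x ^+ n * q.[t]) by apply: (idealS (iM n)); apply: Mp_horner.
have [d Sd Ed] : exists2 d, S d & p`_n.+1 = d * x.
  apply: (regp_dvdx hS (n := n.+1) (a := - (x ^+ n * q.[t]))) => //.
    exact: (subringN sS).
  have : x ^+ n.+1 * p.[t] = 0 by rewrite e mulr0.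
  rewrite {1}pE hornerD hornerZ hornerXn mulrDr => /eqP; rewrite addr_eq0 => /eqP E.
  have -> : p`_n.+1 * y ^+ n.+1 = x ^+ n.+1 * (p`_n.+1 * t ^+ n.+1) by rewrite exprMn exprVn; field; rewrite expf_neq0.
  by rewrite -[RHS]opprK -E exprS; ring.
have M1 : forall j, Mp S x y 1 (q + (d * y) *: 'X^n)`_j.
  apply: IH.
  - rewrite ltnS (leq_trans (size_polyD _ _)) // geq_max sq.
    by rewrite (leq_trans (size_scale_leq _ _)) // size_polyXn.
  - apply: (polySD sS) => // j; rewrite coefZ coefXn.
    apply: (subringM sS); first exact: (subringM sS).
    by case: (j == n); [exact: (subring1 sS)|exact: (subring0 sS)].
  - rewrite hornerD hornerZ hornerXn -[RHS]e [in RHS]pE hornerD hornerZ hornerXn Ed.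
    by rewrite exprS; field.
rewrite pE coefD coefZ Ed; apply: (idealD (iM 1)).
  have := M1 i; rewrite coefD coefZ coefXn => h.
  apply: (idealDr sS (iM 1) _ h).
  apply: (idealMr (iM 1)); first by apply: (idealMl (iM 1)) => //; exact: (regp_My hS).
  by case: (i == n); [exact: (subring1 sS)|exact: (subring0 sS)].
apply: (idealMr (iM 1)); first by apply: (idealMl (iM 1)) => //; exact: (regp_Mx hS).
exact: polySXn.
Qed.

End Chart.

(** * Reduction of polynomials to the residue field *)

Section Reduction.
Variables (K : fieldType) (S : set K) (lS : lr S).
Variables (k : fieldType) (pi : K -> k) (sg : k -> K).
Hypothesis hpi : residue_map S (maxid S) pi sg.
Implicit Types (a b c z : K) (p q r : {poly K}) (G P U : {poly k}).

Let sS : is_subring S := lr_subring lS.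

Lemma res0 : pi 0 = 0.
Proof. by apply/(resP hpi); [exact: subring0|exact: ideal0 (lr_ideal lS)]. Qed.

Lemma resN a : S a -> pi (- a) = - pi a.
Proof.
move=> Sa; apply/eqP; rewrite -addr_eq0 -(resD hpi) ?addNr ?res0 //.
exact: subringN.
Qed.

Lemma resB a b : S a -> S b -> pi (a - b) = pi a - pi b.
Proof. by move=> Sa Sb; rewrite (resD hpi) ?resN //; apply: subringN. Qed.

Lemma res_sum (I : Type) (r : seq I) (F : I -> K) : (forall i, S (F i)) ->
  pi (\sum_(i <- r) F i) = \sum_(i <- r) pi (F i).
Proof.
move=> SF; elim: r => [|i r IH]; first by rewrite !big_nil res0.
rewrite !big_cons (resD hpi) ?IH //; exact: subring_sum.
Qed.

Definition red_poly p : {poly k} := map_poly pi p.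
Definition lift_poly G : {poly K} := map_poly sg G.

Local Notation red := red_poly.
Local Notation lift := lift_poly.

Lemma coef_red p i : (red p)`_i = pi p`_i.
Proof. exact: coef_map_id0 res0. Qed.

Lemma polyS_lift G : polyS S (lift G).
Proof. by move=> i; rewrite coef_map_id0 ?(ressg0 hpi) //; apply: (ressg hpi). Qed.

Lemma redK G : red (lift G) = G.
Proof.
by apply/polyP => i; rewrite coef_red coef_map_id0 ?(ressg0 hpi) // (ressgK hpi).
Qed.

Lemma size_red p : (size (red p) <= size p)%N.
Proof. exact: size_poly. Qed.

Lemma redC a : red a%:P = (pi a)%:P.
Proof.
by apply/polyP => i; rewrite coef_red !coefC; case: eqP => // _; apply: res0.
Qed.

Lemma red1 : red 1 = 1.
Proof. by rewrite redC (res1 hpi). Qed.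

Lemma redX : red 'X = 'X.
Proof.
apply/polyP => i; rewrite coef_red !coefX.
by case: (i == 1%N); [exact: (res1 hpi)|exact: res0].
Qed.

Lemma redD p q : polyS S p -> polyS S q -> red (p + q) = red p + red q.
Proof. by move=> Sp Sq; apply/polyP => i; rewrite coefD !coef_red coefD (resD hpi). Qed.

Lemma redB p q : polyS S p -> polyS S q -> red (p - q) = red p - red q.
Proof. by move=> Sp Sq; apply/polyP => i; rewrite coefB !coef_red coefB resB. Qed.

Lemma redM p q : polyS S p -> polyS S q -> red (p * q) = red p * red q.
Proof.
move=> Sp Sq; apply/polyP => i; rewrite coef_red !coefM res_sum.
  by apply: eq_bigr => j _; rewrite (resM hpi) // !coef_red.
by move=> j; apply: subringM.
Qed.

Lemma red_exp p n : polyS S p -> red (p ^+ n) = red p ^+ n.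
Proof.
move=> Sp; elim: n => [|n IH]; first by rewrite !expr0 red1.
by rewrite !exprS redM ?IH //; apply: polyS_exp.
Qed.

Lemma red_eq0 p : polyS S p -> (red p = 0 <-> forall i, maxid S p`_i).
Proof.
move=> Sp; split=> [e i|h].
  by apply/(resP hpi) => //; rewrite -coef_red e coef0.
by apply/polyP => i; rewrite coef_red coef0; apply/(resP hpi).
Qed.

End Reduction.

(** * The exceptional curve in the chart and its generic point *)

Section ChartPrimes.
Variables (K : fieldType) (S : set K) (x y : K) (hS : regp S x y).
Variables (k : fieldType) (pi : K -> k) (sg : k -> K).
Hypothesis hpi : residue_map S (maxid S) pi sg.
Implicit Types (a b c z : K) (p q r : {poly K}) (G P U : {poly k}) (Q T : set K).

Local Notation t := (y / x).
Local Notation B := (blowup_chart S x).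
Local Notation red := (red_poly pi).
Local Notation lift := (lift_poly sg).

Let sS : is_subring S := regp_sub hS.
Let Sx := regp_x hS.
Let Sy := regp_y hS.
Let x0 : x != 0 := regp_x0 hS.
Let lS : lr S := regp_lr hS.
Let mE : maxid S = Mp S x y 1 := regp_maxid hS.
Let sB : is_subring B := chart_subring S x.
Let Bt : B t := chart_t hS.
Let BS : S `<=` B := sub_chart (x := x).

Lemma chart_maxid a : maxid S a -> exists2 c, B c & a = x * c.
Proof.
rewrite mE => -[b [c [Sb Sc ->]]]; exists (b + c * t); last by field.
by apply: (subringD sB); [exact: BS|apply: (subringM sB) => //; exact: BS].
Qed.

(** This is the isomorphism of B/xB with k[X]. If p(y/x) = x q(y/x), then [chart_relation] applies
    to p - x q, whose reduction is that of p. *)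
Lemma red0_chart p : polyS S p -> (red p = 0 <-> pideal B x p.[t]).
Proof.
move=> Sp; split.
  move/(red_eq0 lS hpi Sp) => H; rewrite horner_coef.
  have iB := is_ideal_pideal sB (BS Sx).
  apply: (ideal_sum _ iB) => i _; apply: (idealMr iB); last exact: (subringX _ sB).
  by have [c Bc ->] := chart_maxid (H i); exists c.
case=> c /(chartP hS) [q Sq ->] E.
have Sxq : polyS S (x%:P * q) by apply: polySM => //; apply: polySC.
have := chart_relation hS (polySB sS Sp Sxq); rewrite hornerD hornerN hornerM hornerC.
rewrite E subrr => /(_ erefl) /(red_eq0 lS hpi (polySB sS Sp Sxq)).
rewrite (redB lS hpi) // (redM lS hpi) //; last exact: polySC.
rewrite (redC lS hpi) ((resP hpi Sx).2 _) ?mul0r ?subr0 // mE; exact: regp_Mx hS.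
Qed.

Lemma red_chart p q : polyS S p -> polyS S q -> p.[t] = q.[t] -> red p = red q.
Proof.
move=> Sp Sq e; apply/eqP; rewrite -subr_eq0 -(redB lS hpi) //; apply/eqP.
apply/red0_chart; first exact: polySB.
rewrite hornerD hornerN e subrr; exists 0; [exact: subring0|exact: mulr0].
Qed.

Lemma pideal_chart_prime : is_prime B (pideal B x).
Proof.
split; first exact: (is_ideal_pideal sB (BS Sx)).
  rewrite -[X in pideal B x X](hornerC 1 t) => /(red0_chart (polyS1 sS)).
  by rewrite (red1 lS hpi) => /eqP; rewrite oner_eq0.
move=> _ _ /(chartP hS) [p Sp ->] /(chartP hS) [q Sq ->].
rewrite -hornerM => /(red0_chart (polySM sS Sp Sq)); rewrite (redM lS hpi) // => /eqP.
by rewrite mulf_eq0 => /orP[] /eqP h; [left|right]; apply/red0_chart.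
Qed.

(** The power of x that divides b is bounded because x^N b lies in S for large N, where orders are
    finite. *)
Lemma chart_val b : B b -> b != 0 ->
  exists n q, [/\ polyS S q, b = x ^+ n * q.[t] & red q != 0].
Proof.
move=> Bb b0; have [p Sp E] := chartP hS Bb; set N := (size p).-1.
pose a := x ^+ N * b.
have Ma : Mp S x y N a by rewrite /a E; apply: (Mp_horner hS) => //; apply: leqSpred.
have Sa : S a by apply: idealS (Mp_ideal N sS Sx Sy) Ma.
have a0 : a != 0 by rewrite mulf_neq0 ?expf_neq0.
have [r [Mr MSr]] := regp_ord_ex hS Sa a0.
have [q [Sq _ Eq]] := Mp_poly hS Mr.
have Nr : (N <= r)%N.
  rewrite leqNgt; apply/negP => lt; apply: MSr; exact: (Mp_le sS Sx Sy lt Ma).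
exists (r - N)%N, q; split=> //.
  by apply: (mulfI (expf_neq0 N x0)); rewrite mulrA -exprD subnKC.
apply/eqP => /(red0_chart Sq) [c Bc Ec]; apply: MSr.
apply: ((Mp_chart hS r.+1 Sa).2 _); exists c => //.
by rewrite Eq -Ec exprSr; ring.
Qed.

(** An element a of S is x^(ord a) times an element of the chart outside (x), so the order in S is
    the order along the exceptional curve. This gives proximity its geometric meaning. *)
Lemma ord_valuation_ringE : ord_valuation_ring S = localization B (pideal B x).
Proof.
have pB := pideal_chart_prime.
have ord_chart a : S a -> a != 0 -> exists c, [/\ B c, ~ pideal B x c & a = x ^+ ord S a * c].
  move=> Sa a0; have [M1 M2] := regp_ordP hS Sa a0.
  have [c Bc E] := (Mp_chart hS (ord S a) Sa).1 M1; exists c; split=> // -[d Bd Ed].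
  apply: M2; apply: ((Mp_chart hS (ord S a).+1 Sa).2 _); exists d => //.
  by rewrite {1}E -Ed exprSr; ring.
apply/seteqP; split.
  move=> _ [a [b [Sa Sb b0 -> h]]].
  have [->|a0] := eqVneq a 0.
    by rewrite mul0r; apply: (subring0 (lr_subring (localization_lr sB pB))).
  have [//|le] : a = 0 \/ (ord S b <= ord S a)%N by [].
    by move=> a00; rewrite a00 eqxx in a0.
  have [c [Bc nc Ea]] := ord_chart a Sa a0; have [d [Bd nd Eb]] := ord_chart b Sb b0.
  move: (ord S a) (ord S b) le Ea Eb => m n le Ea Eb.
  exists (x ^+ (m - n) * c), d; split=> //.
    by apply: (subringM sB) => //; apply: (subringX _ sB); exact: BS.
  have d0 := prime_neq0 pB nd.
  rewrite Ea Eb -[in LHS](subnK le) exprD; field.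
  by rewrite d0 expf_neq0.
move=> _ [c [d [/(chartP hS) [p Sp ->] /(chartP hS) [q Sq ->] nd ->]]].
have d0 := prime_neq0 pB nd.
set N := maxn (size p).-1 (size q).-1.
have Mp1 : Mp S x y N (x ^+ N * p.[t]).
  by apply: (Mp_horner hS) => //; rewrite (leq_trans (leqSpred _)) // ltnS leq_maxl.
have Mq : Mp S x y N (x ^+ N * q.[t]).
  by apply: (Mp_horner hS) => //; rewrite (leq_trans (leqSpred _)) // ltnS leq_maxr.
have iM := Mp_ideal N sS Sx Sy.
have Sq' := idealS iM Mq.
have q0 : x ^+ N * q.[t] != 0 by rewrite mulf_neq0 ?expf_neq0.
exists (x ^+ N * p.[t]), (x ^+ N * q.[t]); split=> //.
- exact: (idealS iM Mp1).
- by field; rewrite d0 expf_neq0.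
have [->|p0] := eqVneq (x ^+ N * p.[t]) 0; [by left|right].
have -> : ord S (x ^+ N * q.[t]) = N.
  apply: (regp_ordE hS) => // /(Mp_chart hS _ Sq') [c' Bc' E]; apply: nd; exists c' => //.
  by apply: (mulfI (expf_neq0 N x0)); rewrite E exprSr; ring.
exact: (regp_le_ord hS).
Qed.

End ChartPrimes.

(** * Closed points of the exceptional curve and their parameters *)

Section ChartPoints.
Variables (K : fieldType) (S : set K) (x y : K) (hS : regp S x y).
Variables (k : fieldType) (pi : K -> k) (sg : k -> K).
Hypothesis hpi : residue_map S (maxid S) pi sg.
Implicit Types (a b c z : K) (p q r : {poly K}) (G U : {poly k}) (Q T : set K).

Local Notation t := (y / x).
Local Notation B := (blowup_chart S x).
Local Notation red := (red_poly pi).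
Local Notation lift := (lift_poly sg).

Let sS : is_subring S := regp_sub hS.
Let Sx := regp_x hS.
Let x0 : x != 0 := regp_x0 hS.
Let lS : lr S := regp_lr hS.
Let mE : maxid S = Mp S x y 1 := regp_maxid hS.
Let sB : is_subring B := chart_subring S x.
Let BS : S `<=` B := sub_chart (x := x).
Let hor p : polyS S p -> B p.[t] := @chart_horner _ _ _ _ hS p.

(* The closed points of the exceptional line in this chart correspond to the
   irreducible polynomials over the residue field. *)
Definition chart_prime p : set K :=
  [set b | exists q, [/\ polyS S q, red p %| red q & b = q.[t]]].

Definition chart_point p : set K := localization B (chart_prime p).

Lemma chart_primeP p q : polyS S q -> (chart_prime p q.[t] <-> red p %| red q).
Proof.
move=> Sq; split=> [[r [Sr d e]]|d]; last by exists q.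
by rewrite (red_chart hS hpi Sq Sr e).
Qed.

Lemma chart_prime_ideal p : is_ideal B (chart_prime p).
Proof.
split.
- by move=> _ [q [Sq _ ->]]; apply: hor.
- exists 0; split; last by rewrite horner0.
    by apply: polySC => //; exact: subring0.
  by rewrite (redC lS hpi) (res0 lS hpi) polyC0 dvdp0.
- move=> _ _ [q [Sq dq ->]] [r [Sr dr ->]]; exists (q + r).
  by split; [exact: polySD|rewrite (redD lS hpi) // dvdp_add|rewrite hornerD].
- move=> _ _ /(chartP hS) [q Sq ->] [r [Sr dr ->]]; exists (q * r).
  by split; [exact: polySM|rewrite (redM lS hpi) // dvdp_mull|rewrite hornerM].
Qed.

Lemma pideal_sub_chart_prime p : pideal B x `<=` chart_prime p.
Proof.
move=> b Pb; have Bb : B b by apply: idealS (is_ideal_pideal sB (BS Sx)) Pb.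
have [q Sq E] := chartP hS Bb; rewrite E; apply/chart_primeP => //.
by have /(red0_chart hS hpi Sq) -> : pideal B x q.[t]; rewrite -?E // dvdp0.
Qed.

Lemma maxid_sub_chart_prime p : maxid S `<=` chart_prime p.
Proof.
move=> a /(chart_maxid hS) [c Bc ->]; apply: pideal_sub_chart_prime.
by exists c.
Qed.

Section Irreducible.
Variables (p : {poly K}) (Sp : polyS S p) (irr : irreducible_poly (red p)).
Local Notation Q := (chart_prime p).
Local Notation T := (chart_point p).
Let iQ := chart_prime_ideal p.

Lemma chart_prime_maximal : is_maximal B Q.
Proof.
split=> //.
  rewrite -[X in chart_prime p X](hornerC 1 t) => /(chart_primeP _ (polyS1 sS)).
  rewrite (red1 lS hpi) => /(dvdp_leq (oner_neq0 _)).
  by rewrite size_poly1 leqNgt; case: irr => ->.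
move=> J iJ QJ.
have [JQ|/existsNP[b /not_implyP[Jb nb]]] := pselect (J `<=` Q).
  by left; apply/seteqP.
right; apply/seteqP; split=> c; first exact: (idealS iJ).
move=> Bc; rewrite -[c]mulr1; apply: (idealMl iJ) => //.
have [q Sq E] := chartP hS (idealS iJ Jb).
have nd : ~~ (red p %| red q).
  by apply/negP => d; apply: nb; rewrite E; apply/chart_primeP.
have [[u v] /= uv] := Bezout_eq1_coprimepP _ _ (irredp_coprime irr nd).
have Su := polyS_lift hpi u; have Sv := polyS_lift hpi v.
pose r := 1 - lift v * q.
have Sr : polyS S r by apply: polySB => //; [exact: polyS1|exact: polySM].
have dr : red p %| red r.
  rewrite (redB lS hpi) //; [|exact: polyS1|exact: polySM].
  rewrite (red1 lS hpi) (redM lS hpi) // (redK lS hpi) -uv addrK.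
  exact: dvdp_mull.
have -> : 1 = r.[t] + (lift v).[t] * b.
  by rewrite /r hornerD hornerN hornerM hornerC E subrK.
apply: (idealD iJ); first by apply: QJ; exists r.
by apply: (idealMl iJ) => //; apply: hor.
Qed.

Lemma chart_prime_prime : is_prime B Q.
Proof. exact: (maximal_prime sB chart_prime_maximal). Qed.

Let pQ := chart_prime_prime.

Lemma chart_point_qt : quadratic_transform S T.
Proof.
exists x, Q; split=> //; [|exact: chart_prime_maximal|exact: maxid_sub_chart_prime].
rewrite mE; exact: regp_Mx hS.
Qed.

Lemma chart_point_lr : lr T.
Proof. exact: localization_lr. Qed.

Lemma sub_chart_point : B `<=` T.
Proof. exact: sub_localization. Qed.

Lemma maxid_chart_point : maxid T = locid B Q.
Proof. exact: maxid_localization. Qed.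

Lemma maxid_chart_pointP q : polyS S q -> (maxid T q.[t] <-> red p %| red q).
Proof.
move=> Sq; apply: iff_trans (chart_primeP _ Sq).
by apply: maxid_localizationI => //; apply: hor.
Qed.

Let sT : is_subring T := lr_subring chart_point_lr.
Let BT := sub_chart_point.
Let w := p.[t].
Let Tw : T w. Proof. by apply: BT; apply: hor. Qed.
Let Tx : T x. Proof. by apply: BT; apply: BS. Qed.

(** A factorization over the residue field lifts to a congruence modulo x; this is the source of all
    normal forms u w^i + x c below. *)
Lemma chart_point_mod q i U : polyS S q -> red q = red p ^+ i * U ->
  exists u c, [/\ polyS S u, B c, red u = U & q.[t] = u.[t] * w ^+ i + x * c].
Proof.
move=> Sq E; have SU := polyS_lift hpi U.
have Sr : polyS S (lift U * p ^+ i) by apply: polySM => //; apply: polyS_exp.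
have : red (q - lift U * p ^+ i) = 0.
  rewrite (redB lS hpi) // (redM lS hpi) ?(red_exp lS hpi) ?(redK lS hpi) //; last exact: polyS_exp.
  by rewrite E mulrC subrr.
move/(red0_chart hS hpi (polySB sS Sq Sr)) => [c Bc Ec].
exists (lift U), c; split=> //; first exact: (redK lS hpi).
by rewrite Ec hornerD hornerN hornerM horner_exp; ring.
Qed.

Lemma maxid_chart_pointE : Mp T x w 1 = locid B Q.
Proof.
have iT := lr_ideal chart_point_lr.
apply/seteqP; split=> [_ [a [b [Ta Tb ->]]]|_ [a [b [[q [Sq dq ->]] Bb nb ->]]]].
  rewrite -maxid_chart_point; apply: (idealD iT); apply: (idealMl iT) => //;
    rewrite maxid_chart_point; apply: (sub_locid sB pQ).
    by apply: pideal_sub_chart_prime; exists 1; [exact: subring1|rewrite mulr1].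
  by exists p.
have [W EW] := dvdpP _ _ dq.
have [|u [c [Su Bc _ ->]]] := chart_point_mod (i := 1) (U := W) Sq.
  by rewrite expr1 mulrC.
have b0 := prime_neq0 pQ nb.
have Tv : T b^-1 by exists 1, b; split=> //; [exact: subring1|rewrite div1r].
exists (c / b), (u.[t] / b); split.
- by apply: (subringM sT) => //; apply: BT.
- by apply: (subringM sT) => //; apply: BT; apply: hor.
- by rewrite expr1; field.
Qed.

Lemma chart_point_unit q : polyS S q -> ~~ (red p %| red q) -> ~ Mp T x w 1 q.[t].
Proof.
move=> Sq /negP nd; rewrite maxid_chart_pointE -maxid_chart_point.
by move/(maxid_chart_pointP Sq).
Qed.

Lemma chart_point_regseq : regseq T x w.
Proof.
move=> _ _ [a [d [Ba Bd nd ->]]] [b [e [Bb Be ne ->]]] E.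
have d0 := prime_neq0 pQ nd; have e0 := prime_neq0 pQ ne.
have [q Sq Eq] := chartP hS (subringM sB Bb Bd).
have E1 : (a * e) * x = q.[t] * w.
  have H v : a / d * x = b / e * v -> a * e * x = b * d * v.
    have -> : a * e * x = (a / d * x) * (d * e) by field.
    by move=> ->; field.
  by rewrite -Eq; apply: H.
have [c Bc Ec] : pideal B x q.[t].
  apply/(red0_chart hS hpi Sq); apply/eqP.
  have : red (q * p) = 0.
    apply/(red0_chart hS hpi (polySM sS Sq Sp)); exists (a * e); first exact: (subringM sB).
    by rewrite hornerM -E1 mulrC.
  rewrite (redM lS hpi) // => /eqP; rewrite mulf_eq0 => /orP[//|].
  by rewrite (negPf (irredp_neq0 irr)).
exists (c / (d * e)); split.
- exists c, (d * e); split=> //; first exact: (subringM sB).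
  exact: (prime_notM pQ).
- have -> : a / d = (a * e * x) / (d * e * x) by field; rewrite x0 d0 e0.
  by rewrite E1 -Ec; field; rewrite x0 d0 e0.
- have -> : b / e = (b * d) / (d * e) by field; rewrite d0 e0.
  by rewrite Eq -Ec; field; rewrite d0 e0.
Qed.

(** The numerator of a non-zero element is x^n (u w^i + x c) with a unit u of T, and such an element
    is not in the power n + i + 1 of the maximal ideal. *)
Lemma chart_point_sep a : (forall n, Mp T x w n a) -> a = 0.
Proof.
move=> Ha; apply: contrapT => /eqP a0.
have [b [d [Bb Bd nd E]]] : T a := Ha 0%N.
have d0 := prime_neq0 pQ nd.
have b0 : b != 0 by apply: contraNneq a0 => b0; rewrite E b0 mul0r.
have [n [q [Sq Eb q0]]] := chart_val hS hpi Bb b0.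
have [i [U [Eq nU]]] := irredp_mult irr q0.
have [u [c [Su Bc Eu Ec]]] := chart_point_mod Sq Eq.
have Tz : T (u.[t] * w ^+ i + x * c) by rewrite -Ec; apply: BT; apply: (hor Sq).
have M1 : Mp T x w (n + i.+1) (x ^+ n * (u.[t] * w ^+ i + x * c)).
  rewrite -Ec -Eb; have -> : b = a * d by rewrite E; field.
  apply: (idealMr (Mp_ideal _ sT Tx Tw)); [exact: Ha|exact: BT].
have := regseq_cancelX sT Tx Tw chart_point_regseq Tz M1.
apply: (regseq_not_Mp sT Tx Tw chart_point_regseq); [by apply: BT; apply: hor|exact: BT|].
by apply: chart_point_unit => //; rewrite Eu.
Qed.

Lemma chart_point_regp : regp T x w.
Proof.
split=> //.
- by move: (lr_not1 chart_point_lr); rewrite maxid_chart_pointE maxid_chart_point.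
- move=> a Ta; rewrite maxid_chart_pointE -maxid_chart_point.
  exact: (lr_inv chart_point_lr).
- exact: chart_point_regseq.
- exact: chart_point_sep.
- move=> z; have [a [b [Sa Sb b0 ->]]] := regp_frac hS z.
  by exists a, b; split=> //; apply: BT; apply: BS.
Qed.

End Irreducible.

(** The primes of B above (x) are those of the principal ideal domain k[X]. One that is larger than
    (x) is generated over x by an element whose reduction has least degree, and that reduction is
    irreducible. *)
Lemma chart_prime_ex Q : is_prime B Q -> Q x ->
  (exists q, [/\ polyS S q, Q q.[t] & red q != 0]) ->
  exists p, [/\ polyS S p, irreducible_poly (red p) & Q = chart_prime p].
Proof.
move=> [iQ Q1 hQ] Qx Hex.
have [n [q [Sq Qq q0 sq]] nmin] : exists2 n, exists q, [/\ polyS S q, Q q.[t], red q != 0 & size (red q) = n] &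
   forall q, polyS S q -> Q q.[t] -> red q != 0 -> (n <= size (red q))%N.
  have [q0 [Sq0 Qq0 nq0]] := Hex.
  have ex : exists n, `[< exists q, [/\ polyS S q, Q q.[t], red q != 0 & size (red q) = n] >].
    by exists (size (red q0)); apply/asboolP; exists q0.
  have [n /asboolP hn nmin] := ex_minnP ex.
  by exists n => // q Sq Qq nq; apply: nmin; apply/asboolP; exists q.
have Qker r : polyS S r -> red r = 0 -> Q r.[t].
  move=> Sr /(red0_chart hS hpi Sr) [c Bc <-]; exact: (idealMr iQ).
have dvdQ r : polyS S r -> Q r.[t] -> red q %| red r.
  move=> Sr Qr; rewrite /dvdp; apply/negPn/negP => nr.
  have Sd := polyS_lift hpi (red r %/ red q).
  have E : red (r - lift (red r %/ red q) * q) = red r %% red q.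
    rewrite (redB lS hpi) //; last exact: polySM.
    rewrite (redM lS hpi) // (redK lS hpi) {1}(divp_eq (red r) (red q)); ring.
  have := nmin (r - lift (red r %/ red q) * q).
  rewrite E -sq leqNgt ltn_modp q0 /= => H; apply: notF; apply: H => //.
    by apply: polySB => //; apply: polySM.
  rewrite hornerD hornerN hornerM; apply: (idealB sB iQ) => //.
  by apply: (idealMl iQ) => //; apply: hor.
have QE : Q = chart_prime q.
  apply/seteqP; split=> [b Qb|b [r [Sr /dvdpP[W EW] ->]]].
    have [r Sr E] := chartP hS (idealS iQ Qb).
    by rewrite E; apply/chart_primeP => //; apply: dvdQ; rewrite -?E.
  have SW := polyS_lift hpi W.
  have -> : r.[t] = (r - lift W * q).[t] + (lift W).[t] * q.[t].
    by rewrite hornerD hornerN hornerM subrK.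
  apply: (idealD iQ); last by apply: (idealMl iQ) => //; apply: hor.
  apply: Qker; first by apply: polySB => //; apply: polySM.
  by rewrite (redB lS hpi) ?(redM lS hpi) ?(redK lS hpi) ?EW ?subrr //; apply: polySM.
exists q; split=> //; split.
  rewrite ltnNge; apply/negP => s1; apply: Q1; rewrite QE.
  rewrite -[X in chart_prime q X](hornerC 1 t); apply/(chart_primeP _ (polyS1 sS)).
  by rewrite (red1 lS hpi) dvdp1 eqn_leq s1 size_poly_gt0.
move=> D sD /dvdpP [H EH].
have SD := polyS_lift hpi D; have SH := polyS_lift hpi H.
have D0 : D != 0 by apply: contraNneq q0 => D0; rewrite EH D0 mulr0.
have H0 : H != 0 by apply: contraNneq q0 => H0; rewrite EH H0 mul0r.
have [] := hQ (lift H).[t] (lift D).[t] (hor SH) (hor SD).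
- rewrite -hornerM QE; apply/chart_primeP; first exact: polySM.
  by rewrite (redM lS hpi) // !(redK lS hpi) -EH.
- move=> /(dvdQ _ SH); rewrite (redK lS hpi) => /(dvdp_leq H0).
  rewrite EH size_mul // leqNgt => /negP[].
  rewrite -ltnS prednK ?addn_gt0 ?size_poly_gt0 ?H0 //.
  rewrite -[X in (X < _)%N]addn1 ltn_add2l ltn_neqAle eq_sym sD.
  by rewrite size_poly_gt0.
- move=> /(dvdQ _ SD); rewrite (redK lS hpi) => dD.
  by rewrite /eqp dD EH dvdp_mull.
Qed.

(** Only the generic point (x) must be excluded; it is not maximal because it is properly contained
    in the prime of the origin y/x = 0. *)
Lemma chart_maximal_ex Q : is_maximal B Q -> maxid S `<=` Q ->
  exists p, [/\ polyS S p, irreducible_poly (red p) & Q = chart_prime p].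
Proof.
move=> hQ mQ; have [iQ Q1 hmax] := hQ.
have Qx : Q x by apply: mQ; rewrite mE; apply: regp_Mx hS.
apply: chart_prime_ex => //; first exact: maximal_prime.
apply: contrapT => H.
have irrX : irreducible_poly (red 'X).
  by rewrite (redX lS hpi) -['X]subr0 -polyC0; apply: irredp_XsubC.
have QP : Q `<=` pideal B x.
  move=> b Qb; have [q Sq E] := chartP hS (idealS iQ Qb); rewrite E.
  apply/(red0_chart hS hpi Sq); apply/eqP/negPn/negP => q0; apply: H.
  by exists q; split=> //; rewrite -E.
have QQ : Q `<=` chart_prime 'X by move=> b /QP; apply: pideal_sub_chart_prime.
have [_ QX1 _] := chart_prime_maximal irrX.
case: (hmax _ (chart_prime_ideal 'X) QQ) => e; last first.
  by apply: QX1; rewrite e; apply: subring1.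
have : pideal B x t by apply: QP; rewrite -e; exists 'X; split=> //; [exact: polySX|rewrite hornerX].
rewrite -[X in pideal B x X](hornerX t) => /(red0_chart hS hpi (polySX sS)).
by rewrite (redX lS hpi) => /eqP; rewrite polyX_eq0.
Qed.

End ChartPoints.

(** * The first neighbourhood *)

Section ResidueDegree.
Variables (K : fieldType) (S T : set K).
Hypotheses (lS : lr S) (lT : lr T) (domST : dominates S T).

(** A non-zero row in the kernel of the coefficient matrix over the residue field of S lifts to the
    relation. It makes the residue degree independent of the basis, and it provides algebraic
    equations for residues. *)
Lemma residue_dependent n (b : 'I_n -> K) m (e : 'I_m -> K) :
  residue_basis S T b -> (n < m)%N -> (forall i, T (e i)) ->
  exists c : 'I_m -> K, [/\ forall i, S (c i), maxid T (\sum_i c i * e i)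
                          & exists i, ~ maxid S (c i)].
Proof.
move=> [Tb hb _] ltnm Te.
have [k [pi [sg hpi]]] := residue_map_ex lS.
have sS := lr_subring lS; have iT := lr_ideal lT.
have /boolp.choice [c hc] : forall i, exists ci : 'I_n -> K,
    (forall j, S (ci j)) /\ maxid T (e i - \sum_j ci j * b j).
  by move=> i; apply: hb.
pose M : 'M[k]_(m, n) := \matrix_(i, j) pi (c i j).
have ker0 : kermx M != 0.
  rewrite -mxrank_eq0 mxrank_ker subn_eq0 -ltnNge.
  exact: leq_ltn_trans (rank_leq_col _) ltnm.
have [u /sub_kermxP uM u0] := rowV0Pn ker0.
exists (fun i => sg (u 0 i)); have Sd i : S (sg (u 0 i)) by apply: (ressg hpi).
split=> //; last first.
  apply: contrapT => H; move/eqP: u0; apply; apply/rowP => i; rewrite mxE.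
  rewrite -[u 0 i](ressgK hpi); apply/(resP hpi) => //.
  by apply: contrapT => ?; apply: H; exists i.
have -> : \sum_i sg (u 0 i) * e i =
   \sum_i sg (u 0 i) * (e i - \sum_j c i j * b j)
   + \sum_j (\sum_i sg (u 0 i) * c i j) * b j.
  have -> : \sum_j (\sum_i sg (u 0 i) * c i j) * b j = \sum_i sg (u 0 i) * (\sum_j c i j * b j).
    rewrite (eq_bigr (fun j => \sum_i sg (u 0 i) * c i j * b j)); last by move=> j _; rewrite mulr_suml.
    rewrite exchange_big /=; apply: eq_bigr => i _; rewrite mulr_sumr.
    by apply: eq_bigr => j _; rewrite mulrA.
  by rewrite -big_split /=; apply: eq_bigr => i _; rewrite -mulrDr subrK.
apply: (idealD iT).
  apply: (ideal_sum _ iT) => i _; apply: (idealMl iT); last exact: (hc i).2.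
  by apply: domST.1.
apply: (ideal_sum _ iT) => j _; apply: (idealMr iT) => //; apply: domST.2.
have Sc i : S (sg (u 0 i) * c i j) by apply: (subringM sS) => //; exact: (hc i).1.
apply/(resP hpi); first exact: (subring_sum _ sS).
rewrite (res_sum lS hpi) //; move/rowP/(_ j): uM; rewrite !mxE => uM0; rewrite -[RHS]uM0.
apply: eq_bigr => i _; rewrite mxE (resM hpi) //; last exact: (hc i).1.
by rewrite (ressgK hpi).
Qed.

Lemma residue_degreeE n (b : 'I_n -> K) : residue_basis S T b -> residue_degree T S = n.
Proof.
move=> hb; have le m1 m2 (e1 : 'I_m1 -> K) (e2 : 'I_m2 -> K) :
    residue_basis S T e1 -> residue_basis S T e2 -> (m2 <= m1)%N.
  move=> h1 h2; rewrite leqNgt; apply/negP => lt.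
  have [Te _ he] := h2.
  have [c [Sc mc [i ni]]] := residue_dependent h1 lt Te.
  exact: ni (he c Sc mc i).
rewrite /residue_degree; case: xgetP => [m -> [e he]|/(_ n)[]]; last by exists b.
by apply/eqP; rewrite eqn_leq (le _ _ _ _ he hb) (le _ _ _ _ hb he).
Qed.

End ResidueDegree.

Lemma residue_basis_trans (K : fieldType) (S T T' : set K) n (b : 'I_n -> K) :
  lr S -> lr T -> lr T' -> dominates S T -> dominates T T' ->
  (forall a, T' a -> exists2 c, T c & maxid T' (a - c)) ->
  residue_basis S T b -> residue_basis S T' b.
Proof.
move=> lS lT lT' [ST mST] [TT' mTT'] H [Tb hb hf].
have sT := lr_subring lT; have iT' := lr_ideal lT'.
split.
- by move=> i; apply: TT'.
- move=> a /H [a' Ta' ma]; have [c [Sc mc]] := hb _ Ta'; exists c; split=> //.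
  have -> : a - \sum_i c i * b i = (a - a') + (a' - \sum_i c i * b i) by ring.
  by apply: (idealD iT') => //; apply: mTT'.
- move=> c Sc mc; apply: hf => //; apply: (dominates_unit lT lT') => //.
  by apply: (subring_sum _ sT) => i _; apply: (subringM sT) => //; apply: ST.
Qed.

Section PointsOfChart.
Variables (K : fieldType) (S : set K) (x y : K) (hS : regp S x y).
Variables (k : fieldType) (pi : K -> k) (sg : k -> K).
Hypothesis hpi : residue_map S (maxid S) pi sg.
Implicit Types (a b c z : K) (p q r : {poly K}) (G U : {poly k}) (Q T : set K).

Local Notation t := (y / x).
Local Notation B := (blowup_chart S x).
Local Notation red := (red_poly pi).
Local Notation lift := (lift_poly sg).
Local Notation chart_prime := (chart_prime S x y pi).
Local Notation chart_point := (chart_point S x y pi).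

Let sS : is_subring S := regp_sub hS.
Let Sx := regp_x hS.
Let x0 : x != 0 := regp_x0 hS.
Let lS : lr S := regp_lr hS.
Let mE : maxid S = Mp S x y 1 := regp_maxid hS.
Let sB : is_subring B := chart_subring S x.
Let Bt : B t := chart_t hS.
Let BS : S `<=` B := sub_chart (x := x).
Let hor p : polyS S p -> B p.[t] := @chart_horner _ _ _ _ hS p.

Lemma chart_point_valuation p : polyS S p -> irreducible_poly (red p) ->
  let V := ord_valuation_ring S in
  [/\ lr V, chart_point p `<=` V, maxid V x & ~ maxid V p.[t]].
Proof.
move=> Sp irr V; have pB := pideal_chart_prime hS hpi.
have VE : V = localization B (pideal B x) := ord_valuation_ringE hS hpi.
rewrite VE; split.
- exact: localization_lr.
- move=> _ [a [b [Ba Bb nb ->]]]; exists a, b; split=> // h; apply: nb.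
  exact: (pideal_sub_chart_prime hS hpi).
- apply/(maxid_localizationI sB pB); first exact: BS.
  by exists 1; [exact: subring1|rewrite mulr1].
- move/(maxid_localizationI sB pB (hor Sp))/(red0_chart hS hpi Sp) => e.
  by move/irredp_neq0: irr; rewrite e eqxx.
Qed.

(** The residue field of the point is k[X]/(red p), with the powers of X below the degree as a
    basis: denominators are inverted modulo the maximal prime, then numerators are replaced by
    remainders. *)
Lemma chart_point_residue p : polyS S p -> irreducible_poly (red p) ->
  residue_basis S (chart_point p) (fun i : 'I_(size (red p)).-1 => t ^+ i).
Proof.
move=> Sp irr; set d := (size (red p)).-1.
have pQ := chart_prime_prime hS hpi irr; have hQ := chart_prime_maximal hS hpi irr.
have BT : B `<=` chart_point p := sub_localization sB pQ.
have lT := chart_point_lr hS hpi irr; have iT := lr_ideal lT.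
have dE : size (red p) = d.+1 by rewrite /d -polySpred // irredp_neq0.
have poly_sum (c : 'I_d -> K) : \sum_i c i * t ^+ i = (\sum_i c i *: 'X^i).[t].
  by rewrite horner_sum; apply: eq_bigr => i _; rewrite hornerZ hornerXn.
have coef_sum (c : 'I_d -> K) j : (\sum_i c i *: 'X^i)`_j = \sum_i c i * (j == i)%:R.
  by rewrite coef_sum; apply: eq_bigr => i _; rewrite coefZ coefXn.
have S_sum (c : 'I_d -> K) : (forall i, S (c i)) -> polyS S (\sum_i c i *: 'X^i).
  move=> Sc j; rewrite coef_sum; apply: (subring_sum _ sS) => i _.
  apply: (subringM sS) => //; case: (j == i :> nat); [exact: subring1|exact: subring0].
have coef_ord (c : 'I_d -> K) (j : 'I_d) : (\sum_i c i *: 'X^i)`_j = c j.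
  rewrite coef_sum (bigD1 j) //= eqxx mulr1 big1 ?addr0 // => i ij.
  by rewrite (_ : (j == i :> nat) = false) ?mulr0 // eq_sym; apply/negbTE.
have size_sum (c : 'I_d -> K) : (size (\sum_i c i *: 'X^i)%R <= d)%N.
  apply/leq_sizeP => j dj; rewrite coef_sum big1 // => i _.
  by rewrite gtn_eqF ?mulr0 // (leq_trans _ dj).
split.
- by move=> i; apply: BT; apply: (subringX _ sB).
- move=> _ [a [b [Ba Bb nb ->]]].
  have [b' Bb' Qb'] := maximal_inv sB hQ Bb nb.
  have [q Sq Eq] := chartP hS (subringM sB Ba Bb').
  pose r := red q %% red p.
  have sr : (size r <= d)%N by rewrite -ltnS -dE ltn_modp irredp_neq0.
  pose c (i : 'I_d) := sg r`_i.
  have Sc i : S (c i) by apply: (ressg hpi).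
  exists c; split=> //.
  have rE : red (\sum_i c i *: 'X^i) = r.
    apply/polyP => j; rewrite (coef_red lS hpi); have [jd|dj] := ltnP j d.
      by rewrite (coef_ord c (Ordinal jd)) (ressgK hpi).
    have -> : r`_j = 0 by apply: nth_default; apply: leq_trans sr dj.
    have -> : (\sum_i c i *: 'X^i)`_j = 0 by apply: nth_default; apply: leq_trans (size_sum c) dj.
    exact: (res0 lS hpi).
  have -> : a / b - \sum_i c i * t ^+ i =
      (- (a / b) * (b * b' - 1)) + (q - \sum_i c i *: 'X^i).[t].
    by rewrite hornerD hornerN -Eq poly_sum; field; exact: (prime_neq0 pQ nb).
  apply: (idealD iT).
    apply: (idealMl iT); last first.
      by rewrite (maxid_chart_point hS hpi irr); apply: (sub_locid sB pQ).
    apply: (subringN (lr_subring lT)); exists a, b; split=> //.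
  apply/(maxid_chart_pointP hS hpi irr); first by apply: polySB => //; apply: S_sum.
  rewrite (redB lS hpi) //; last exact: S_sum.
  by rewrite rE /r {1}(divp_eq (red q) (red p)) addrK dvdp_mull.
- move=> c Sc; rewrite poly_sum => /(maxid_chart_pointP hS hpi irr (S_sum _ Sc)) dv i.
  suff r0 : red (\sum_i c i *: 'X^i) = 0.
    by rewrite -(coef_ord c i); apply: ((red_eq0 lS hpi (S_sum _ Sc)).1 r0).
  apply/eqP/negPn/negP => r0; have := dvdp_leq r0 dv; rewrite dE leqNgt => /negP; apply.
  rewrite ltnS; apply: leq_trans (size_red _ _) _; exact: size_sum.
Qed.

Lemma dvdX_red q : polyS S q -> ('X %| red q) <-> maxid S q`_0.
Proof.
move=> Sq; rewrite -(resP hpi) // -(coef_red lS hpi) -horner_coef0.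
by rewrite -['X]subr0 -polyC0 dvdp_XsubCl; split=> [/eqP|/eqP].
Qed.

Lemma irreducible_redX : irreducible_poly (red 'X).
Proof. by rewrite (redX lS hpi) -['X]subr0 -polyC0; apply: irredp_XsubC. Qed.

(** When y/x is a non-unit of T, the value q(y/x) is a non-unit exactly if the constant term of q
    is, so the centre of T in the chart is the origin. *)
Lemma contraction_origin T : lr T -> dominates S T -> maxid T t ->
  maxid T `&` B = chart_prime 'X.
Proof.
move=> lT [ST mST] mt; have sT := lr_subring lT; have iT := lr_ideal lT.
have Tt := lr_maxidS lT mt.
have BT : B `<=` T by apply: (chart_sub' hS).
have H q : polyS S q -> maxid T q.[t] <-> 'X %| red q.
  move=> Sq; rewrite dvdX_red //.
  elim/poly_ind: q Sq => [_|q a _ /(polyS_MXaddC sS _ _).1 [Sq Sa]].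
    rewrite horner0 coef0; split=> _; [exact: (ideal0 (lr_ideal lS))|exact: (ideal0 iT)].
  rewrite hornerMXaddC coefD coefMX coefC /= add0r.
  have mq : maxid T (q.[t] * t) by apply: (idealMl iT) => //; apply: BT; apply: hor.
  split=> [h|/mST h]; last exact: (idealD iT).
  apply: (dominates_unit lS lT) => //; rewrite -[a](addKr (q.[t] * t)) addrC.
  exact: (idealB sT iT).
apply/seteqP; split=> [b [mb /(chartP hS) [q Sq E]]|_ [q [Sq dq ->]]].
  exists q; split=> //; rewrite (redX lS hpi); apply/H => //; by rewrite -E.
by split; [apply/H => //; rewrite -(redX lS hpi)|apply: hor].
Qed.

Lemma qt_origin T T' : lr T' -> quadratic_transform S T -> dominates T T' ->
  maxid T' t -> T = chart_point 'X.
Proof.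
move=> lT' qT dT mt; have [lT dST _] := qt_generator lS qT.
have dST' := dominates_trans dST dT.
have T'z z : maxid S z -> T' (z / x).
  rewrite mE => -[a [b [Sa Sb ->]]].
  have -> : (a * x + b * y) / x = a + b * t by field.
  have sT' := lr_subring lT'; have Tt := lr_maxidS lT' mt.
  by apply: (subringD sT'); [apply: dST'.1|apply: (subringM sT') => //; apply: dST'.1].
have mx : maxid S x by rewrite mE; apply: regp_Mx hS.
by rewrite (qt_localization lS lT' qT dT mx x0 T'z) contraction_origin.
Qed.

End PointsOfChart.

Lemma qt_chart_point (K : fieldType) (S T : set K) (x0 y0 : K) (k : fieldType)
    (pi : K -> k) (sg : k -> K) :
  regp S x0 y0 -> residue_map S (maxid S) pi sg -> quadratic_transform S T ->
  exists x y p, [/\ regp S x y, polyS S p, irreducible_poly (red_poly pi p)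
                  & T = chart_point S x y pi p].
Proof.
move=> h0 hpi /(qt_regp h0) [x [y [Q [hS hQ mQ ->]]]].
have [p [Sp irr ->]] := chart_maximal_ex hS hpi hQ mQ.
by exists x, y, p.
Qed.

Section Points.
Variables (K : fieldType) (S : set K) (x y : K) (hS : regp S x y).
Variables (k : fieldType) (pi : K -> k) (sg : k -> K).
Hypothesis hpi : residue_map S (maxid S) pi sg.
Implicit Types (T : set K).

Let sS : is_subring S := regp_sub hS.
Let x0 : x != 0 := regp_x0 hS.
Let y0 : y != 0 := regp_y0 hS.
Let lS : lr S := regp_lr hS.
Let mE : maxid S = Mp S x y 1 := regp_maxid hS.

Lemma qt_regular T : quadratic_transform S T -> exists z w, regp T z w.
Proof.
move=> /(qt_chart_point hS hpi) [x' [y' [p [hS' Sp irr ->]]]].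
by exists x', p.[y' / x']; apply: (chart_point_regp hS' hpi Sp irr).
Qed.

(** For fixed parameters the exceptional line consists of one affine chart and one point at
    infinity, the origin of the other chart. *)
Lemma qt_points T : quadratic_transform S T ->
  (exists p, [/\ polyS S p, irreducible_poly (red_poly pi p) & T = chart_point S x y pi p])
  \/ T = chart_point S y x pi 'X.
Proof.
move=> qT; have [lT dST _] := qt_generator lS qT.
have [u [u0 Tx Ty nxy]] := qt_generator_regp hS qT.
have sT := lr_subring lT; have iT := lr_ideal lT.
have mx : maxid S x by rewrite mE; apply: regp_Mx hS.
have [nx|nx] := pselect (maxid T (x / u)).
  right; apply: (qt_origin (regp_swap hS) hpi lT qT (dominates_refl T)).
  have -> : x / y = (x / u) * (y / u)^-1 by field; rewrite u0 y0.
  by apply: (idealMr iT) => //; apply: (lr_inv lT) => // ny; apply: nxy.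
left.
have Tt : T (y / x).
  have -> : y / x = (y / u) * (x / u)^-1 by field; rewrite u0 x0.
  by apply: (subringM sT) => //; apply: (lr_inv lT).
have Tz z : maxid S z -> T (z / x).
  rewrite mE => -[a' [b' [Sa' Sb' ->]]].
  have -> : (a' * x + b' * y) / x = a' + b' * (y / x) by field.
  by apply: (subringD sT); [apply: dST.1|apply: (subringM sT) => //; apply: dST.1].
have TE := qt_localization lS lT qT (dominates_refl T) mx x0 Tz.
have sB := chart_subring S x.
have BT : blowup_chart S x `<=` T by apply: (chart_sub' hS) => //; apply: dST.1.
have pQ := contraction_prime lT sB BT.
have [||p [Sp irr QE]] := chart_prime_ex hS hpi pQ.
- by split; [apply: dST.2|apply: sub_chart; apply: (regp_x hS)].
- have [x' [y' [p [hS' Sp irr E]]]] := qt_chart_point hS hpi qT.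
  have hb := chart_point_residue hS' hpi Sp irr; rewrite -E in hb.
  set n := (size (red_poly pi p)).-1 in hb.
  (* The n + 1 powers of y/x are dependent over a residue extension of degree n. The resulting
     equation shows that the centre of T in this chart is not the generic point (x). *)
  have [|c [Sc mc [i ni]]] := residue_dependent lS lT dST hb (ltnSn n) (e := fun i => (y / x) ^+ i).
    by move=> i; apply: (subringX _ sT).
  pose q := \poly_(i < n.+1) c (inord i).
  have Sq : polyS S q.
    by move=> j; rewrite coef_poly; case: ifP => // _; apply: (subring0 sS).
  have qE : q.[y / x] = \sum_i c i * (y / x) ^+ i.
    by rewrite horner_poly; apply: eq_bigr => j _; rewrite inord_val.
  exists q; split=> //.
    by split; [rewrite qE|apply: (chart_horner hS)].
  apply/eqP => /(red_eq0 lS hpi Sq) /(_ i); rewrite coef_poly ltn_ord inord_val.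
  exact: ni.
- by exists p; split=> //; rewrite TE QE.
Qed.

End Points.

(** * Points proximate to S *)

Section StrictTransform.
Variable K : fieldType.
Implicit Types (S T V : set K) (a b c h u x y z w : K).

Lemma ideal_gen_principal S T g : lr S -> lr T -> maxid S g -> g != 0 ->
  (forall v, maxid S v -> T (v / g)) -> S `<=` T ->
  ideal_gen T (maxid S) = pideal T g.
Proof.
move=> lS lT mg g0 Tg ST; have sT := lr_subring lT.
have Tg' : T g by apply: ST; apply: (lr_maxidS lS).
apply/seteqP; split.
  apply: ideal_gen_sub; first exact: (is_ideal_pideal sT).
  by move=> v mv; exists (v / g); [exact: Tg|field].
move=> _ [a Ta <-].
have iG : is_ideal T (ideal_gen T (maxid S)).
  by apply: (is_ideal_gen sT) => v mv; apply: ST; apply: (lr_maxidS lS).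
by apply: (idealMr iG) => //; apply: ideal_genS.
Qed.

(** Two generators of the extended maximal ideal differ by a unit of T and two equations of the
    curve by a unit of S, so all choices in the definition give the same ideal. *)
Lemma strict_transform1E S T x y h g : regp S x y -> quadratic_transform S T ->
  S h -> h != 0 -> maxid S g -> g != 0 -> (forall v, maxid S v -> T (v / g)) ->
  strict_transform1 S T (pideal S h) = pideal T (h / g ^+ ord S h).
Proof.
move=> hS qT Sh h0 mg g0 Tg; have lS := regp_lr hS; have sS := lr_subring lS.
have [lT [ST _] _] := qt_generator lS qT; have sT := lr_subring lT.
have gE := ideal_gen_principal lS lT mg g0 Tg ST.
have gen a : S a -> pideal S a a by move=> Sa; exists 1; [exact: subring1|rewrite mulr1].
have Tgen : pideal T g g by exists 1; [exact: subring1|rewrite mulr1].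
apply/seteqP; split; last first.
  by move=> z hz; exists g, h; split=> //; rewrite mulrC.
move=> z [x' [h' [xE h'0 hE [c Tc <-]]]].
have [a Sa Ea] : pideal S h h'.
  by rewrite hE; exists 1; [exact: subring1|rewrite mulr1].
have [a' Sa' Ea'] : pideal S h' h by rewrite -hE; apply: gen.
have a0 : a != 0 by apply: contraNneq h'0 => a0; rewrite -Ea a0 mulr0.
have aV : a^-1 = a'.
  by apply: (mulfI (mulf_neq0 h0 a0)); rewrite mulfK // Ea Ea'.
have [b Tb Eb] : pideal T g x'.
  by rewrite -gE xE; exists 1; [exact: subring1|rewrite mulr1].
have [b' Tb' Eb'] : pideal T x' g by rewrite -xE gE.
have b0 : b != 0.
  by apply: contraNneq g0 => b0; rewrite -Eb' -Eb b0 mulr0 mul0r.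
have bV : b^-1 = b'.
  by apply: (mulfI (mulf_neq0 g0 b0)); rewrite mulfK // Eb Eb'.
rewrite -Ea (regp_unit_ord hS) ?aV // -Eb; move: (ord S h) => n.
exists (b' ^+ n * a * c); last first.
  by rewrite -bV exprMn exprVn; field; rewrite !expf_neq0.
by apply: (subringM sT) => //; apply: (subringM sT); [exact: subringX|exact: ST].
Qed.

End StrictTransform.

(** * The infinitely near points on a smooth curve *)

Section Proximity.
Variable K : fieldType.
Implicit Types (S T V : set K) (a b c h u x y z w : K).

(* V is the local ring at the generic point of the curve z = 0, which passes
   through T and is smooth there. *)
Record on_curve V T z w : Prop := OnCurve {
  oc_regp : regp T z w;
  oc_lr : lr V;
  oc_sub : T `<=` V;
  oc_z : maxid V z;
  oc_w : ~ maxid V w }.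

(* The point of the first neighbourhood of T on the strict transform of the curve
   with generic local ring V. *)
Definition next_pt V T : set K :=
  xget set0 [set T' | quadratic_transform T T' /\ T' `<=` V].

Section Next.
Variables (V T : set K) (z w : K) (hT : on_curve V T z w).

Let rT := oc_regp hT.
Let lT := regp_lr rT.
Let lV := oc_lr hT.
Let TV := oc_sub hT.
Let z0 : z != 0 := regp_x0 rT.
Let w0 : w != 0 := regp_y0 rT.
Let sV := lr_subring lV.
Let iV := lr_ideal lV.
Let Vw' : V w^-1. Proof. by apply: (lr_inv lV (TV (regp_y rT)) (oc_w hT)). Qed.
Let mzw : maxid V (z / w). Proof. exact: (idealMr iV (oc_z hT)). Qed.
Let not_Vwz : ~ V (w / z).
Proof.
move=> h; apply: (oc_w hT); have -> : w = z * (w / z) by field.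
exact: (idealMr iV (oc_z hT)).
Qed.

(** The point is the origin of the chart of w, where the curve has the equation z/w = 0 and w is
    still transversal to it; being rational over T, it has the same residue field. It is unique
    because w/z is not in V: in any transform inside V the quotient z/w must then be a non-unit,
    which characterizes the origin. *)
Lemma next_pt_ex : exists T', [/\ quadratic_transform T T', T' `<=` V,
  forall T'', quadratic_transform T T'' -> T'' `<=` V -> T'' = T',
  on_curve V T' (z / w) w &
  forall a, T' a -> exists2 c, T c & maxid T' (a - c)].
Proof.
have [k [pi [sg hpi]]] := residue_map_ex lT.
have rT' := regp_swap rT; have sT := lr_subring lT.
have irr := irreducible_redX rT' hpi; have SX := polySX sT.
have regN := chart_point_regp rT' hpi SX irr; rewrite hornerX in regN.
have resN := chart_point_residue rT' hpi SX irr.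
set N := chart_point T w z pi 'X in regN resN.
have BV : blowup_chart T w `<=` V by apply: (chart_sub' rT') => //; apply: (lr_maxidS lV).
have NV : N `<=` V.
  move=> _ [a [b [Ba Bb nb ->]]]; apply: (subringM sV); first exact: BV.
  apply: (lr_inv lV); first exact: BV.
  have [q Sq E] := chartP rT' Bb; rewrite E in nb *.
  (* A denominator is a unit of T plus a multiple of z/w, and z/w lies in the maximal ideal of V, so
     it is invertible in V. *)
  have {}nb : ~ maxid T q`_0.
    move=> h; apply: nb; exists q; split=> //; rewrite (redX lT hpi).
    exact/(dvdX_red rT' hpi Sq).
  elim/poly_ind: q Sq nb {E} => [|q d _] Sq; first by rewrite coef0 => -[]; apply: ideal0 (lr_ideal lT).
  have [Sq' Sd] := (polyS_MXaddC sT q d).1 Sq.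
  rewrite hornerMXaddC coefD coefMX coefC /= add0r addrC => nd.
  apply: (lr_notD lV); last by apply: (idealMl iV) => //; apply: BV; apply: (chart_horner rT').
  by apply: (lr_unitP lV); [exact: (lr_neq0 lT nd)|apply: TV; apply: (lr_inv lT)].
exists N; split=> //.
- exact: (chart_point_qt rT' hpi irr).
- move=> T'' qT TV''; have [lT'' dTT _] := qt_generator lT qT.
  have [u [u0 Tz Tw nzw]] := qt_generator_regp rT qT; have iT'' := lr_ideal lT''.
  have nw : ~ maxid T'' (w / u).
    move=> mw; apply: not_Vwz; have -> : w / z = (w / u) * (z / u)^-1 by field; rewrite z0 u0.
    apply: TV''; apply: (subringM (lr_subring lT'')) => //; apply: (lr_inv lT'') => // mz.
    exact: nzw.
  apply: (qt_origin rT' hpi lT'' qT (dominates_refl T'')).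
  apply: contrapT => nz; apply: not_Vwz; rewrite -invf_div; apply: TV''.
  apply: (lr_inv lT'') => //.
  have -> : z / w = (z / u) * (w / u)^-1 by field; rewrite w0 u0.
  by apply: (subringM (lr_subring lT'')) => //; apply: (lr_inv lT'').
- split=> //; [exact: (regp_swap regN)|exact: oc_w hT].
- have resN1 : residue_basis T N (fun i : 'I_1 => (z / w) ^+ i).
    by move: resN; rewrite (redX lT hpi) size_polyX.
  have [_ gen _] := resN1; move=> a /gen [c [Tc]]; rewrite big_ord1 expr0 mulr1 => mc.
  by exists (c ord0).
Qed.

Lemma next_ptP : [/\ quadratic_transform T (next_pt V T), next_pt V T `<=` V,
  forall T'', quadratic_transform T T'' -> T'' `<=` V -> T'' = next_pt V T,
  on_curve V (next_pt V T) (z / w) w &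
  forall a, next_pt V T a -> exists2 c, T c & maxid (next_pt V T) (a - c)].
Proof.
have [T' [qT TV' uniq cT res]] := next_pt_ex.
suff -> : next_pt V T = T' by split.
rewrite /next_pt; case: xgetP => [T'' -> [q h]|/(_ T')[]]; last by split.
exact: uniq.
Qed.

Local Notation T' := (next_pt V T).
Let qT : quadratic_transform T T'. Proof. by case: next_ptP. Qed.
Let cT : on_curve V T' (z / w) w. Proof. by case: next_ptP. Qed.
Let rT' := oc_regp cT.
Let lT' := regp_lr rT'.
Let sT' := lr_subring lT'.
Let sT := lr_subring lT.
Let dTT : dominates T T'. Proof. by have [] := qt_generator lT qT. Qed.

Lemma next_pt_div v : maxid T v -> T' (v / w).
Proof.
rewrite (regp_maxid rT) => -[a [b [Ta Tb ->]]].
have -> : (a * z + b * w) / w = a * (z / w) + b by field.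
apply: (subringD sT'); last exact: dTT.1.
by apply: (subringM sT'); [exact: dTT.1|exact: regp_x rT'].
Qed.

Lemma next_pt_Mp n a : Mp T z w n a -> T' (a / w ^+ n).
Proof.
apply: Mp_div => //; [exact: dTT.1|exact: regp_x rT'|rewrite divff //; exact: subring1].
Qed.

(* The exponent i is the intersection multiplicity at T of h with z = 0. *)
Definition normal_form h u i c := [/\ T u, ~ maxid T u, T c & h = u * w ^+ i + z * c].

Section NormalForm.
Variables (h u c : K) (i : nat) (hh : normal_form h u i c).

Lemma normal_formT : T h.
Proof.
case: hh => Tu _ Tc ->.
by apply: (subringD sT); apply: (subringM sT) => //;
  [apply: (subringX _ sT); exact: regp_y rT|exact: regp_x rT].
Qed.

Lemma normal_form_not_Mp : ~ Mp T z w i.+1 h.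
Proof.
case: hh => Tu nu Tc ->; rewrite (regp_maxid rT) in nu.
exact: (regseq_not_Mp sT (regp_x rT) (regp_y rT) (regp_reg rT)).
Qed.

Lemma normal_form_neq0 : h != 0.
Proof.
apply/eqP => h0; apply: normal_form_not_Mp; rewrite h0.
exact: ideal0 (Mp_ideal _ sT (regp_x rT) (regp_y rT)).
Qed.

(** The first bound keeps i - ord h from being truncated; the second makes the intersection
    multiplicity drop at each step while it is positive. *)
Lemma normal_form_ord : (ord T h <= i)%N /\ ((0 < i)%N -> (0 < ord T h)%N).
Proof.
split; last first.
  move=> i0; apply: (regp_le_ord rT) normal_form_neq0; rewrite -(regp_maxid rT).
  case: hh => Tu _ Tc ->; have iT := lr_ideal lT.
  have mz : maxid T z by rewrite (regp_maxid rT); apply: regp_Mx rT.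
  have mw : maxid T w by rewrite (regp_maxid rT); apply: regp_My rT.
  apply: (idealD iT); last exact: (idealMr iT).
  case: i i0 => // n _; rewrite exprSr mulrA; apply: (idealMl iT) => //.
  by apply: (subringM sT) => //; apply: (subringX _ sT); exact: regp_y rT.
rewrite leqNgt; apply/negP => lt; apply: normal_form_not_Mp.
exact: (Mp_le sT (regp_x rT) (regp_y rT) lt (regp_ordP rT normal_formT normal_form_neq0).1).
Qed.

Lemma next_pt_strict :
  strict_transform1 T T' (pideal T h) = pideal T' (h / w ^+ ord T h).
Proof.
apply: (strict_transform1E rT qT normal_formT normal_form_neq0 _ w0 next_pt_div).
by rewrite (regp_maxid rT); exact: regp_My rT.
Qed.

End NormalForm.

End Next.

(** With r the order of h, division by w^r turns z c into (z/w) (c w / w^r). The last factor is in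
    the next point: for r > 0, z c = h - u w^i lies in the power r of the maximal ideal, so c lies
    in the power r - 1. *)
Lemma normal_form_next V T z w h u c i : on_curve V T z w -> normal_form T z w h u i c ->
  exists c', normal_form (next_pt V T) (z / w) w (h / w ^+ ord T h) u (i - ord T h) c'.
Proof.
move=> hT hh; have [le _] := normal_form_ord hT hh.
have rT := oc_regp hT; have sT := regp_sub rT; have lT := regp_lr rT.
have [Tz Tw] := (regp_x rT, regp_y rT); have w0 := regp_y0 rT.
have [qT _ _ hT' _] := next_ptP hT.
have rT' := oc_regp hT'; have sT' := regp_sub rT'; have lT' := regp_lr rT'.
have [_ [TT' mTT'] _] := qt_generator lT qT.
have [Tu nu Tc hE] := hh; have iM n := Mp_ideal n sT Tz Tw.
have := (regp_ordP rT (normal_formT hT hh) (normal_form_neq0 hT hh)).1.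
move: (ord T h) le => r le Mr.
exists (c * w / w ^+ r); split.
- exact: TT'.
- exact: (fun e => nu (dominates_unit lT lT' (conj TT' mTT') Tu e)).
- case: r le Mr => [|r] le Mr; first by rewrite expr0 divr1; apply: (subringM sT'); apply: TT'.
  have -> : c * w / w ^+ r.+1 = c / w ^+ r by rewrite exprS; field; rewrite w0 expf_neq0.
  apply: (next_pt_Mp hT); apply: (regp_cancelx rT Tc).
  have -> : z * c = h - u * w ^+ i by rewrite hE; ring.
  apply: (idealB sT (iM _) Mr); apply: (Mp_le sT Tz Tw le).
  apply: (idealMl (iM _) Tu); elim: (i) => [|n IH]; first by rewrite expr0; apply: subring1.
  by rewrite exprS; apply: Mp_y.
- by rewrite hE -{1}(subnK le) exprD; field; rewrite w0 expf_neq0.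
Qed.

(** The remaining multiplicity decreases by the order at each point, and by at least one while it is
    positive, so i steps exhaust it and any further terms are 0. *)
Lemma sum_orders_on_curve V N T z w h u c i : on_curve V T z w ->
  normal_form T z w h u i c -> (i <= N)%N ->
  (\sum_(0 <= j < N) ordI (iter j (next_pt V) T)
    (strict_transform_along T (traject (next_pt V) (next_pt V T) j) (pideal T h)))%N = i.
Proof.
elim: N T z w h u c i => [|N IH] T z w h u c i hT hh.
  by rewrite leqn0 => /eqP ->; rewrite big_nil.
move=> leN; have [le pos] := normal_form_ord hT hh.
have [qT _ _ hT' _] := next_ptP hT; have [c' hh'] := normal_form_next hT hh.
have rT := oc_regp hT.
rewrite big_nat_recl //= (regp_ordI rT (normal_formT hT hh) (normal_form_neq0 hT hh)).
under eq_bigr => j _ do rewrite -iterS iterSr (next_pt_strict hT hh).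
rewrite (IH _ _ _ _ _ _ _ hT' hh') ?subnKC //.
case: i leN {hh hh'} pos le => [|i] leN pos le; first by rewrite sub0n.
rewrite leq_subLR; apply: leq_trans leN _.
by rewrite -[X in (X <= _)%N]add1n leq_add2r pos.
Qed.

End Proximity.

(* i is the intersection multiplicity at T of the exceptional curve with the
   strict transform of h. *)
Definition exc_intersection (K : fieldType) (S : set K) (h : K) (T : set K) (i : nat) :=
  quadratic_transform S T /\ exists z w h' u c n (b : 'I_n -> K),
  [/\ on_curve (ord_valuation_ring S) T z w, normal_form T z w h' u i c,
      strict_transform1 S T (pideal S h) = pideal T h' & residue_basis S T b].

(** * Intersection multiplicities over the first neighbourhood *)

Section FirstNeighbourhood.
Variables (K : fieldType) (S : set K) (k : fieldType) (pi : K -> k) (sg : k -> K).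
Hypothesis hpi : residue_map S (maxid S) pi sg.
Implicit Types (a b c h x y z : K) (p q : {poly K}) (T : set K) (U : {poly k}).
Local Notation red := (red_poly pi).

(** As m is the order of h, q(y/x) is an equation of the strict transform, and x = 0 is the
    exceptional curve; the intersection multiplicity is thus the exponent of [red p] in [red q]. *)
Lemma chart_point_exc_intersection x y p q m h i U : regp S x y ->
  polyS S p -> irreducible_poly (red p) -> polyS S q -> h = x ^+ m * q.[y / x] ->
  S h -> h != 0 -> ord S h = m -> red q = red p ^+ i * U -> ~~ (red p %| U) ->
  exc_intersection S h (chart_point S x y pi p) i.
Proof.
move=> hS Sp irr Sq hE Sh h0 om qE nU; have lS := regp_lr hS.
have qT := chart_point_qt hS hpi irr; split=> //.
have x0 := regp_x0 hS; have mx : maxid S x by rewrite (regp_maxid hS); apply: regp_Mx hS.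
have [u [c [Su Bc uE hc]]] := chart_point_mod hS hpi Sp Sq qE.
have BT := sub_chart_point hS hpi irr.
have [lV TV Vx Vp] := chart_point_valuation hS hpi Sp irr.
exists x, p.[y / x], q.[y / x], u.[y / x], c, (size (red p)).-1, (fun i => (y / x) ^+ i).
split.
- by split=> //; apply: (chart_point_regp hS hpi Sp irr).
- split=> //; [by apply: BT; apply: (chart_horner hS)| |exact: BT].
  by move/(maxid_chart_pointP hS hpi irr Su); rewrite uE; apply/negP.
- rewrite (strict_transform1E hS qT Sh h0 mx x0); last first.
    by move=> v mv; apply: BT; apply: chart_div.
  by rewrite om hE mulrAC divff ?mul1r // expf_neq0.
- exact: (chart_point_residue hS hpi Sp irr).
Qed.

Lemma chart_point_eqp x y p q : red p %= red q ->
  chart_point S x y pi p = chart_point S x y pi q.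
Proof.
move=> pq; congr localization; apply/seteqP; split=> b [r [Sr d ->]]; exists r;
  by rewrite ?(eqp_dvdl _ pq) // -(eqp_dvdl _ pq).
Qed.

(** The polynomial G dehomogenizes the initial form of h. Its degree D may be less than the order m;
    the defect m - D is the multiplicity at infinity, and that point is listed even when the defect
    is 0. *)
Lemma first_neighbourhood x y h : regp S x y -> S h -> h != 0 ->
  exists L : seq (set K * nat),
  [/\ uniq [seq Ti.1 | Ti <- L],
      forall Ti, Ti \in L -> exc_intersection S h Ti.1 Ti.2,
      forall T, quadratic_transform S T -> T \notin [seq Ti.1 | Ti <- L] ->
        exc_intersection S h T 0
    & (\sum_(Ti <- L) residue_degree Ti.1 S * Ti.2)%N = ord S h].
Proof.
move=> hS Sh h0; have lS := regp_lr hS; have hS' := regp_swap hS.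
have [x0 y0] := (regp_x0 hS, regp_y0 hS).
have [Mh nMh] := regp_ordP hS Sh h0.
have [m om] : exists m, ord S h = m by exists (ord S h).
rewrite om in Mh nMh *.
have [q [Sq sq hE]] := Mp_poly hS Mh.
pose G := red q; have [D DE] : exists D, D = (size G).-1 by exists (size G).-1.
(* If G vanished, h would be divisible by x^(m+1) in the chart and have order greater than m. *)
have G0 : G != 0.
  apply/eqP => /(red0_chart hS hpi Sq) [c Bc E]; apply: nMh.
  by apply: ((Mp_chart hS m.+1 Sh).2 _); exists c => //; rewrite hE -E exprSr mulrA.
have Dm : (D <= m)%N.
  by rewrite -ltnS DE prednK ?size_poly_gt0 // (leq_trans (size_red _ _)).
have [L0 [e [uL irrL eL sL fL]]] := factorization G0.
pose Tp P := chart_point S x y pi (lift_poly sg P).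
pose Ti := chart_point S y x pi 'X.
have redl P : red (lift_poly sg P) = P := redK lS hpi P.
have Sl P : polyS S (lift_poly sg P) := polyS_lift hpi P.
have irrX := irreducible_redX hS' hpi.
have SX := polySX (regp_sub hS).
have irrP P : P \in L0 -> irreducible_poly (red (lift_poly sg P)) by rewrite redl => /irrL [].
exists ((Ti, m - D)%N :: [seq (Tp P, e P) | P <- L0]).
have EL : [seq v.1 | v <- [seq (Tp P, e P) | P <- L0]] = [seq Tp P | P <- L0].
  by rewrite -map_comp.
split.
- rewrite /= EL; apply/andP; split.
    (* The point at infinity is outside the chart of x: x/y is a non-unit there, while y/x belongs
       to every point of that chart. *)
    apply/negP => /mapP [P PL E].
    have lT := chart_point_lr hS hpi (irrP P PL).
    have : maxid Ti (x / y).
      rewrite -[X in maxid _ X]hornerX; apply/(maxid_chart_pointP hS' hpi irrX SX).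
      exact: dvdpp.
    rewrite E; apply: (lr_unitP lT); first by rewrite mulf_neq0 ?invr_neq0.
    rewrite invf_div; apply: (sub_chart_point hS hpi (irrP P PL)); exact: chart_t.
  rewrite map_inj_in_uniq // => P P' PL PL' E.
  have [iP mP _] := irrL P PL; have [iP' mP' _] := irrL P' PL'.
  have : maxid (Tp P) (lift_poly sg P).[y / x].
    by apply/(maxid_chart_pointP hS hpi (irrP P PL) (Sl P)); apply: dvdpp.
  rewrite E => /(maxid_chart_pointP hS hpi (irrP P' PL') (Sl P)); rewrite !redl => d.
  apply/esym/eqP; rewrite -eqp_monic //; apply: iP => //.
  by case: iP' => s _; rewrite neq_ltn s orbT.
- move=> _ /[!inE] /predU1P[->|/mapP[P PL ->]] /=; last first.
    have [U [EU nU]] := eL P PL.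
    by apply: (chart_point_exc_intersection (q := q) (m := m) (U := U)) => //; rewrite ?redl //; case: (irrL P PL).
  (* In the chart of y the reduction of the strict transform is the reversal of
     G, so 'X occurs in it with the defect m - deg G as exponent. *)
  pose q' := \poly_(j < m.+1) q`_(m - j).
  pose U := \poly_(j < D.+1) G`_(D - j).
  have Sq' : polyS S q'.
    by move=> j; rewrite coef_poly; case: ifP => // _; apply: (subring0 (regp_sub hS)).
  apply: (chart_point_exc_intersection (q := q') (m := m) (U := U)) => //.
  + rewrite hE horner_poly (horner_coef_wide _ sq) !mulr_sumr (reindex_inj rev_ord_inj) /=.
    apply: eq_bigr => j _; have jm : (j <= m)%N by rewrite -ltnS.
    have E z : z ^+ m = z ^+ (m - j) * z ^+ j by rewrite -exprD subnK.
    rewrite subSS !E !exprMn !exprVn; field.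
    by rewrite !expf_neq0.
  + apply/polyP => j; rewrite (coef_red lS hpi) (redX lS hpi) coefXnM [q'`_j]coef_poly [U`_ _]coef_poly.
    have sG : (size G <= D.+1)%N by rewrite DE; apply: leqSpred.
    have [jm|mj] := ltnP j m.+1; last first.
      rewrite (res0 lS hpi) !ifF //; lia.
    rewrite -(coef_red lS hpi) -/G; case: ifP => jD.
      by apply: nth_default; apply: leq_trans sG _; rewrite ltn_subRL addnC -ltn_subRL.
    rewrite ifT; [congr (_`_ _); lia|lia].
  + rewrite (redX lS hpi) -['X]subr0 -polyC0 dvdp_XsubCl /root horner_coef0 coef_poly /= subn0.
    by rewrite DE -lead_coefE lead_coef_eq0.
- move=> T qT; rewrite /= inE negb_or EL => /andP[/eqP nTi nL].
  case: (qt_points hS hpi qT) => [[p [Sp irr TE]]|//].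
  rewrite TE; apply: (chart_point_exc_intersection (q := q) (m := m) (U := G)) => //.
    by rewrite expr0 mul1r.
  apply/negP => dG; move/negP: nL; apply; apply/mapP.
  have p0 := irredp_neq0 irr; have lc0 : (lead_coef (red p))^-1 != 0.
    by rewrite invr_neq0 // lead_coef_eq0.
  pose P := (lead_coef (red p))^-1 *: red p.
  have PE : P %= red p by rewrite eqp_scale.
  exists P; last by rewrite TE; apply: chart_point_eqp; rewrite redl eqp_sym.
  apply: fL; last by rewrite (eqp_dvdl _ PE).
    case: irr => sp ir; split; first by rewrite size_scale.
    by move=> d sd; rewrite (eqp_dvdr _ PE) => /(ir _ sd) /eqp_trans; apply; rewrite eqp_sym.
  by rewrite monicE lead_coefZ mulVf // lead_coef_eq0.
- rewrite big_cons big_map /=.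
  have [_ dTi _] := qt_generator lS (chart_point_qt hS' hpi irrX).
  rewrite (residue_degreeE lS (chart_point_lr hS' hpi irrX) dTi
     (chart_point_residue hS' hpi SX irrX)).
  rewrite (redX lS hpi) size_polyX mul1n (eq_big_seq (fun P : {poly k} => ((size P).-1 * e P)%N)).
    by rewrite sL -DE subnK.
  move=> P PL /=; have iP := irrP P PL.
  have [_ dTP _] := qt_generator lS (chart_point_qt hS hpi iP).
  by rewrite (residue_degreeE lS (chart_point_lr hS hpi iP) dTP
    (chart_point_residue hS hpi (Sl P) iP)) redl.
Qed.

End FirstNeighbourhood.

Lemma map_uniq_inj (T1 T2 : eqType) (f : T1 -> T2) (s : seq T1) :
  uniq [seq f i | i <- s] -> {in s &, injective f}.
Proof.
elim: s => //= a s IH /andP[na us] u v; rewrite !inE.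
move=> /predU1P[->|us'] /predU1P[->|vs] // e; last exact: IH.
  by case/negP: na; rewrite e map_f.
by case/negP: na; rewrite -e map_f.
Qed.

(** * Quadratic sequences *)

Section Chains.
Variable K : fieldType.
Implicit Types (R S T U V I : set K) (h : K) (s : seq (set K)).

Definition regular S := exists x y, regp S x y.

Lemma regular_lr S : regular S -> lr S.
Proof. by case=> x [y hS]; apply: (regp_lr hS). Qed.

Lemma regular_residue_map S : regular S -> exists (k : fieldType) (pi : K -> k) (sg : k -> K),
  residue_map S (maxid S) pi sg.
Proof. by move/regular_lr/residue_map_ex. Qed.

Lemma qt_reg S T : regular S -> quadratic_transform S T ->
  [/\ regular T, dominates S T & ~ T `<=` S].
Proof.
move=> rS qT; have [k [pi [sg hpi]]] := regular_residue_map rS.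
have [x [y hS]] := rS; have [_ dST _] := qt_generator (regp_lr hS) qT.
by split=> //; [exact: (qt_regular hS hpi qT)|exact: qt_strict hS qT].
Qed.

Lemma chain_cat S T U s1 s2 : quadratic_chain S s1 T -> quadratic_chain T s2 U ->
  quadratic_chain S (s1 ++ s2) U.
Proof.
elim: s1 S => [|S1 s1 IH] S /=; first by move=> ->.
by move=> [q c] /(IH _ c).
Qed.

Lemma chain_reg S s T : regular S -> quadratic_chain S s T ->
  [/\ regular T, dominates S T & s != [::] -> ~ T `<=` S].
Proof.
elim: s S => [|S1 s IH] S rS /=; first by move=> <-; split=> //; apply: dominates_refl.
move=> [q c]; have [rS1 d1 n1] := qt_reg rS q; have [rT d2 _] := IH _ rS1 c.
split=> //; first exact: dominates_trans d2.
by move=> _ TS; apply: n1 => a /(d2.1) /TS.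
Qed.

(** [T] dominates the first members of both chains, and [S] has only one quadratic transform
    dominated by [T]. Strict growth excludes that one chain stops earlier. *)
Lemma chain_uniq S s s' T : regular S -> quadratic_chain S s T ->
  quadratic_chain S s' T -> s = s'.
Proof.
elim: s S s' => [|S1 s IH] S [|S1' s'] rS //=.
- move=> <- c; have [_ _ n] := chain_reg rS (c : quadratic_chain S (S1' :: s') S).
  by case: (n isT).
- move=> c E; rewrite -E in c.
  have [_ _ n] := chain_reg rS (c : quadratic_chain S (S1 :: s) S).
  by case: (n isT).
move=> [q c] [q' c']; have [rS1 _ _] := qt_reg rS q; have [rS1' _ _] := qt_reg rS q'.
have [rT d _] := chain_reg rS1 c; have [_ d' _] := chain_reg rS1' c'.
have E := qt_uniq (regular_lr rS) (regular_lr rT) q q' d d'.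
by rewrite -E in c' *; rewrite (IH _ _ rS1 c c').
Qed.

Lemma quadratic_seqE S s T : regular S -> quadratic_chain S s T -> quadratic_seq S T = s.
Proof.
move=> rS c; rewrite /quadratic_seq; case: xgetP => [s' -> c'|/(_ s)//].
exact: chain_uniq c' c.
Qed.

Lemma near_pointsP S T : near_points S T <-> exists s, quadratic_chain S s T.
Proof.
split.
  case=> n _; elim: n T => [|n IH] T /=; first by move=> ->; exists [::].
  move=> [S' /IH [s c] q]; exists (s ++ [:: T]); apply: chain_cat c _; by split.
move=> [s]; suff H n U : near_points_at S n U -> quadratic_chain U s T -> near_points S T.
  exact: (H 0%N).
elim: s n U => [|U1 s IH] n U hU /=; first by move=> <-; exists n.
by move=> [q c]; apply: (IH n.+1 U1) => //; exists U.
Qed.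

Lemma near_reg R S : regular R -> near_points R S -> regular S.
Proof. by move=> rR /near_pointsP [s c]; case: (chain_reg rR c). Qed.

Lemma strict_transform_along_cat S s1 s2 I T : quadratic_chain S s1 T ->
  strict_transform_along S (s1 ++ s2) I =
  strict_transform_along T s2 (strict_transform_along S s1 I).
Proof. by elim: s1 S I => [|S1 s1 IH] S I /=; [move=> ->|move=> [_ /IH]]. Qed.

Lemma strict_transform_trans R S T s I : regular R -> near_points R S ->
  quadratic_chain S s T ->
  strict_transform R T I = strict_transform_along S s (strict_transform R S I).
Proof.
move=> rR /near_pointsP [s0 c0] c; rewrite /strict_transform.
by rewrite (quadratic_seqE rR c0) (quadratic_seqE rR (chain_cat c0 c)) (strict_transform_along_cat _ _ c0).
Qed.

Lemma strict_transform_principal R S h : regular R -> near_points R S -> R h -> h != 0 ->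
  exists h', [/\ S h', h' != 0 & strict_transform R S (pideal R h) = pideal S h'].
Proof.
move=> rR /near_pointsP [s c] Rh h0; rewrite /strict_transform (quadratic_seqE rR c).
elim: s R rR h Rh h0 c => [|S1 s IH] R rR h Rh h0 /=; first by move=> <-; exists h.
move=> [q c]; have [x [y hR]] := rR.
have [lS1 [RS1 _] [g [mg g0 S1g]]] := qt_generator (regp_lr hR) q.
rewrite (strict_transform1E hR q Rh h0 mg g0 S1g); apply: IH => //.
- by case: (qt_reg rR q).
- have [Mh _] := regp_ordP hR Rh h0; move: (ord R h) Mh => n.
  have mE := regp_maxid hR; have sS1 := lr_subring lS1.
  apply: (Mp_div sS1 RS1 g0); apply: S1g; rewrite mE.
    exact: regp_Mx hR.
  exact: regp_My hR.
- by rewrite mulf_neq0 ?invr_neq0 ?expf_neq0.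
Qed.

(** Every member of the chain to [S] is dominated by [T], so by uniqueness the chain to [T] begins
    with the chain to [S]. *)
Lemma chain_between R S T s1 s2 : regular R -> quadratic_chain R s1 S ->
  quadratic_chain R s2 T -> dominates S T -> exists s, quadratic_chain S s T.
Proof.
elim: s1 R s2 => [|S1 s1 IH] R s2 rR /=; first by move=> <- c _; exists s2.
case: s2 => [|T1 s2] /=.
  move=> c <- d; have [_ _ n] := chain_reg rR (c : quadratic_chain R (S1 :: s1) S).
  by case: (n isT); exact: d.1.
move=> [q c] [q' c'] dST; have [rS1 _ _] := qt_reg rR q; have [rT1 _ _] := qt_reg rR q'.
have [_ d _] := chain_reg rS1 c; have [rT d' _] := chain_reg rT1 c'.
have E := qt_uniq (regular_lr rR) (regular_lr rT) q q' (dominates_trans d dST) d'.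
by rewrite -E in c'; apply: (IH S1 s2 rS1 c c' dST).
Qed.

End Chains.

(** * The proximity formula *)

Section ProximitySum.
Variables (K : fieldType) (R S : set K).
Hypotheses (rR : regular R) (nS : near_points R S).
Implicit Types (T U : set K).
Local Notation V := (ord_valuation_ring S).
Local Notation next := (next_pt V).

Let rS : regular S := near_reg rR nS.
Let lS := regular_lr rS.

Lemma qt_on_curve T : quadratic_transform S T ->
  (exists z w, on_curve V T z w) /\ maxid S `<=` maxid V.
Proof.
move=> qT; have [k [pi [sg hpi]]] := regular_residue_map rS; have [x0 [y0 h0]] := rS.
have [x [y [p [hS Sp irr ->]]]] := qt_chart_point h0 hpi qT.
have [lV TV Vx Vp] := chart_point_valuation hS hpi Sp irr.
split; first by exists x, p.[y / x]; split=> //; apply: (chart_point_regp hS hpi Sp irr).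
have BT := sub_chart_point hS hpi irr.
move=> a /(chart_maxid hS) [c Bc ->]; apply: (idealMr (lr_ideal lV)) => //.
by apply: TV; apply: BT.
Qed.

Lemma chain_traject T z w j : on_curve V T z w ->
  quadratic_chain T (traject next (next T) j) (iter j next T) /\
  (exists z', on_curve V (iter j next T) z' w).
Proof.
elim: j T z => [|j IH] T z hT; first by split=> //; exists z.
have [q _ _ hT' _] := next_ptP hT; have [c e] := IH _ _ hT'.
by rewrite iterSr; split.
Qed.

Lemma chain_prox T j : quadratic_transform S T ->
  quadratic_chain S (T :: traject next (next T) j) (iter j next T).
Proof.
move=> qT; have [[z [w hT]] _] := qt_on_curve qT.
by split=> //; case: (chain_traject j hT).
Qed.

Lemma chain_iter_next T s U : quadratic_transform S T -> quadratic_chain T s U ->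
  U `<=` V -> exists j, U = iter j next T.
Proof.
move=> qT; have [[z [w hT]] _] := qt_on_curve qT.
elim: s T z {qT} hT => [|T1 s IH] T z hT /=; first by move=> <- _; exists 0%N.
move=> [q c] UV; have [_ _ uniq hT' _] := next_ptP hT.
have rT : regular T by exists z, w; exact: (oc_regp hT).
have [rT1 _ _] := qt_reg rT q; have [_ d _] := chain_reg rT1 c.
have E : T1 = next T by apply: uniq => // a /(d.1) /UV.
rewrite E in c; have [j ->] := IH _ _ hT' c UV.
by exists j.+1; rewrite iterSr.
Qed.

(** If U is contained in V_S, so are all members of the chain from S to U, and after the first
    neighbourhood each has only one successor inside V_S. *)
Lemma proximateP U : proximate R S U <->
  exists T j, quadratic_transform S T /\ U = iter j next T.
Proof.
split.
  move=> [_ nU [SU nUS] UV].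
  have rU := near_reg rR nU; have lU := regular_lr rU.
  have [s1 c1] := (near_pointsP _ _).1 nS; have [s2 c2] := (near_pointsP _ _).1 nU.
  have dSU : dominates S U.
    split=> // a ma; apply: contrapT => na.
    have [k [pi [sg hpi]]] := regular_residue_map rS; have [x [y hS]] := rS.
    (* Proximity is defined by inclusions only, so domination has to be derived. Any point of the
       first neighbourhood serves to show that V_S dominates S; an element of the maximal ideal of S
       that is a unit in U would then be a unit in V_S. *)
    have [[z [w hT]] mSV] := qt_on_curve (chart_point_qt hS hpi (irreducible_redX hS hpi)).
    have lV := oc_lr hT.
    have Ua : U a by apply: SU; apply: (lr_maxidS lS).
    by move: (mSV _ ma); apply: (lr_unitP lV); [exact: (lr_neq0 lU na)|apply: UV; apply: (lr_inv lU)].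
  have [[|T s] /= c] := chain_between rR c1 c2 dSU; first by case: nUS; rewrite c.
  have [q c'] := c; have [j ->] := chain_iter_next q c' UV.
  by exists T, j.
move=> [T [j [qT ->]]]; have c := chain_prox j qT.
have [s1 c1] := (near_pointsP _ _).1 nS.
have [_ d n] := chain_reg rS c.
have [[z [w hT]] _] := qt_on_curve qT; have [_ [z' hj]] := chain_traject j hT.
split=> //.
- by apply/near_pointsP; exists (s1 ++ T :: traject next (next T) j); apply: chain_cat c.
- by split; [exact: d.1|exact: n].
- exact: (oc_sub hj).
Qed.

(** The chain from S to the point is unique: its first member is the point of the first
    neighbourhood, and its length gives the number of steps. *)
Lemma iter_next_inj T T' j j' : quadratic_transform S T -> quadratic_transform S T' ->
  iter j next T = iter j' next T' -> T = T' /\ j = j'.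
Proof.
move=> qT qT' E; have c := chain_prox j qT; rewrite E in c.
have [-> e] := chain_uniq rS c (chain_prox j' qT'); split=> //.
by have := congr1 size e; rewrite !size_traject.
Qed.

Lemma residue_basis_iter T z w n (b : 'I_n -> K) j : dominates S T -> on_curve V T z w ->
  residue_basis S T b -> residue_basis S (iter j next T) b.
Proof.
elim: j T z => [//|j IH] T z dST hT hb; rewrite iterSr.
have [q _ _ hT' res] := next_ptP hT.
have lT := regp_lr (oc_regp hT); have lT' := regp_lr (oc_regp hT').
have [_ d _] := qt_generator lT q.
apply: (IH _ _ (dominates_trans dST d) hT').
exact: residue_basis_trans res hb.
Qed.

Section Multiplicity.
Variable (I : set K) (h : K).
Hypotheses (Sh : S h) (h0 : h != 0) (hI : strict_transform R S I = pideal S h).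

Let mult U := (residue_degree U S * ordI U (strict_transform R U I))%N.

Lemma sum_mult T i N : exc_intersection S h T i -> (i <= N)%N ->
  (\sum_(0 <= j < N) mult (iter j next T))%N = (residue_degree T S * i)%N.
Proof.
move=> [qT [z [w [h' [u [c [n [b [hT hh E hb]]]]]]]]] iN.
have [lT dST _] := qt_generator lS qT.
rewrite -(sum_orders_on_curve hT hh iN) big_distrr /=; apply: eq_bigr => j _.
have [cj [z' hj]] := chain_traject j hT.
have [_ d _] := chain_reg rS (chain_prox j qT).
rewrite /mult (residue_degreeE lS lT dST hb).
rewrite (residue_degreeE lS (regp_lr (oc_regp hj)) d (residue_basis_iter j dST hT hb)).
by rewrite (strict_transform_trans I rR nS (chain_prox j qT)) hI /= E.
Qed.

(** The partial sums of j and of j + 1 terms agree, as the full value is reached after i terms. *)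
Lemma mult_eq0 T i j : exc_intersection S h T i -> (i <= j)%N -> mult (iter j next T) = 0%N.
Proof.
move=> hT ij; have := sum_mult hT (leqW ij).
rewrite big_nat_recr //= (sum_mult hT ij) => /eqP.
by rewrite -[X in _ == X]addn0 eqn_add2l => /eqP.
Qed.

Lemma proximity_sum :
  finite_set [set T | proximate R S T /\ mult T <> 0%N] /\
  ordI S (strict_transform R S I) =
    \big[addn/0%N]_(T \in [set T | proximate R S T]) mult T.
Proof.
have [k [pi [sg hpi]]] := regular_residue_map rS; have [x [y hS]] := rS.
have [L [uL dL nL sL]] := first_neighbourhood hpi hS Sh h0.
(* Over a point with intersection multiplicity i only its first i successors along the exceptional
   curve, itself included, can contribute. This list contains the support and carries the sum. *)
pose pts := [seq iter j next Ti.1 | Ti <- L, j <- iota 0 Ti.2].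
have ptsP U : U \in pts -> proximate R S U.
  move=> /allpairsPdep [Ti [j [TiL _ ->]]]; apply/proximateP.
  by exists Ti.1, j; split=> //; case: (dL _ TiL).
have out U : proximate R S U -> U \notin pts -> mult U = 0%N.
  move=> /proximateP [T [j [qT ->]]] nU.
  have [/mapP[Ti TiL TE]|nT] := boolP (T \in [seq Ti.1 | Ti <- L]); last first.
    exact: (mult_eq0 (nL T qT nT)).
  rewrite TE in nU *; apply: (mult_eq0 (dL _ TiL)).
  rewrite leqNgt; apply: contra nU => lt; apply/allpairsPdep.
  by exists Ti, j; split=> //; rewrite mem_iota.
have upts : uniq pts.
  apply: allpairs_uniq_dep => [|Ti _|]; first exact: map_uniq uL.
    exact: iota_uniq.
  move=> p p' /allpairsPdep [t [j [tL _ ->]]] /allpairsPdep [t' [j' [t'L _ ->]]] /= E.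
  have [qt _] := dL t tL; have [qt' _] := dL t' t'L.
  have [e ->] := iter_next_inj qt qt' E.
  by rewrite (map_uniq_inj uL tL t'L e).
split.
  apply: (sub_finite_set _ (finite_seq pts)) => U [pU mU] /=.
  by apply: contrapT => /negP nU; apply: mU; apply: out.
rewrite hI (regp_ordI hS Sh h0) -sL.
rewrite (fsbigE pts) //.
rewrite [RHS](_ : _ = \sum_(U <- pts) mult U)%N; last first.
  rewrite big_mkcond; apply: eq_big_seq => U /ptsP pU.
  by rewrite ifT //; apply/mem_set.
rewrite big_allpairs_dep; apply: eq_big_seq => t tL.
rewrite -(sum_mult (dL t tL) (leqnn _)) /index_iota subn0 //.
Qed.

End Multiplicity.
End ProximitySum.

(** * Application to the curve and to curvettes *)

Section Main.
Variable K : fieldType.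
Implicit Types (R S T I : set K) (f g h : K).

Lemma blowups_near R (C X : set (set K)) : blowups R C X ->
  C `<=` near_points R /\ X `<=` near_points R.
Proof.
elim=> [|{}C {}X S _ [CN XN] XS].
  split=> [_ ->|T qT]; first by exists 0%N.
  by exists 1%N => //; exists R.
split=> [U [->|/CN //]|U [[/XN //]|qU]]; first exact: XN.
by have [n _ hn] := XN _ XS; exists n.+1 => //; exists S.
Qed.

Lemma proximity_formula R S h : regular R -> near_points R S -> R h -> h != 0 ->
  let mult T := (residue_degree T S * ordI T (strict_transform R T (pideal R h)))%N in
  finite_set [set T | proximate R S T /\ mult T <> 0%N] /\
  ordI S (strict_transform R S (pideal R h)) =
    \big[addn/0%N]_(T \in [set T | proximate R S T]) mult T.
Proof.
move=> rR nS Rh h0 mult; have [h' [Sh' h'0 E]] := strict_transform_principal rR nS Rh h0.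
exact: (proximity_sum rR nS Sh' h'0 E).
Qed.

(** No principal ideal is empty, so the junk value of one step persists along the rest of the
    chain. *)
Lemma strict_transform_along_set0 S (s : seq (set K)) T : regular S ->
  quadratic_chain S s T -> strict_transform_along S s set0 = set0.
Proof.
elim: s S => //= S1 s IH S rS [q c]; have [rS1 _ _] := qt_reg rS q.
rewrite (_ : strict_transform1 _ _ _ = set0); first exact: IH c.
apply/seteqP; split=> // z [x [h [_ _ E _]]].
have : pideal S h (h * 1) by exists 1 => //; apply: subring1; apply: lr_subring (regular_lr rS).
by rewrite -E.
Qed.

(* The strict transform of an ideal that is not principal is the empty set, which
   has no order. *)
Lemma curvette_principal R f T g : regular R -> curvette R f T g ->
  exists h, [/\ R h, h != 0 & pideal T g `&` R = pideal R h].
Proof.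
move=> rR [[nT Tg] _ [x [xE xg]] ordT _]; have lR := regular_lr rR; have sR := lr_subring lR.
set I := pideal T g `&` R; have [s c] := (near_pointsP _ _).1 nT.
apply: contrapT => H; move: ordT xE; rewrite /strict_transform /exc_div (quadratic_seqE rR c).
(* If T = R, the exceptional divisor is the unit ideal by convention, and the parameter x generating
   it would be a unit. *)
case: s c => [|S1 s] /=.
  move=> RT _ RE; rewrite -RT in RE xg.
  have [a Ra xa] : pideal R x 1 by rewrite -RE; apply: subring1.
  have mx : maxid R x by rewrite xg; apply: ideal_genS; left.
  by apply: (lr_not1 lR); rewrite -xa; apply: (idealMr (lr_ideal lR)).
move=> [q c] + _; have [rS1 _ _] := qt_reg rR q.
have -> : strict_transform1 R S1 I = set0.
  apply/seteqP; split=> // z [y [h [_ h0 E _]]]; apply: H; exists h; split=> //.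
  have : I h by rewrite E; exists 1; [exact: subring1|rewrite mulr1].
  by case.
rewrite (strict_transform_along_set0 rS1 c) /ordI; case: xgetP => // m _ [[h []]] //.
Qed.

End Main.

Theorem theorem6p5 (K : fieldType) (R : set K) (f : K) (C : set (set K))
    (regR : regular_local_ring R 2) (fracR : is_quotient_field R)
    (Rf : R f) (f_neq0 : f != 0) (resC : resolution_cluster R f C) :
  (forall S : set K, C S ->
     let mult (T : set K) :=
       (residue_degree T S * ordI T (strict_transform R T (pideal R f)))%N in
     finite_set [set T | proximate R S T /\ mult T <> 0%N] /\
     ordI S (strict_transform R S (pideal R f)) =
       \big[addn/0%N]_(T \in [set T | proximate R S T]) mult T) /\
  (forall (S T : set K) (g : K), C S -> near_points R T -> curvette R f T g ->
     let I := pideal T g `&` R in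
     let mult (T' : set K) :=
       (residue_degree T' S * ordI T' (strict_transform R T' I))%N in
     finite_set [set T' | proximate R S T' /\ mult T' <> 0%N] /\
     ordI S (strict_transform R S I) =
       \big[addn/0%N]_(T' \in [set T' | proximate R S T']) mult T').
Proof.
have rR : regular R := regular_regp regR fracR.
have [X [/blowups_near [CN _] _]] := resC.
split=> [S CS|S T g CS _ /(curvette_principal rR) [h [Rh h0 ->]]] /=.
  exact: proximity_formula (CN _ CS) Rf f_neq0.
exact: proximity_formula (CN _ CS) Rh h0.
Qed.
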